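(* Let $m\geq -1/2$, $s>1/2$, $\mu:=\min\{2\sqrt{1+m},\ \tfrac32\sqrt{4+m}\}$, and assume that the initial data satisfy $u_0\in H^{s+2}_*$, $v_0\in H^{s}_*$ and $$\varepsilon:=\max\{|u_0|_1\,,\ |v_0|_{\tilde H^{-1}}\}\ \leq\ \varepsilon_0:=0.08\sqrt\mu\,.$$ Then there exists $N$ such that the weak solution $u(t,x)$ of the beam equation $$u_{tt}+u_{xxxx}-\Big(m+\frac1{2\pi}\int_0^\pi u_x^2\,dx\Big)u_{xx}=0$$ with hinged-hinged boundary conditions and initial data $u(0,x)=u_0(x)$, $u_t(0,x)=v_0(x)$ satisfies $$u(t,\cdot)\in H^{s+2}_*\,,\qquad |u(t,\cdot)|_{H^{s+2}_N}\leq 1.9\,\varepsilon\,,\qquad \sup_{x\in[0,\pi]}|u(t,x)|\leq 2\varepsilon\,,\qquad \forall\,|t|\leq T_0\,\mu\,\varepsilon^{-4}\,,$$ where $$T_0=0.948\,\frac{1-c_\dag c_*\varepsilon^2/\mu}{c_\dag c_*^2}\,,\qquad c_*:=\Big(\frac{11}{10}\Big)^2\Big(\frac56-\frac1{80e}\Big)^{-2}\,,\qquad c_\dag:=\frac{44e}{\pi}\,.$$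
   Context: $\mathbb N=\{1,2,3,\dots\}$, $x\in[0,\pi]$, $t\in\mathbb R$, $\omega_j:=\sqrt{j^4+mj^2}$ and $\phi_j(x):=\sqrt{2/\pi}\,\sin(jx)$ for $j\in\mathbb N$. For $s\ge 0$, $H^s_*$ is the Hilbert space of functions $u(x)=\sum_{j\in\mathbb N}u_j\phi_j(x)$, $u_j\in\mathbb R$, with finite norm $|u|_s:=\big(\sum_{j\in\mathbb N}u_j^2j^{2s}\big)^{1/2}$. For an integer $N\ge1$ define the (equivalent) norm on $H^s_*$ by $$|u|_{H^{s}_N}^2:=\sum_{j\leq N}j^{2}u_{j}^2+\sum_{j> N}j^{2s}u_{j}^2\,,$$ so that $|u|_{H^{s+2}_N}^2=\sum_{j\leq N}j^{2}u_{j}^2+\sum_{j> N}j^{2s+4}u_{j}^2$. Moreover $$|v|_{\tilde H^{-1}}^2:=\sum_{j\geq 1}\frac{j^{2}}{\omega_j^2}v_{j}^2\,.$$ The hinged-hinged boundary conditions are $u(t,0)=u(t,\pi)=u_{xx}(t,0)=u_{xx}(t,\pi)=0$. Weak solution: given an open interval of times $\mathcal I\ni 0$, $s>1/2$, and initial data $u_0\in H^{s+2}_*$, $v_0\in H^s_*$, a $C^2$ function $t\mapsto u(t,\cdot)\in H^{s+2}_*$ is a weak solution of the equation with data $(u_0,v_0)$ if $u(0,x)=u_0(x)$, $u_t(0,x)=v_0(x)$ and, for every test function $\eta\in C^\infty_c((0,\pi))$ and every $t\in\mathcal I$, $$\int_0^{\pi}\Big[u_{tt}\eta+u_{xx}\eta_{xx}+\Big(m+\frac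 1{2\pi}\int_0^{\pi}u_x^2\,dx\Big) u_x \eta_x\Big]dx=0\,.$$
   Formalization: Weak solutions are taken in C^0(H^{s+2}) ∩ C^1(H^s) ∩ C^2(H^{s-2}), with the integral of u_tt η read as a duality pairing, since a C^2 map into H^{s+2} is impossible when u_t(0)=v_0 lies only in H^s. *)

(* Defs.v *)
From Stdlib Require Import Reals Lra.
From Coquelicot Require Import Coquelicot.
Open Scope R_scope.

(* Sequences of Fourier coefficients have type [nat -> R]; only the indices
   j >= 1, written [S n] under [Series], are ever used. *)

Definition phi (j : nat) (x : R) : R := sqrt (2 / PI) * sin (INR j * x).

Definition omega (m : R) (j : nat) : R := sqrt (INR j ^ 4 + m * INR j ^ 2).

Definition coef (f : R -> R) (j : nat) : R := RInt (fun x => f x * phi j x) 0 PI.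

(* Sum over j of c_j^2 j^(2r) is finite. The exponent r may be negative: this is
   needed for the second time derivative of a solution. *)
Definition in_h (r : R) (c : nat -> R) : Prop :=
  ex_series (fun n => c (S n) ^ 2 * Rpower (INR (S n)) (2 * r)).

Definition h_norm (r : R) (c : nat -> R) : R :=
  sqrt (Series (fun n => c (S n) ^ 2 * Rpower (INR (S n)) (2 * r))).

(* The space H^s_*. Functions live on [0, PI]; their values elsewhere are
   irrelevant. Only exponents s > 1/2 are used: then finiteness of the norm makes
   the sine series converge absolutely and uniformly, so requiring pointwise
   equality just selects the continuous representative. *)
Definition in_H (s : R) (f : R -> R) : Prop :=
  in_h s (coef f) /\
  forall x, 0 <= x <= PI -> is_series (fun n => coef f (S n) * phi (S n) x) (f x).

Definition H_norm (s : R) (f : R -> R) : R := h_norm s (coef f).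

Definition HN_norm (s : R) (N : nat) (f : R -> R) : R :=
  sqrt (sum_n_m (fun j => INR j ^ 2 * coef f j ^ 2) 1 N
        + Series (fun n => Rpower (INR (S N + n)) (2 * s) * coef f (S N + n) ^ 2)).

Definition Htilde_norm (m : R) (f : R -> R) : R :=
  sqrt (Series (fun n => INR (S n) ^ 2 / omega m (S n) ^ 2 * coef f (S n) ^ 2)).

Definition sup_abs (f : R -> R) : Rbar :=
  Lub_Rbar (fun y => exists x, 0 <= x <= PI /\ y = Rabs (f x)).

Definition in_interval (a b : Rbar) (t : R) : Prop := Rbar_lt a t /\ Rbar_lt t b.

Definition h_continuous (a b : Rbar) (r : R) (c : R -> nat -> R) : Prop :=
  forall t, in_interval a b t ->
    in_h r (c t) /\
    filterlim (fun tau => h_norm r (fun j => c tau j - c t j)) (locally t) (locally 0).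

Definition h_derivative (a b : Rbar) (r : R) (c d : R -> nat -> R) : Prop :=
  forall t, in_interval a b t ->
    in_h r (c t) /\ in_h r (d t) /\
    filterlim (fun tau => h_norm r (fun j => (c tau j - c t j) / (tau - t) - d t j))
      (locally' t) (locally 0).

Definition test_function (eta : R -> R) : Prop :=
  (forall n x, ex_derive_n eta n x) /\
  exists a b, 0 < a /\ a < b /\ b < PI /\ forall x, x < a \/ b < x -> eta x = 0.

(* Weak solutions on the open interval (a, b) containing 0. The initial velocity
   is only in H^s_*, so u cannot be twice differentiable with values in
   H^(s+2)_*; the C^2 regularity in time is the one natural for the equation:
   u in C^0(H^(s+2)_* ), u_t in C^0(H^s_* ), u_tt in C^0(H^(s-2)_* ), where v and
   w are the coefficients of u_t and u_tt. Since s - 2 may be negative, the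
   integral of u_tt eta is the duality pairing (equal to the integral, by
   Parseval, as soon as u_tt is square integrable).
   The hinged-hinged boundary conditions are carried by u(t) in H^(s+2)_*. *)
Definition weak_solution (m s : R) (u0 v0 : R -> R) (a b : Rbar)
    (u : R -> R -> R) : Prop :=
  in_interval a b 0 /\
  (forall t, in_interval a b t -> in_H (s + 2) (u t)) /\
  (forall x, 0 <= x <= PI -> u 0 x = u0 x) /\
  (forall x, 0 <= x <= PI -> is_derive (fun t => u t x) 0 (v0 x)) /\
  exists v w : R -> nat -> R,
    h_continuous a b (s + 2) (fun t => coef (u t)) /\
    h_derivative a b s (fun t => coef (u t)) v /\
    h_continuous a b s v /\
    h_derivative a b (s - 2) v w /\
    h_continuous a b (s - 2) w /\
    forall eta t, test_function eta -> in_interval a b t ->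
      Series (fun n => w t (S n) * coef eta (S n))
      + RInt (fun x =>
          Derive_n (u t) 2 x * Derive_n eta 2 x
          + (m + 1 / (2 * PI) * RInt (fun y => Derive (u t) y ^ 2) 0 PI)
            * Derive (u t) x * Derive eta x) 0 PI = 0.

Definition mu (m : R) : R := Rmin (2 * sqrt (1 + m)) (3 / 2 * sqrt (4 + m)).

Definition epsilon (m : R) (u0 v0 : R -> R) : R :=
  Rmax (H_norm 1 u0) (Htilde_norm m v0).

Definition c_star : R := (11 / 10) ^ 2 / (5 / 6 - 1 / (80 * exp 1)) ^ 2.

Definition c_dag : R := 44 * exp 1 / PI.

Definition T0 (m eps : R) : R :=
  948 / 1000 * ((1 - c_dag * c_star * eps ^ 2 / mu m) / (c_dag * c_star ^ 2)).

(* |t| <= T0 mu eps^(-4), where eps^(-4) is infinite for eps = 0. *)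
Definition within_lifespan (m eps t : R) : Prop :=
  eps = 0 \/ Rabs t <= T0 m eps * mu m / eps ^ 4.

(* Main.v *)
Require Import Defs.
From Stdlib Require Import Reals Lra Lia Psatz Factorial.
From Coquelicot Require Import Coquelicot.
Open Scope R_scope.

(** In the sine basis the equation becomes a system of oscillators
      [u_j'' = - j^2 (j^2 + m + A) u_j],   [A = (1 / 2 pi) sum_k k^2 u_k^2],
    which interact only through the common scalar [A], called [kirch] below.

    The weighted norm comes for free: given a bound on [A], mode [j] is bounded by its initial
    amplitude times [exp (C |t|)], with the same [C] for all modes. On a bounded time interval
    the high modes are therefore uniformly small in [H^(s+2)], and [N] may be chosen after the
    solution so that they do not count ([lifespan_control]). What has to be controlled for a
    long time is the energy [E = sum_j j^2 (u_j^2 + v_j^2 / omega_j^2)], which is at most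
    [2 eps^2] at time zero: if it stays below [5/2 eps^2], both norm estimates follow, the one
    on the supremum by the Cauchy-Schwarz inequality.

    The derivative of [E] is of order four in the amplitude, which gives times of order
    [eps^-2] only. One step of Birkhoff normal form reaches [eps^-4]: the quartic [corrector]
    cancels the quartic terms and leaves a derivative bounded by [E^3 / (1 + m)]
    ([is_derive_corrected], [actions_growth]). The corrector is explicit, and its denominators
    [j^2 + m] and [j^2 + k^2 + m] are at least [1 + m], while [mu <= 3 (1 + m)]. A continuity
    argument then closes the estimate with much room in the constants ([long_time_energy]).
    The normal form is applied to finitely many modes, with an error that disappears as their
    number grows, so that all sums differentiated in time are finite.

    Existence: the Duhamel formula gains [1 / omega_j], of order [j^-2], which compensates the
    factor [j^2] of the stiffness. Once the stiffness is truncated, Picard iteration converges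
    for all times, with bounds mode by mode ([truncated_solution]); the energy estimate shows
    that the truncation is not felt during the lifespan.

    Uniqueness: test functions are supported away from the end points, so that the
    eigenfunctions are not among them, and [u_tt] is only in [h^(s-2)]. That the residual of
    the equation of each mode vanishes is a form of the lemma of du Bois-Reymond
    ([coef_zero_of_test]). The difference of two solutions of the resulting system is then
    estimated in the energy space [H^2 x L^2] ([modes_unique]). *)

(** * Limits and series *)

Lemma ex_series_ext_R (a b : nat -> R) : (forall n, a n = b n) -> ex_series a -> ex_series b.
Proof. apply (ex_series_ext (V := R_NormedModule)). Qed.

Lemma is_derive_cont (f : R -> R) (x l : R) : is_derive f x l -> continuous f x.
Proof. intros H. apply (ex_derive_continuous (V := R_NormedModule)). now exists l. Qed.

Global Instance locally'_R_filter (x : R) : Filter (locally' x).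
Proof. apply within_filter, locally_filter. Qed.

Lemma tends_iff {T} (F : (T -> Prop) -> Prop) {FF : Filter F} (f : T -> R) (l : R) :
  filterlim f F (locally l) <-> forall eps, 0 < eps -> F (fun x => Rabs (f x - l) < eps).
Proof.
  split.
  - intros H eps He.
    apply (proj1 (filterlim_locally f l) H (mkposreal eps He)).
  - intros H. apply filterlim_locally. intros eps.
    exact (H eps (cond_pos eps)).
Qed.

Lemma tends_const {T} (F : (T -> Prop) -> Prop) {FF : Filter F} (l : R) :
  filterlim (fun _ : T => l) F (locally l).
Proof. apply filterlim_const. Qed.

Lemma tends_plus {T} (F : (T -> Prop) -> Prop) {FF : Filter F} (f g : T -> R) (a b : R) :
  filterlim f F (locally a) -> filterlim g F (locally b) ->
  filterlim (fun x => f x + g x) F (locally (a + b)).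
Proof.
  intros Hf Hg. eapply filterlim_comp_2; [exact Hf | exact Hg |].
  apply (filterlim_plus (V := R_NormedModule) a b).
Qed.

Lemma tends_mult {T} (F : (T -> Prop) -> Prop) {FF : Filter F} (f g : T -> R) (a b : R) :
  filterlim f F (locally a) -> filterlim g F (locally b) ->
  filterlim (fun x => f x * g x) F (locally (a * b)).
Proof.
  intros Hf Hg. eapply filterlim_comp_2; [exact Hf | exact Hg |].
  apply (filterlim_mult (K := R_AbsRing) a b).
Qed.

Lemma tends_opp {T} (F : (T -> Prop) -> Prop) {FF : Filter F} (f : T -> R) (a : R) :
  filterlim f F (locally a) -> filterlim (fun x => - f x) F (locally (- a)).
Proof.
  intros Hf. eapply filterlim_comp; [exact Hf |].
  apply (filterlim_opp (V := R_NormedModule) a).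
Qed.

Lemma tends_minus {T} (F : (T -> Prop) -> Prop) {FF : Filter F} (f g : T -> R) (a b : R) :
  filterlim f F (locally a) -> filterlim g F (locally b) ->
  filterlim (fun x => f x - g x) F (locally (a - b)).
Proof.
  intros Hf Hg. apply (tends_plus F); [exact Hf | apply (tends_opp F), Hg].
Qed.

Lemma tends_comp {T} (F : (T -> Prop) -> Prop) {FF : Filter F} (f : T -> R) (g : R -> R) (a : R) :
  filterlim f F (locally a) -> continuous g a ->
  filterlim (fun x => g (f x)) F (locally (g a)).
Proof. intros Hf Hg. eapply filterlim_comp; [exact Hf | exact Hg]. Qed.

Lemma tends_squeeze {T} (F : (T -> Prop) -> Prop) {FF : Filter F} (f g : T -> R) (l : R) :
  F (fun x => Rabs (f x - l) <= g x) -> filterlim g F (locally 0) ->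
  filterlim f F (locally l).
Proof.
  intros H Hg. apply (tends_iff F). intros eps He.
  apply (proj1 (tends_iff F g 0)) with (eps := eps) in Hg; [|exact He].
  generalize (filter_and _ _ H Hg). apply filter_imp.
  intros x [H1 H2]. rewrite Rminus_0_r in H2.
  apply Rabs_def2 in H2. lra.
Qed.

Lemma ex_series_dom (a b : nat -> R) :
  (forall n, Rabs (a n) <= b n) -> ex_series b -> ex_series a.
Proof. intros H Hb. apply (ex_series_le (V := R_CompleteNormedModule)) with b; assumption. Qed.

Lemma ex_series_scal_R (c : R) (a : nat -> R) :
  ex_series a -> ex_series (fun n => c * a n).
Proof. intros H. apply (ex_series_scal (V := R_NormedModule) c a H). Qed.

Lemma ex_series_plus_R (a b : nat -> R) :
  ex_series a -> ex_series b -> ex_series (fun n => a n + b n).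
Proof. intros Ha Hb. apply (ex_series_plus (V := R_NormedModule) a b Ha Hb). Qed.

Lemma Rabs_Series_le (a b : nat -> R) :
  (forall n, Rabs (a n) <= b n) -> ex_series b -> Rabs (Series a) <= Series b.
Proof.
  intros H Hb.
  assert (Ha : ex_series (fun n => Rabs (a n))).
  { apply ex_series_dom with b; [|exact Hb]. intros n. rewrite Rabs_Rabsolu. apply H. }
  eapply Rle_trans; [apply Series_Rabs, Ha|].
  apply Series_le; [|exact Hb]. intros n. split; [apply Rabs_pos | apply H].
Qed.

Lemma Series_nonneg (a : nat -> R) : (forall n, 0 <= a n) -> ex_series a -> 0 <= Series a.
Proof.
  intros H Ha.
  rewrite <- (Rmult_0_l (Series a)), <- Series_scal_l.
  apply Series_le; [|exact Ha]. intros n. rewrite Rmult_0_l. split; [lra | apply H].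
Qed.

Lemma Series_split (a : nat -> R) (N : nat) :
  ex_series a -> Series a = sum_n a N + Series (fun k => a (S N + k)%nat).
Proof.
  intros H. rewrite sum_n_Reals. apply (Series_incr_n a (S N)); [lia | exact H].
Qed.

Lemma ex_series_shift (a : nat -> R) (N : nat) :
  ex_series a -> ex_series (fun k => a (N + k)%nat).
Proof. intros H. apply (ex_series_incr_n (V := R_NormedModule) a N), H. Qed.

Lemma sum_n_le_Series (a : nat -> R) (N : nat) :
  (forall n, 0 <= a n) -> ex_series a -> sum_n a N <= Series a.
Proof.
  intros H Ha. rewrite (Series_split a N Ha).
  assert (0 <= Series (fun k => a (S N + k)%nat)); [|lra].
  apply Series_nonneg; [intros; apply H | apply ex_series_shift, Ha].
Qed.

Lemma term_le_Series (a : nat -> R) (N : nat) :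
  (forall n, 0 <= a n) -> ex_series a -> a N <= Series a.
Proof.
  intros H Ha. eapply Rle_trans; [|apply (sum_n_le_Series a N H Ha)].
  destruct N as [|N]; [rewrite sum_O; lra|].
  rewrite sum_Sn. unfold plus; simpl.
  assert (0 <= sum_n a N); [|lra].
  rewrite sum_n_Reals. apply cond_pos_sum, H.
Qed.

Lemma Series_tail_small (a : nat -> R) (eps : R) :
  ex_series a -> 0 < eps ->
  exists N0, forall N, (N0 <= N)%nat -> Rabs (Series (fun k => a (S N + k)%nat)) < eps.
Proof.
  intros Ha He.
  destruct (proj1 (tends_iff eventually (sum_n a) _) (Series_correct a Ha) eps He) as [N0 HN].
  exists N0. intros N HNN. specialize (HN N HNN). simpl in HN.
  rewrite (Series_split a N Ha) in HN.
  rewrite <- Rabs_Ropp.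
  eapply Rle_lt_trans; [|exact HN]. right. f_equal. ring.
Qed.

Lemma tends_sum_n {T} (F : (T -> Prop) -> Prop) {FF : Filter F} (f : T -> nat -> R)
    (l : nat -> R) (N : nat) :
  (forall n, filterlim (fun x => f x n) F (locally (l n))) ->
  filterlim (fun x => sum_n (f x) N) F (locally (sum_n l N)).
Proof.
  intros H. induction N as [|N IH].
  - rewrite sum_O. eapply filterlim_ext; [|exact (H 0%nat)]. intros x. now rewrite sum_O.
  - rewrite sum_Sn. eapply filterlim_ext; [|exact (tends_plus F _ _ _ _ IH (H (S N)))].
    intros x. now rewrite sum_Sn.
Qed.

(** Dominated convergence for series. Every passage to the limit below (continuity and
    differentiability in time in the sequence spaces, differentiation of sine series in
    space, convergence of mollifiers) is an instance of it. *)
Lemma Series_dominated {T} (F : (T -> Prop) -> Prop) {FF : Filter F}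
    (f : T -> nat -> R) (l M : nat -> R) :
  ex_series M -> F (fun x => forall n, Rabs (f x n) <= M n) ->
  (forall n, Rabs (l n) <= M n) ->
  (forall n, filterlim (fun x => f x n) F (locally (l n))) ->
  filterlim (fun x => Series (f x)) F (locally (Series l)).
Proof.
  intros HM Hf Hl Hlim. apply (tends_iff F). intros eps He.
  destruct (Series_tail_small M (eps / 3) HM) as [N HN]; [lra|].
  specialize (HN N (le_n N)).
  assert (Hs := proj1 (tends_iff F _ _) (tends_sum_n F f l N Hlim) (eps / 3) ltac:(lra)).
  generalize (filter_and _ _ Hf Hs). apply filter_imp. intros x [H1 H2].
  rewrite (Series_split (f x) N) by (apply ex_series_dom with M; assumption).
  rewrite (Series_split l N) by (apply ex_series_dom with M; assumption).
  assert (HMt := ex_series_shift M (S N) HM).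
  assert (A1 := Rabs_Series_le (fun k => f x (S N + k)%nat) (fun k => M (S N + k)%nat)
     (fun k => H1 _) HMt).
  assert (A2 := Rabs_Series_le (fun k => l (S N + k)%nat) (fun k => M (S N + k)%nat)
     (fun k => Hl _) HMt).
  apply Rabs_def2 in H2. apply Rabs_def2 in HN. apply Rabs_le_between in A1.
  apply Rabs_le_between in A2. apply Rabs_def1; lra.
Qed.

Lemma is_derive_tends (f : R -> R) (x l : R) :
  is_derive f x l <->
  filterlim (fun y => (f y - f x) / (y - x)) (locally' x) (locally l).
Proof.
  rewrite is_derive_Reals. split.
  - intros H. apply (tends_iff (locally' x)).
    intros eps He. destruct (H eps He) as [d Hd].
    exists d. intros y Hy Hne.
    assert (Hy' : Rabs (y - x) < d) by exact Hy.
    specialize (Hd (y - x) (Rminus_eq_contra _ _ Hne) Hy').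
    now rewrite Rplus_minus in Hd.
  - intros H eps He.
    assert (H' := proj1 (tends_iff _ _ _) H eps He).
    destruct H' as [d Hd]. exists d. intros h Hh Hhd.
    assert (Hb : ball x d (x + h)).
    { change (Rabs ((x + h) - x) < d). now replace (x + h - x) with h by ring. }
    specialize (Hd (x + h) Hb ltac:(lra)). simpl in Hd.
    replace (x + h - x) with h in Hd by ring. exact Hd.
Qed.

Lemma slope_le (f f' : R -> R) (M x y : R) :
  (forall z, Rmin x y <= z <= Rmax x y -> is_derive f z (f' z) /\ Rabs (f' z) <= M) ->
  Rabs (f y - f x) <= M * Rabs (y - x).
Proof.
  intros H.
  destruct (MVT_gen f x y f') as [c [Hc Heq]].
  - intros z Hz. apply H. lra.
  - intros z Hz. apply derivable_continuous_pt. exists (f' z).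
    apply is_derive_Reals, H. exact Hz.
  - rewrite Heq, Rabs_mult. apply Rmult_le_compat_r; [apply Rabs_pos|]. apply H, Hc.
Qed.

(** Termwise differentiation: the difference quotients are dominated because of the mean
    value theorem. *)
Lemma is_derive_Series (f f' : nat -> R -> R) (M : nat -> R) (x d : R) :
  0 < d -> ex_series M -> ex_series (fun n => f n x) ->
  (forall n y, Rabs (y - x) < d -> is_derive (f n) y (f' n y) /\ Rabs (f' n y) <= M n) ->
  is_derive (fun y => Series (fun n => f n y)) x (Series (fun n => f' n x)).
Proof.
  intros Hd HM Hx H. apply is_derive_tends.
  assert (Hdom : forall y, Rabs (y - x) < d -> forall n,
            Rabs (f n y - f n x) <= M n * Rabs (y - x)).
  { intros y Hy n. apply slope_le with (f' n). intros z Hz. apply H.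
    unfold Rmin, Rmax in Hz. destruct (Rle_dec x y) in Hz;
    apply Rabs_def2 in Hy; apply Rabs_def1; lra. }
  assert (Hex : forall y, Rabs (y - x) < d -> ex_series (fun n => f n y - f n x)).
  { intros y Hy. apply ex_series_dom with (fun n => Rabs (y - x) * M n).
    - intros n. rewrite Rmult_comm. apply Hdom, Hy.
    - apply ex_series_scal_R, HM. }
  eapply (filterlim_ext_loc (F := locally' x)
    (fun y => Series (fun n => (f n y - f n x) / (y - x)))).
  { exists (mkposreal d Hd). intros y Hy Hne. change (Rabs (y - x) < d) in Hy.
    unfold Rdiv. rewrite Series_scal_r. f_equal.
    rewrite <- Series_minus.
    - apply Series_ext. intros n. reflexivity.
    - apply (ex_series_ext_R (fun n => f n x + (f n y - f n x))).
      + intros n. simpl. ring.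
      + apply ex_series_plus_R; [exact Hx | apply Hex, Hy].
    - exact Hx. }
  apply Series_dominated with M.
  - apply within_filter, locally_filter.
  - exact HM.
  - exists (mkposreal d Hd). intros y Hy Hne n. change (Rabs (y - x) < d) in Hy.
    unfold Rdiv. rewrite Rabs_mult, Rabs_inv.
    assert (0 < Rabs (y - x)) by (apply Rabs_pos_lt; lra).
    apply Rmult_le_reg_r with (Rabs (y - x)); [assumption|].
    rewrite Rmult_assoc, Rinv_l by lra. rewrite Rmult_1_r. apply Hdom, Hy.
  - intros n. apply H. unfold Rminus. rewrite Rplus_opp_r, Rabs_R0. exact Hd.
  - intros n. apply is_derive_tends, H. unfold Rminus. rewrite Rplus_opp_r, Rabs_R0. exact Hd.
Qed.

(** * Weighted sequence spaces *)

Lemma S_ge_1 n : 1 <= INR (S n).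
Proof. rewrite S_INR. assert (H := pos_INR n). lra. Qed.

Lemma S_pos n : 0 < INR (S n).
Proof. assert (H := S_ge_1 n). lra. Qed.

Lemma Rpower_pos x y : 0 < Rpower x y.
Proof. apply exp_pos. Qed.

Lemma Rpower_sqr x y : Rpower x y ^ 2 = Rpower x (2 * y).
Proof. replace (2 * y) with (y + y) by ring. rewrite Rpower_plus. ring. Qed.

Lemma Rpower_S_pow n k : Rpower (INR (S n)) (INR k) = INR (S n) ^ k.
Proof. apply Rpower_pow, S_pos. Qed.

Lemma Rpower_S_le n x y : x <= y -> Rpower (INR (S n)) x <= Rpower (INR (S n)) y.
Proof. intros H. apply Rle_Rpower; [apply S_ge_1 | exact H]. Qed.

Lemma Rpower_S_ge_1 n x : 0 <= x -> 1 <= Rpower (INR (S n)) x.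
Proof.
  intros H. rewrite <- (Rpower_O (INR (S n))); [|apply S_pos]. apply Rpower_S_le, H.
Qed.

Lemma ex_series_telescope (a : nat -> R) (l : R) :
  is_lim_seq a l -> ex_series (fun n => a n - a (S n)).
Proof.
  intros H. exists (a 0%nat - l).
  apply (tends_iff eventually). intros eps He.
  apply is_lim_seq_incr_1 in H.
  generalize (proj1 (tends_iff eventually _ _) H eps He). apply filter_imp.
  intros n Hn.
  assert (E : sum_n (fun n => a n - a (S n)) n = a 0%nat - a (S n)).
  { clear. induction n as [|n IH]; [now rewrite sum_O|].
    rewrite sum_Sn, IH. unfold plus; simpl. ring. }
  change (Rabs (sum_n (fun n => a n - a (S n)) n - (a 0%nat - l)) < eps).
  rewrite E, <- Rabs_Ropp. replace (- _) with (a (S n) - l) by ring. exact Hn.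
Qed.

(** By the mean value theorem the terms are dominated by the increments of [n^(1-p)], which
    telescope. *)
Lemma ex_series_Rpower p : 1 < p -> ex_series (fun n => Rpower (INR (S n)) (- p)).
Proof.
  intros Hp. apply (ex_series_incr_1 (V := R_NormedModule)).
  set (a n := Rpower (INR (S n)) (1 - p)).
  assert (Ha : forall n, a (S n) <= a n
             /\ Rpower (INR (S (S n))) (- p) <= / (p - 1) * (a n - a (S n))).
  { intros n.
    destruct (MVT_gen (fun x => Rpower x (1 - p)) (INR (S n)) (INR (S (S n)))
       (fun x => (1 - p) * Rpower x (- p))) as [c [Hc Hd]].
    - intros x Hx. rewrite Rmin_left in Hx by (apply le_INR; lia).
      assert (Hx0 := S_pos n). apply is_derive_Reals.
      replace (- p) with ((1 - p) - 1) by ring. apply derivable_pt_lim_power. lra.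
    - intros x Hx. rewrite Rmin_left in Hx by (apply le_INR; lia).
      assert (Hx0 := S_pos n).
      apply derivable_continuous_pt. eexists. apply derivable_pt_lim_power. lra.
    - rewrite Rmin_left, Rmax_right in Hc by (apply le_INR; lia).
      fold (a n) (a (S n)) in Hd. rewrite (S_INR (S n)) in Hd.
      assert (Hx0 := S_pos n).
      assert (Hm : Rpower (INR (S (S n))) (- p) <= Rpower c (- p)).
      { rewrite !Rpower_Ropp. apply Rinv_le_contravar; [apply Rpower_pos|].
        apply Rle_Rpower_l; lra. }
      replace (a n - a (S n)) with ((p - 1) * Rpower c (- p)) by lra.
      rewrite <- Rmult_assoc, Rinv_l, Rmult_1_l by lra.
      split; [|exact Hm]. assert (Hq := Rpower_pos c (- p)). nra. }
  apply ex_series_dom with (fun n => / (p - 1) * (a n - a (S n))).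
  - intros n. rewrite Rabs_pos_eq; [apply Ha | left; apply Rpower_pos].
  - apply ex_series_scal_R.
    destruct (ex_finite_lim_seq_decr a 0) as [l Hl].
    + intros n. apply Ha.
    + intros n. left. apply Rpower_pos.
    + apply ex_series_telescope with l, Hl.
Qed.

(** Multipliers of order [k]: the inclusions between the spaces and the bounds on the time
    derivatives of a solution are instances. *)
Lemma in_h_weight r k C (c d : nat -> R) :
  (forall n, Rabs (d (S n)) <= C * Rpower (INR (S n)) k * Rabs (c (S n))) ->
  in_h (r + k) c -> in_h r d.
Proof.
  intros H Hc. unfold in_h in *.
  apply ex_series_dom with
    (fun n => C ^ 2 * (c (S n) ^ 2 * Rpower (INR (S n)) (2 * (r + k)))).
  - intros n. rewrite Rabs_pos_eq.
    2: { apply Rmult_le_pos; [apply pow2_ge_0 | left; apply Rpower_pos]. }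
    replace (2 * (r + k)) with (2 * k + 2 * r) by ring. rewrite Rpower_plus.
    rewrite <- !(Rmult_assoc (c (S n) ^ 2)), <- Rmult_assoc.
    apply Rmult_le_compat_r; [left; apply Rpower_pos|].
    rewrite <- (pow2_abs (d (S n))).
    apply Rle_trans with ((C * Rpower (INR (S n)) k * Rabs (c (S n))) ^ 2).
    + apply pow_incr. split; [apply Rabs_pos | apply H].
    + right. rewrite !Rpow_mult_distr, pow2_abs, Rpower_sqr. ring.
  - apply ex_series_scal_R, Hc.
Qed.

Lemma in_h_dom r (c d : nat -> R) :
  (forall n, Rabs (d (S n)) <= Rabs (c (S n))) -> in_h r c -> in_h r d.
Proof.
  intros H Hc. apply in_h_weight with (k := 0) (C := 1) (c := c).
  - intros n. rewrite Rpower_O by apply S_pos. specialize (H n). lra.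
  - rewrite Rplus_0_r. exact Hc.
Qed.

Lemma in_h_le r r' (c : nat -> R) : r <= r' -> in_h r' c -> in_h r c.
Proof.
  intros H Hc. apply in_h_weight with (k := r' - r) (C := 1) (c := c).
  - intros n. assert (H1 := Rpower_S_ge_1 n (r' - r) ltac:(lra)).
    assert (H2 := Rabs_pos (c (S n))). nra.
  - replace (r + (r' - r)) with r' by ring. exact Hc.
Qed.

Lemma in_h_plus r (c d : nat -> R) : in_h r c -> in_h r d -> in_h r (fun j => c j + d j).
Proof.
  intros Hc Hd. unfold in_h in *.
  apply ex_series_dom with
    (fun n => 2 * (c (S n) ^ 2 * Rpower (INR (S n)) (2 * r)
                   + d (S n) ^ 2 * Rpower (INR (S n)) (2 * r))).
  - intros n. assert (Hp := Rpower_pos (INR (S n)) (2 * r)).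
    rewrite Rabs_pos_eq; [|apply Rmult_le_pos; [apply pow2_ge_0 | lra]].
    assert (Hq := pow2_ge_0 (c (S n) - d (S n))). nra.
  - apply ex_series_scal_R, ex_series_plus_R; assumption.
Qed.

Lemma in_h_scal r a (c : nat -> R) : in_h r c -> in_h r (fun j => a * c j).
Proof.
  intros Hc. apply in_h_weight with (k := 0) (C := Rabs a) (c := c).
  - intros n. rewrite Rpower_O by apply S_pos. rewrite Rabs_mult. lra.
  - rewrite Rplus_0_r. exact Hc.
Qed.

Lemma in_h_minus r (c d : nat -> R) : in_h r c -> in_h r d -> in_h r (fun j => c j - d j).
Proof.
  intros Hc Hd. apply in_h_dom with (fun j => c j + (-1) * d j).
  - intros n. right. f_equal. ring.
  - apply in_h_plus; [exact Hc | apply in_h_scal, Hd].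
Qed.

(** Young's inequality [|c| <= c^2 n^(2r) + n^(-2r)] leaves the sum of [n^(-2r)], which is where
    the threshold [1/2] on the regularity comes from. *)
Lemma in_h_summable r (c : nat -> R) :
  1 / 2 < r -> in_h r c -> ex_series (fun n => Rabs (c (S n))).
Proof.
  intros Hr Hc.
  apply ex_series_dom with
    (fun n => c (S n) ^ 2 * Rpower (INR (S n)) (2 * r) + Rpower (INR (S n)) (- (2 * r))).
  - intros n. rewrite Rabs_Rabsolu.
    set (P := Rpower (INR (S n)) r).
    assert (HP : 0 < P) by apply Rpower_pos.
    rewrite Rpower_Ropp, <- Rpower_sqr. fold P.
    assert (H := pow2_ge_0 (Rabs (c (S n)) * P - / P)).
    replace ((Rabs (c (S n)) * P - / P) ^ 2)
      with (Rabs (c (S n)) ^ 2 * P ^ 2 + / P ^ 2 - 2 * Rabs (c (S n))) in H by (field; lra).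
    rewrite pow2_abs in H. assert (H2 := Rabs_pos (c (S n))). lra.
  - apply ex_series_plus_R; [exact Hc | apply ex_series_Rpower; lra].
Qed.

Lemma in_h_summable_pow r k (c : nat -> R) :
  1 / 2 < r -> in_h (r + INR k) c -> ex_series (fun n => INR (S n) ^ k * Rabs (c (S n))).
Proof.
  intros Hr Hc.
  assert (H : in_h r (fun j => INR j ^ k * c j)).
  { apply in_h_weight with (k := INR k) (C := 1) (c := c); [|exact Hc].
    intros n. rewrite Rpower_S_pow, Rabs_mult, Rmult_1_l.
    rewrite (Rabs_pos_eq (_ ^ k)); [lra | apply pow_le; left; apply S_pos]. }
  apply in_h_summable in H; [|exact Hr].
  eapply ex_series_ext_R; [|exact H].
  intros n. simpl. rewrite Rabs_mult.
  rewrite (Rabs_pos_eq (_ ^ k)); [reflexivity | apply pow_le; left; apply S_pos].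
Qed.

Lemma h_term_pos r (c : nat -> R) n : 0 <= c (S n) ^ 2 * Rpower (INR (S n)) (2 * r).
Proof. apply Rmult_le_pos; [apply pow2_ge_0 | left; apply Rpower_pos]. Qed.

Lemma h_norm_sqr r (c : nat -> R) :
  in_h r c -> h_norm r c ^ 2 = Series (fun n => c (S n) ^ 2 * Rpower (INR (S n)) (2 * r)).
Proof.
  intros Hc. unfold h_norm. apply pow2_sqrt.
  apply Series_nonneg; [apply h_term_pos | exact Hc].
Qed.

Lemma h_norm_pos r (c : nat -> R) : 0 <= h_norm r c.
Proof. apply sqrt_pos. Qed.

Lemma h_norm_term r (c : nat -> R) n :
  in_h r c -> Rabs (c (S n)) * Rpower (INR (S n)) r <= h_norm r c.
Proof.
  intros Hc. apply Rsqr_incr_0_var; [|apply h_norm_pos].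
  rewrite !Rsqr_pow2, h_norm_sqr by exact Hc.
  rewrite Rpow_mult_distr, pow2_abs, Rpower_sqr.
  apply (term_le_Series (fun n => c (S n) ^ 2 * Rpower (INR (S n)) (2 * r)));
    [apply h_term_pos | exact Hc].
Qed.

(** Reduces convergence in norm to convergence of each coefficient. *)
Lemma h_norm_dominated {T} (F : (T -> Prop) -> Prop) {FF : Filter F}
    r (f : T -> nat -> R) (B : nat -> R) :
  in_h r B -> F (fun x => forall n, Rabs (f x (S n)) <= B (S n)) ->
  (forall n, filterlim (fun x => f x (S n)) F (locally 0)) ->
  filterlim (fun x => h_norm r (f x)) F (locally 0).
Proof.
  intros HB Hdom Hlim. unfold h_norm.
  rewrite <- sqrt_0.
  apply (tends_comp F _ sqrt 0); [|apply continuous_sqrt].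
  assert (E : Series (fun _ => 0 * 0) = 0) by (rewrite Series_scal_l; ring).
  rewrite <- E.
  apply (Series_dominated F) with (fun n => B (S n) ^ 2 * Rpower (INR (S n)) (2 * r)).
  - exact HB.
  - revert Hdom. apply filter_imp. intros x Hx n.
    rewrite Rabs_pos_eq by apply h_term_pos.
    apply Rmult_le_compat_r; [left; apply Rpower_pos|].
    rewrite <- pow2_abs. apply pow_incr. split; [apply Rabs_pos | apply Hx].
  - intros n. rewrite Rmult_0_l, Rabs_R0. apply h_term_pos.
  - intros n.
    replace (0 * 0) with (0 ^ 2 * Rpower (INR (S n)) (2 * r)) by ring.
    apply (tends_mult F); [|apply tends_const, FF].
    apply (tends_comp F _ (fun y => y ^ 2) 0); [apply Hlim|].
    apply (ex_derive_continuous (V := R_NormedModule)). auto_derive. exact I.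
Qed.

Lemma h_norm_tends_coef {T} (F : (T -> Prop) -> Prop) {FF : Filter F}
    r (f : T -> nat -> R) n :
  F (fun x => in_h r (f x)) -> filterlim (fun x => h_norm r (f x)) F (locally 0) ->
  filterlim (fun x => f x (S n)) F (locally 0).
Proof.
  intros Hin Hlim.
  apply (tends_squeeze F) with
    (fun x => h_norm r (f x) * / Rpower (INR (S n)) r).
  - revert Hin. apply filter_imp. intros x Hx. rewrite Rminus_0_r.
    assert (Hp := Rpower_pos (INR (S n)) r).
    apply Rmult_le_reg_r with (Rpower (INR (S n)) r); [exact Hp|].
    rewrite Rmult_assoc, Rinv_l, Rmult_1_r by lra. apply h_norm_term, Hx.
  - replace 0 with (0 * / Rpower (INR (S n)) r) by ring.
    apply (tends_mult F); [exact Hlim | apply tends_const, FF].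
Qed.

(** * Existence for the truncated Kirchhoff system *)

Lemma lam_ge m n : - 1 / 2 <= m ->
  1 / 2 <= 1 + m <= INR (S n) ^ 2 + m /\ INR (S n) ^ 2 <= 2 * (INR (S n) ^ 2 + m).
Proof. intros hm. assert (H := S_ge_1 n). nra. Qed.

Lemma omega_sqr m n : - 1 / 2 <= m ->
  omega m (S n) ^ 2 = INR (S n) ^ 2 * (INR (S n) ^ 2 + m).
Proof.
  intros hm. unfold omega. rewrite pow2_sqrt; [ring|].
  assert (H := lam_ge m n hm). assert (H1 := S_ge_1 n).
  replace (_ + _) with (INR (S n) ^ 2 * (INR (S n) ^ 2 + m)) by ring.
  apply Rmult_le_pos; nra.
Qed.

Lemma omega_pos m n : - 1 / 2 <= m -> 0 < omega m (S n).
Proof.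
  intros hm. apply sqrt_lt_R0.
  assert (H := lam_ge m n hm). assert (H1 := S_ge_1 n).
  replace (_ + _) with (INR (S n) ^ 2 * (INR (S n) ^ 2 + m)) by ring.
  apply Rmult_lt_0_compat; nra.
Qed.

(** The ratio [j^2 / omega_j] is what remains of the stiffness term in the Duhamel formula; it is
    bounded because [1 + m >= 1/2]. *)
Lemma sqr_le_omega m n : - 1 / 2 <= m -> INR (S n) ^ 2 <= 3 / 2 * omega m (S n).
Proof.
  intros hm. assert (Hw := omega_pos m n hm). assert (E := omega_sqr m n hm).
  assert (H := S_ge_1 n).
  apply Rsqr_incr_0_var; [|lra].
  rewrite !Rsqr_pow2, Rpow_mult_distr, E.
  assert (H2 := lam_ge m n hm). assert (H3 : 1 <= INR (S n) ^ 2) by nra.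
  set (x := INR (S n) ^ 2) in *. clearbody x. nra.
Qed.

Lemma omega_le m n : - 1 / 2 <= m -> omega m (S n) <= (2 + Rabs m) * INR (S n) ^ 2.
Proof.
  intros hm. assert (Hw := omega_pos m n hm). assert (E := omega_sqr m n hm).
  assert (H := S_ge_1 n). assert (Hm := Rabs_pos m). assert (Hm2 := Rle_abs m).
  apply Rsqr_incr_0_var; [|nra].
  rewrite !Rsqr_pow2, Rpow_mult_distr, E.
  assert (Hj : 1 <= INR (S n) ^ 2) by nra.
  set (x := INR (S n) ^ 2) in *. clearbody x.
  apply Rle_trans with (x * ((2 + Rabs m) ^ 2 * x)); [|right; ring].
  apply Rmult_le_compat_l; nra.
Qed.

(** By Parseval, [1 / (2 pi)] times the integral of [u_x^2]. *)
Definition kirch (c : nat -> R) : R :=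
  1 / (2 * PI) * Series (fun n => INR (S n) ^ 2 * c (S n) ^ 2).

Lemma cont_mult (f g : R -> R) x : continuous f x -> continuous g x ->
  continuous (fun t => f t * g t) x.
Proof. intros Hf Hg. apply (continuous_mult (K := R_AbsRing) f g x Hf Hg). Qed.

Lemma cont_cos_lin w x : continuous (fun t => cos (w * t)) x.
Proof. apply (ex_derive_continuous (V := R_NormedModule)). auto_derive. exact I. Qed.

Lemma cont_sin_lin w x : continuous (fun t => sin (w * t)) x.
Proof. apply (ex_derive_continuous (V := R_NormedModule)). auto_derive. exact I. Qed.

Lemma ex_RInt_cont (f : R -> R) a b : (forall t, continuous f t) -> ex_RInt f a b.
Proof. intros H. apply (ex_RInt_continuous (V := R_CompleteNormedModule)). intros; apply H. Qed.

Lemma RInt_reflect (h : R -> R) a b : (forall s, continuous h s) ->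
  RInt (fun s => h (- s)) a b = - RInt h (- a) (- b).
Proof.
  intros Hc. apply (is_RInt_unique (V := R_CompleteNormedModule)).
  apply (is_RInt_ext (V := R_NormedModule) (fun s => opp (opp (h (- s))))).
  { intros s _. apply opp_opp. }
  apply (is_RInt_opp (V := R_NormedModule)).
  apply (is_RInt_comp_opp (V := R_NormedModule)).
  apply (RInt_correct (V := R_CompleteNormedModule)), ex_RInt_cont, Hc.
Qed.

Lemma Rabs_RInt_exp_le (h : R -> R) (M K t : R) :
  0 < K -> (forall s, continuous h s) ->
  (forall s, Rabs s <= Rabs t -> Rabs (h s) <= M * exp (K * Rabs s)) ->
  Rabs (RInt h 0 t) <= M / K * (exp (K * Rabs t) - 1).
Proof.
  intros HK Hc Hb.
  assert (Hpos : forall g T, (forall s, continuous g s) -> 0 <= T ->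
     (forall s, 0 <= s <= T -> Rabs (g s) <= M * exp (K * s)) ->
     Rabs (RInt g 0 T) <= M / K * (exp (K * T) - 1)).
  { intros g T Hg HT Hgb.
    eapply Rle_trans; [apply abs_RInt_le; [exact HT | apply ex_RInt_cont, Hg]|].
    assert (Hi : is_RInt (fun s => M * exp (K * s)) 0 T (M / K * (exp (K * T) - 1))).
    { replace (M / K * (exp (K * T) - 1))
        with (minus (M / K * exp (K * T)) (M / K * exp (K * 0)))
        by (unfold minus, plus, opp; simpl; rewrite Rmult_0_r, exp_0; ring).
      apply (is_RInt_derive (V := R_CompleteNormedModule) (fun s => M / K * exp (K * s))).
      - intros s _. auto_derive; [exact I|]. field. lra.
      - intros s _. apply (ex_derive_continuous (V := R_NormedModule)).
        auto_derive. exact I. }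
    rewrite <- (is_RInt_unique _ _ _ _ Hi).
    apply RInt_le; [exact HT | | eexists; exact Hi | intros s Hs; apply Hgb; lra].
    apply ex_RInt_cont. intros s. apply continuous_comp; [apply Hg | apply continuous_Rabs]. }
  destruct (Rle_dec 0 t) as [Ht | Ht].
  - rewrite (Rabs_pos_eq t Ht) in *. apply Hpos; [exact Hc | exact Ht |].
    intros s Hs. rewrite <- (Rabs_pos_eq s) at 2 by lra. apply Hb.
    rewrite Rabs_pos_eq; lra.
  - rewrite (Rabs_left t) in * by lra.
    assert (E : RInt h 0 t = - RInt (fun s => h (- s)) 0 (- t)).
    { rewrite RInt_reflect by exact Hc. now rewrite Ropp_0, !Ropp_involutive. }
    rewrite E, Rabs_Ropp. apply Hpos.
    + intros s. apply continuous_comp; [|apply Hc].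
      apply (continuous_opp (V := R_NormedModule)), continuous_id.
    + lra.
    + intros s Hs. specialize (Hb (- s)). rewrite Rabs_Ropp, Rabs_pos_eq in Hb by lra.
      apply Hb. lra.
Qed.

(** The forced oscillation [int_0^t sin (w (t - s)) g s ds], written so that [t] occurs only in
    the bounds of the integrals; [duh_d] is the same with the cosine. *)
Definition duh (g : R -> R) (w t : R) : R :=
  sin (w * t) * RInt (fun s => cos (w * s) * g s) 0 t
  - cos (w * t) * RInt (fun s => sin (w * s) * g s) 0 t.

Definition duh_d (g : R -> R) (w t : R) : R :=
  cos (w * t) * RInt (fun s => cos (w * s) * g s) 0 t
  + sin (w * t) * RInt (fun s => sin (w * s) * g s) 0 t.

Section Duhamel.
Variables (g : R -> R) (w : R).
Hypothesis Hg : forall s, continuous g s.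

Let Cc s : continuous (fun s => cos (w * s) * g s) s.
Proof. apply cont_mult; [apply cont_cos_lin | apply Hg]. Qed.

Let Cs s : continuous (fun s => sin (w * s) * g s) s.
Proof. apply cont_mult; [apply cont_sin_lin | apply Hg]. Qed.

Lemma is_derive_RInt_0 (f : R -> R) t :
  (forall s, continuous f s) -> is_derive (fun t => RInt f 0 t) t (f t).
Proof.
  intros Hf. apply (is_derive_RInt f (fun t => RInt f 0 t) 0 t); [|apply Hf].
  apply filter_forall. intros y.
  apply (RInt_correct (V := R_CompleteNormedModule)), ex_RInt_cont, Hf.
Qed.

Lemma is_derive_duh (t : R) : is_derive (duh g w) t (w * duh_d g w t).
Proof.
  unfold duh, duh_d.
  pose (I1 := fun t : R => RInt (fun s => cos (w * s) * g s) 0 t : R).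
  pose (I2 := fun t : R => RInt (fun s => sin (w * s) * g s) 0 t : R).
  assert (D1 : is_derive I1 t (cos (w * t) * g t)) by apply (is_derive_RInt_0 _ t Cc).
  assert (D2 : is_derive I2 t (sin (w * t) * g t)) by apply (is_derive_RInt_0 _ t Cs).
  change (is_derive (fun t => sin (w * t) * I1 t - cos (w * t) * I2 t) t
    (w * (cos (w * t) * I1 t + sin (w * t) * I2 t))).
  clearbody I1 I2.
  auto_derive.
  - split; [eexists; exact D1 | split; [eexists; exact D2 | exact I]].
  - assert (E1 : Derive (fun x : R => I1 x) t = cos (w * t) * g t) by apply (is_derive_unique _ _ _ D1).
    assert (E2 : Derive (fun x : R => I2 x) t = sin (w * t) * g t) by apply (is_derive_unique _ _ _ D2).
    rewrite E1, E2. ring.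
Qed.

Lemma is_derive_duh_d (t : R) : is_derive (duh_d g w) t (- w * duh g w t + g t).
Proof.
  unfold duh, duh_d.
  pose (I1 := fun t : R => RInt (fun s => cos (w * s) * g s) 0 t : R).
  pose (I2 := fun t : R => RInt (fun s => sin (w * s) * g s) 0 t : R).
  assert (D1 : is_derive I1 t (cos (w * t) * g t)) by apply (is_derive_RInt_0 _ t Cc).
  assert (D2 : is_derive I2 t (sin (w * t) * g t)) by apply (is_derive_RInt_0 _ t Cs).
  change (is_derive (fun t => cos (w * t) * I1 t + sin (w * t) * I2 t) t
    (- w * (sin (w * t) * I1 t - cos (w * t) * I2 t) + g t)).
  clearbody I1 I2.
  auto_derive.
  - split; [eexists; exact D1 | split; [eexists; exact D2 | exact I]].
  - assert (E1 : Derive (fun x : R => I1 x) t = cos (w * t) * g t) by apply (is_derive_unique _ _ _ D1).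
    assert (E2 : Derive (fun x : R => I2 x) t = sin (w * t) * g t) by apply (is_derive_unique _ _ _ D2).
    rewrite E1, E2.
    assert (E := sin2_cos2 (w * t)). unfold Rsqr in E.
    replace (g t) with ((sin (w * t) * sin (w * t) + cos (w * t) * cos (w * t)) * g t) at 3
      by (rewrite E; ring). ring.
Qed.

Let lin_comb (a b t : R) :
  a * RInt (fun s => cos (w * s) * g s) 0 t + b * RInt (fun s => sin (w * s) * g s) 0 t
  = RInt (fun s => (a * cos (w * s) + b * sin (w * s)) * g s) 0 t.
Proof.
  symmetry. apply (is_RInt_unique (V := R_CompleteNormedModule)).
  apply (is_RInt_ext (V := R_NormedModule)
    (fun s => a * (cos (w * s) * g s) + b * (sin (w * s) * g s))).
  { intros s _. simpl. ring. }
  apply (is_RInt_plus (V := R_NormedModule));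
    apply (is_RInt_scal (V := R_NormedModule));
    apply (RInt_correct (V := R_CompleteNormedModule)), ex_RInt_cont; assumption.
Qed.

Let comb_bound (a b M K t : R) :
  0 < K -> a ^ 2 + b ^ 2 = 1 ->
  (forall s, Rabs s <= Rabs t -> Rabs (g s) <= M * exp (K * Rabs s)) ->
  Rabs (a * RInt (fun s => cos (w * s) * g s) 0 t + b * RInt (fun s => sin (w * s) * g s) 0 t)
    <= M / K * (exp (K * Rabs t) - 1).
Proof.
  intros HK Hab Hb. rewrite lin_comb. apply Rabs_RInt_exp_le; [exact HK | |].
  - intros s. apply cont_mult; [|apply Hg].
    apply (ex_derive_continuous (V := R_NormedModule)). auto_derive. exact I.
  - intros s Hs. rewrite Rabs_mult.
    eapply Rle_trans; [|apply Hb, Hs].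
    rewrite <- (Rmult_1_l (Rabs (g s))) at 2.
    apply Rmult_le_compat_r; [apply Rabs_pos|].
    apply Rabs_le_between. assert (E := sin2_cos2 (w * s)). unfold Rsqr in E.
    assert (H1 := pow2_ge_0 (a * sin (w * s) - b * cos (w * s))).
    assert ((a * cos (w * s) + b * sin (w * s)) ^ 2 <= 1); [|nra].
    replace 1 with ((a ^ 2 + b ^ 2) * (sin (w * s) * sin (w * s) + cos (w * s) * cos (w * s)))
      by (rewrite E, Hab; ring). nra.
Qed.

Lemma duh_bound M K t : 0 < K ->
  (forall s, Rabs s <= Rabs t -> Rabs (g s) <= M * exp (K * Rabs s)) ->
  Rabs (duh g w t) <= M / K * (exp (K * Rabs t) - 1).
Proof.
  intros HK Hb. unfold duh, Rminus. rewrite Ropp_mult_distr_l.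
  apply comb_bound; [exact HK | | exact Hb].
  assert (E := sin2_cos2 (w * t)). unfold Rsqr in E. nra.
Qed.

Lemma duh_d_bound M K t : 0 < K ->
  (forall s, Rabs s <= Rabs t -> Rabs (g s) <= M * exp (K * Rabs s)) ->
  Rabs (duh_d g w t) <= M / K * (exp (K * Rabs t) - 1).
Proof.
  intros HK Hb. unfold duh_d. apply comb_bound; [exact HK | | exact Hb].
  assert (E := sin2_cos2 (w * t)). unfold Rsqr in E. nra.
Qed.
End Duhamel.

Lemma duh_minus (g h : R -> R) w t :
  (forall s, continuous g s) -> (forall s, continuous h s) ->
  duh g w t - duh h w t = duh (fun s => g s - h s) w t.
Proof.
  intros Hg Hh. unfold duh.
  assert (Hm : forall k : R -> R, (forall s, continuous k s) ->
    RInt (fun s => k s * (g s - h s)) 0 t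
    = RInt (fun s => k s * g s) 0 t - RInt (fun s => k s * h s) 0 t).
  { intros k Hk. apply (is_RInt_unique (V := R_CompleteNormedModule)).
    apply (is_RInt_ext (V := R_NormedModule) (fun s => minus (k s * g s) (k s * h s))).
    { intros s _. unfold minus, plus, opp. simpl. ring. }
    apply (is_RInt_minus (V := R_NormedModule));
      apply (RInt_correct (V := R_CompleteNormedModule)), ex_RInt_cont;
      intros s; apply cont_mult; auto. }
  rewrite (Hm (fun s => cos (w * s))), (Hm (fun s => sin (w * s)));
    [ring | intros; apply cont_sin_lin | intros; apply cont_cos_lin].
Qed.

Lemma exp_le x y : x <= y -> exp x <= exp y.
Proof. intros [H | H]; [left; apply exp_increasing, H | rewrite H; lra]. Qed.

Lemma PI_gt_3 : 3 < PI.
Proof. assert (H := PI2_3_2). unfold PI2 in H. lra. Qed.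

Lemma kirch_nonneg c : ex_series (fun n => INR (S n) ^ 2 * c (S n) ^ 2) -> 0 <= kirch c.
Proof.
  intros H. unfold kirch. assert (Hpi := PI_RGT_0). apply Rmult_le_pos.
  - apply Rdiv_le_0_compat; lra.
  - apply Series_nonneg; [|exact H]. intros n. apply Rmult_le_pos; apply pow2_ge_0.
Qed.

(** Bound on the amplitude of the free oscillation of mode [j]. *)
Definition amp (m : R) (c0 v0 : nat -> R) (j : nat) : R :=
  Rabs (c0 j) + Rabs (v0 j) / omega m j.

Section Picard.
Variables (m R0 : R) (c0 v0 : nat -> R).
Hypothesis hm : - 1 / 2 <= m.
Hypothesis hR : 0 < R0.

Let b (n : nat) : R := amp m c0 v0 (S n).
Let w (n : nat) : R := omega m (S n).
Let K : R := 3 / 2 * R0.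

Hypothesis hb : ex_series (fun n => INR (S n) ^ 2 * b n ^ 2).

Let w_pos n : 0 < w n.
Proof. apply omega_pos, hm. Qed.

Let b_nonneg n : 0 <= b n.
Proof.
  unfold b, amp. assert (H := w_pos n). unfold w in H.
  apply Rplus_le_le_0_compat; [apply Rabs_pos|].
  apply Rdiv_le_0_compat; [apply Rabs_pos | exact H].
Qed.

Let K_pos : 0 < K.
Proof. unfold K. lra. Qed.

(** The truncation makes the stiffness bounded whatever the iterate is, so that every iterate
    obeys one and the same bound, mode by mode. *)
Definition trunc (c : nat -> R) : R := Rmin R0 (kirch c).

(** Duhamel formula for the oscillators forced by the stiffness of the previous iterate. *)
Definition picard (x : R -> nat -> R) (t : R) (j : nat) : R :=
  c0 j * cos (omega m j * t) + v0 j / omega m j * sin (omega m j * t)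
  - INR j ^ 2 / omega m j * duh (fun s => trunc (x s) * x s j) (omega m j) t.

Definition picard_d (x : R -> nat -> R) (t : R) (j : nat) : R :=
  - c0 j * omega m j * sin (omega m j * t) + v0 j * cos (omega m j * t)
  - INR j ^ 2 * duh_d (fun s => trunc (x s) * x s j) (omega m j) t.

Definition admissible (x : R -> nat -> R) : Prop :=
  (forall n t, continuous (fun s => x s (S n)) t) /\
  forall n t, Rabs (x t (S n)) <= b n * exp (K * Rabs t).

Lemma admissible_sqr_le x t T n : admissible x -> Rabs t <= T ->
  Rabs (INR (S n) ^ 2 * x t (S n) ^ 2) <= exp (K * T) ^ 2 * (INR (S n) ^ 2 * b n ^ 2).
Proof.
  intros [_ Hx] HT. rewrite Rabs_mult, <- RPow_abs, <- RPow_abs.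
  rewrite (Rabs_pos_eq (INR (S n))) by apply pos_INR.
  replace (_ * (_ * _)) with (INR (S n) ^ 2 * (b n * exp (K * T)) ^ 2) by ring.
  apply Rmult_le_compat_l; [apply pow2_ge_0|].
  apply pow_incr. split; [apply Rabs_pos|].
  eapply Rle_trans; [apply Hx|]. apply Rmult_le_compat_l; [apply b_nonneg|].
  apply exp_le. apply Rmult_le_compat_l; [lra | exact HT].
Qed.

Lemma admissible_ex_series x t : admissible x ->
  ex_series (fun n => INR (S n) ^ 2 * x t (S n) ^ 2).
Proof.
  intros Hx. eapply ex_series_dom.
  - intros n. apply (admissible_sqr_le x t (Rabs t)); [exact Hx | lra].
  - apply ex_series_scal_R, hb.
Qed.

Lemma trunc_bounds x t : admissible x -> 0 <= trunc (x t) <= R0.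
Proof.
  intros Hx. unfold trunc. split; [|apply Rmin_l].
  apply Rmin_glb; [lra | apply kirch_nonneg, admissible_ex_series, Hx].
Qed.

Lemma locally_Rabs_lt (t T : R) : Rabs t < T -> locally t (fun s => Rabs s < T).
Proof.
  intros H. exists (mkposreal (T - Rabs t) ltac:(lra)). intros s Hs.
  change (Rabs (s - t) < T - Rabs t) in Hs.
  assert (H2 := Rabs_triang_inv s t). lra.
Qed.

Lemma kirch_continuous x t : admissible x -> continuous (fun s => kirch (x s)) t.
Proof.
  intros Hx. unfold kirch.
  apply cont_mult; [apply continuous_const|].
  apply (Series_dominated (locally t)) with
    (fun n => exp (K * (Rabs t + 1)) ^ 2 * (INR (S n) ^ 2 * b n ^ 2)).
  - apply ex_series_scal_R, hb.
  - generalize (locally_Rabs_lt t (Rabs t + 1) ltac:(lra)). apply filter_imp.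
    intros s Hs n. apply admissible_sqr_le; [exact Hx | lra].
  - intros n. apply admissible_sqr_le; [exact Hx | lra].
  - intros n. apply (tends_mult (locally t)); [apply tends_const, locally_filter|].
    apply (tends_comp (locally t) _ (fun y => y ^ 2)); [apply Hx|].
    apply (ex_derive_continuous (V := R_NormedModule)). auto_derive. exact I.
Qed.

Lemma trunc_continuous x t : admissible x -> continuous (fun s => trunc (x s)) t.
Proof.
  intros Hx. unfold trunc.
  apply (continuous_ext (fun s => (R0 + kirch (x s) - Rabs (R0 - kirch (x s))) / 2)).
  { intros s. unfold Rmin, Rabs.
    destruct (Rle_dec R0 (kirch (x s))); destruct (Rcase_abs (R0 - kirch (x s))); lra. }
  assert (Hk := kirch_continuous x t Hx).
  apply cont_mult; [|apply continuous_const].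
  apply (continuous_minus (V := R_NormedModule)).
  - apply (continuous_plus (V := R_NormedModule)); [apply continuous_const | exact Hk].
  - apply (continuous_comp (fun s => R0 - kirch (x s)) Rabs); [|apply continuous_Rabs].
    apply (continuous_minus (V := R_NormedModule)); [apply continuous_const | exact Hk].
Qed.

Lemma forcing_continuous x n t : admissible x ->
  continuous (fun s => trunc (x s) * x s (S n)) t.
Proof. intros Hx. apply cont_mult; [apply trunc_continuous, Hx | apply Hx]. Qed.

Lemma forcing_bound x n s : admissible x ->
  Rabs (trunc (x s) * x s (S n)) <= R0 * b n * exp (K * Rabs s).
Proof.
  intros Hx. rewrite Rabs_mult. assert (H := trunc_bounds x s Hx).
  rewrite (Rabs_pos_eq (trunc _)) by lra.
  rewrite Rmult_assoc. apply Rmult_le_compat; [lra | apply Rabs_pos | lra | apply Hx].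
Qed.

Lemma is_derive_picard x n t : admissible x ->
  is_derive (fun t => picard x t (S n)) t (picard_d x t (S n)).
Proof.
  intros Hx. unfold picard, picard_d. fold (w n).
  assert (D := is_derive_duh _ (w n) (fun s => forcing_continuous x n s Hx) t).
  set (D1 := duh _ (w n)) in *. set (D2 := duh_d _ (w n) t) in *.
  set (j := INR (S n)). clearbody j. auto_derive; [eexists; exact D|].
  assert (E : Derive (fun x0 : R => D1 x0) t = w n * D2) by apply (is_derive_unique _ _ _ D).
  rewrite E. field. assert (H := w_pos n). lra.
Qed.

Lemma is_derive_picard_d x n t : admissible x ->
  is_derive (fun t => picard_d x t (S n)) t
    (- (INR (S n) ^ 2 * (INR (S n) ^ 2 + m)) * picard x t (S n)
     - INR (S n) ^ 2 * (trunc (x t) * x t (S n))).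
Proof.
  intros Hx. rewrite <- omega_sqr by exact hm.
  unfold picard, picard_d. fold (w n).
  assert (D := is_derive_duh_d _ (w n) (fun s => forcing_continuous x n s Hx) t).
  set (D1 := duh _ (w n) t) in *. set (D2 := duh_d _ (w n)) in *.
  set (j := INR (S n)). clearbody j. auto_derive; [eexists; exact D|].
  assert (E : Derive (fun x0 : R => D2 x0) t = - w n * D1 + trunc (x t) * x t (S n))
    by apply (is_derive_unique _ _ _ D).
  rewrite E. field. assert (H := w_pos n). lra.
Qed.

(** The rate [K] is chosen so that the bound reproduces itself: the free part is at most [b_n],
    and the forced part at most [b_n (exp (K |t|) - 1)] because [j^2 / omega_j <= 3/2]. *)
Lemma picard_bound x n t : admissible x ->
  Rabs (picard x t (S n)) <= b n * exp (K * Rabs t).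
Proof.
  intros Hx. unfold picard. fold (w n).
  assert (D := duh_bound _ (w n) (fun s => forcing_continuous x n s Hx) (R0 * b n) K t K_pos
    (fun s _ => forcing_bound x n s Hx)).
  set (D1 := duh _ (w n) t) in *. clearbody D1.
  assert (Hw := w_pos n). assert (Hj : INR (S n) ^ 2 <= 3 / 2 * w n) by apply (sqr_le_omega m n hm).
  assert (H1 : Rabs (c0 (S n) * cos (w n * t) + v0 (S n) / w n * sin (w n * t)) <= b n).
  { eapply Rle_trans; [apply Rabs_triang|]. unfold b, amp. fold (w n).
    apply Rplus_le_compat; rewrite Rabs_mult.
    - rewrite <- (Rmult_1_r (Rabs (c0 _))) at 2.
      apply Rmult_le_compat_l; [apply Rabs_pos|]. apply Rabs_le, COS_bound.
    - unfold Rdiv at 1. rewrite Rabs_mult, Rabs_inv, (Rabs_pos_eq (w n)) by lra.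
      rewrite <- (Rmult_1_r (Rabs (v0 _) / w n)).
      apply Rmult_le_compat_l; [apply Rdiv_le_0_compat; [apply Rabs_pos | exact Hw]|].
      apply Rabs_le, SIN_bound. }
  assert (H2 : Rabs (INR (S n) ^ 2 / w n * D1) <= b n * (exp (K * Rabs t) - 1)).
  { rewrite Rabs_mult.
    assert (H3 : 0 <= INR (S n) ^ 2 / w n <= 3 / 2).
    { split; [apply Rdiv_le_0_compat; [apply pow2_ge_0 | exact Hw]|].
      apply Rmult_le_reg_r with (w n); [exact Hw|]. unfold Rdiv.
      rewrite Rmult_assoc, Rinv_l, Rmult_1_r by lra. exact Hj. }
    rewrite (Rabs_pos_eq (_ / _)) by lra.
    apply Rle_trans with (3 / 2 * (R0 * b n / K * (exp (K * Rabs t) - 1))).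
    - apply Rmult_le_compat; [lra | apply Rabs_pos | lra | exact D].
    - right. unfold K. field. lra. }
  unfold Rminus. eapply Rle_trans; [apply Rabs_triang|]. rewrite Rabs_Ropp. lra.
Qed.

Lemma picard_d_bound x n t : admissible x ->
  Rabs (picard_d x t (S n)) <= w n * b n * exp (K * Rabs t).
Proof.
  intros Hx. unfold picard_d. fold (w n).
  assert (D := duh_d_bound _ (w n) (fun s => forcing_continuous x n s Hx) (R0 * b n) K t K_pos
    (fun s _ => forcing_bound x n s Hx)).
  set (D1 := duh_d _ (w n) t) in *. clearbody D1.
  assert (Hw := w_pos n). assert (Hj : INR (S n) ^ 2 <= 3 / 2 * w n) by apply (sqr_le_omega m n hm).
  assert (H1 : Rabs (- c0 (S n) * w n * sin (w n * t) + v0 (S n) * cos (w n * t)) <= w n * b n).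
  { eapply Rle_trans; [apply Rabs_triang|]. unfold b, amp. fold (w n).
    replace (w n * (Rabs (c0 (S n)) + Rabs (v0 (S n)) / w n))
      with (w n * Rabs (c0 (S n)) + Rabs (v0 (S n))) by (field; lra).
    apply Rplus_le_compat.
    - rewrite !Rabs_mult, Rabs_Ropp, (Rabs_pos_eq (w n)) by lra.
      assert (Hs : Rabs (sin (w n * t)) <= 1) by apply Rabs_le, SIN_bound.
      assert (Hp : 0 <= w n * Rabs (c0 (S n))) by (apply Rmult_le_pos; [lra | apply Rabs_pos]).
      nra.
    - rewrite Rabs_mult.
      assert (Hs : Rabs (cos (w n * t)) <= 1) by apply Rabs_le, COS_bound.
      assert (Hp := Rabs_pos (v0 (S n))). nra. }
  assert (H2 : Rabs (INR (S n) ^ 2 * D1) <= w n * b n * (exp (K * Rabs t) - 1)).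
  { rewrite Rabs_mult, (Rabs_pos_eq (INR (S n) ^ 2)) by apply pow2_ge_0.
    apply Rle_trans with (3 / 2 * w n * (R0 * b n / K * (exp (K * Rabs t) - 1))).
    - apply Rmult_le_compat; [apply pow2_ge_0 | apply Rabs_pos | lra | exact D].
    - right. unfold K. field. lra. }
  unfold Rminus. eapply Rle_trans; [apply Rabs_triang|]. rewrite Rabs_Ropp. lra.
Qed.

Lemma picard_admissible x : admissible x -> admissible (picard x).
Proof.
  intros Hx. split.
  - intros n t. eapply is_derive_cont. apply is_derive_picard, Hx.
  - intros n t. apply picard_bound, Hx.
Qed.

Let B : R := Series (fun n => INR (S n) ^ 2 * b n ^ 2).

(** [C] is a Lipschitz constant of the forcing on [|t| <= T], and [L] the exponential rate of a
    weighted norm in which the iteration contracts by one half. *)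
Let C (T : R) : R := R0 + 1 / PI * B * exp (K * T) ^ 2.
Let L (T : R) : R := 3 * C T.

Let B_nonneg : 0 <= B.
Proof. apply Series_nonneg; [|exact hb]. intros n. apply Rmult_le_pos; apply pow2_ge_0. Qed.

Let C_ge T : R0 <= C T.
Proof.
  unfold C. assert (Hpi := PI_RGT_0). assert (HB := B_nonneg).
  assert (0 <= 1 / PI * B * exp (K * T) ^ 2); [|lra].
  apply Rmult_le_pos; [|apply pow2_ge_0].
  apply Rmult_le_pos; [|exact HB]. apply Rdiv_le_0_compat; lra.
Qed.

(** Differences are measured mode by mode in units of [b_n]: the sum over the modes then only
    costs the constant [B]. *)
Lemma trunc_lipschitz x y T th t : admissible x -> admissible y -> Rabs t <= T -> 0 <= th ->
  (forall n, Rabs (x t (S n) - y t (S n)) <= b n * th) ->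
  Rabs (trunc (x t) - trunc (y t)) <= 1 / PI * B * exp (K * T) * th.
Proof.
  intros Hx Hy HT Hth H.
  apply Rle_trans with (Rabs (kirch (x t) - kirch (y t))).
  { unfold trunc, Rmin, Rabs.
    destruct (Rle_dec R0 (kirch (x t))); destruct (Rle_dec R0 (kirch (y t)));
    repeat destruct Rcase_abs; lra. }
  assert (Hpi := PI_RGT_0).
  unfold kirch. rewrite <- Rmult_minus_distr_l.
  rewrite <- Series_minus by (apply admissible_ex_series; assumption).
  rewrite Rabs_mult, (Rabs_pos_eq (1 / _)) by (apply Rdiv_le_0_compat; lra).
  assert (HS : ex_series (fun n => 2 * exp (K * T) * th * (INR (S n) ^ 2 * b n ^ 2)))
    by apply ex_series_scal_R, hb.
  eapply Rle_trans.
  - apply Rmult_le_compat_l; [apply Rdiv_le_0_compat; lra|].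
    apply Rabs_Series_le; [|exact HS]. intros n.
    rewrite <- Rmult_minus_distr_l, Rabs_mult, Rabs_pos_eq by apply pow2_ge_0.
    replace (2 * exp (K * T) * th * (INR (S n) ^ 2 * b n ^ 2))
      with (INR (S n) ^ 2 * ((b n * th) * (2 * (b n * exp (K * T))))) by ring.
    apply Rmult_le_compat_l; [apply pow2_ge_0|].
    replace (x t (S n) ^ 2 - y t (S n) ^ 2)
      with ((x t (S n) - y t (S n)) * (x t (S n) + y t (S n))) by ring.
    rewrite Rabs_mult. apply Rmult_le_compat; [apply Rabs_pos | apply Rabs_pos | apply H |].
    eapply Rle_trans; [apply Rabs_triang|].
    assert (He : b n * exp (K * Rabs t) <= b n * exp (K * T)).
    { apply Rmult_le_compat_l; [apply b_nonneg|]. apply exp_le.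
      apply Rmult_le_compat_l; [lra | exact HT]. }
    assert (Hx' := proj2 Hx n t). assert (Hy' := proj2 Hy n t). lra.
  - rewrite Series_scal_l. fold B. right. field. lra.
Qed.

(** Integration in time against the weight [exp (L |t|)] produces the factor [1 / L], here
    [1 / (3 C)], and [j^2 / omega_j] at most [3/2]. *)
Lemma picard_contraction x y T th : admissible x -> admissible y -> 0 <= th ->
  (forall n t, Rabs t <= T -> Rabs (x t (S n) - y t (S n)) <= b n * (th * exp (L T * Rabs t))) ->
  forall n t, Rabs t <= T ->
    Rabs (picard x t (S n) - picard y t (S n)) <= b n * (th / 2 * exp (L T * Rabs t)).
Proof.
  intros Hx Hy Hth H n t HT.
  assert (HC := C_ge T).
  unfold picard. fold (w n).
  set (D1 := duh (fun s => trunc (x s) * x s (S n)) (w n) t).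
  set (D2 := duh (fun s => trunc (y s) * y s (S n)) (w n) t).
  replace (_ - _) with (INR (S n) ^ 2 / w n * (D2 - D1)) by ring.
  assert (Hw := w_pos n). assert (Hj : INR (S n) ^ 2 <= 3 / 2 * w n) by apply (sqr_le_omega m n hm).
  assert (H3 : 0 <= INR (S n) ^ 2 / w n <= 3 / 2).
  { split; [apply Rdiv_le_0_compat; [apply pow2_ge_0 | exact Hw]|].
    apply Rmult_le_reg_r with (w n); [exact Hw|]. unfold Rdiv.
    rewrite Rmult_assoc, Rinv_l, Rmult_1_r by lra. exact Hj. }
  assert (HD : Rabs (D2 - D1) <= C T * (b n * th) / L T * (exp (L T * Rabs t) - 1)).
  { unfold D1, D2. rewrite duh_minus by (intros; apply forcing_continuous; assumption).
    apply duh_bound; [| unfold L; lra |].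
    - intros s. apply (continuous_minus (V := R_NormedModule));
        apply forcing_continuous; assumption.
    - intros s Hs. rewrite Rabs_minus_sym.
      set (e := th * exp (L T * Rabs s)).
      assert (He : 0 <= e) by (apply Rmult_le_pos; [exact Hth | left; apply exp_pos]).
      assert (Hsn : forall k, Rabs (x s (S k) - y s (S k)) <= b k * e)
        by (intros k; apply H; lra).
      assert (A1 := trunc_lipschitz x y T e s Hx Hy ltac:(lra) He Hsn).
      assert (A2 := trunc_bounds x s Hx).
      replace (trunc (x s) * x s (S n) - trunc (y s) * y s (S n))
        with (trunc (x s) * (x s (S n) - y s (S n)) + (trunc (x s) - trunc (y s)) * y s (S n))
        by ring.
      eapply Rle_trans; [apply Rabs_triang|]. rewrite !Rabs_mult.
      rewrite (Rabs_pos_eq (trunc _)) by lra.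
      replace (C T * (b n * th) * exp (L T * Rabs s))
        with (R0 * (b n * e) + 1 / PI * B * exp (K * T) * e * (b n * exp (K * T)))
        by (unfold C, e; ring).
      apply Rplus_le_compat; apply Rmult_le_compat; try apply Rabs_pos; try lra.
      + apply Hsn.
      + eapply Rle_trans; [apply Hy|]. apply Rmult_le_compat_l; [apply b_nonneg|].
        apply exp_le. apply Rmult_le_compat_l; lra. }
  rewrite Rabs_mult, (Rabs_pos_eq (_ / _)) by lra.
  apply Rle_trans with (3 / 2 * (C T * (b n * th) / L T * (exp (L T * Rabs t) - 1))).
  - apply Rmult_le_compat; [lra | apply Rabs_pos | lra | exact HD].
  - assert (Hbt : 0 <= b n * th) by (apply Rmult_le_pos; [apply b_nonneg | exact Hth]).
    replace (3 / 2 * (C T * (b n * th) / L T * (exp (L T * Rabs t) - 1)))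
      with (b n * th / 2 * (exp (L T * Rabs t) - 1)) by (unfold L; field; lra).
    lra.
Qed.

Fixpoint picard_iter (k : nat) : R -> nat -> R :=
  match k with
  | O => fun _ _ => 0
  | S k => picard (picard_iter k)
  end.

Definition picard_lim (t : R) (j : nat) : R :=
  Series (fun k => picard_iter (S k) t j - picard_iter k t j).

Lemma picard_iter_admissible k : admissible (picard_iter k).
Proof.
  induction k as [|k IH]; [|apply picard_admissible, IH].
  split; intros n t; simpl.
  - apply continuous_const.
  - rewrite Rabs_R0. apply Rmult_le_pos; [apply b_nonneg | left; apply exp_pos].
Qed.

Lemma picard_iter_step T k n t : Rabs t <= T ->
  Rabs (picard_iter (S k) t (S n) - picard_iter k t (S n))
    <= b n * ((1 / 2) ^ k * exp (L T * Rabs t)).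
Proof.
  revert n t. induction k as [|k IH]; intros n t HT.
  - simpl picard_iter at 2. rewrite Rminus_0_r, pow_O, Rmult_1_l.
    eapply Rle_trans; [apply (proj2 (picard_iter_admissible 1) n t)|].
    apply Rmult_le_compat_l; [apply b_nonneg|]. apply exp_le.
    apply Rmult_le_compat_r; [apply Rabs_pos|].
    assert (HC := C_ge T). unfold K, L. lra.
  - replace ((1 / 2) ^ S k) with ((1 / 2) ^ k / 2) by (simpl; field).
    apply (picard_contraction (picard_iter (S k)) (picard_iter k) T);
      [apply picard_iter_admissible | apply picard_iter_admissible
      | apply pow_le; lra | exact IH | exact HT].
Qed.

Lemma ex_series_half : ex_series (fun k => (1 / 2) ^ k).
Proof. apply ex_series_geom. rewrite Rabs_pos_eq; lra. Qed.

Lemma Series_half N : Series (fun k => (1 / 2) ^ (N + k)) = 2 * (1 / 2) ^ N.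
Proof.
  rewrite (Series_ext _ (fun k => (1 / 2) ^ N * (1 / 2) ^ k))
    by (intros; apply pow_add).
  rewrite Series_scal_l, Series_geom by (rewrite Rabs_pos_eq; lra). field.
Qed.

Lemma le_of_half_pow x y c : (forall N, x <= y + c * (1 / 2) ^ N) -> x <= y.
Proof.
  intros H.
  apply (is_lim_seq_le (fun _ => x) (fun N => y + c * (1 / 2) ^ N) x y).
  - exact H.
  - apply is_lim_seq_const.
  - replace y with (y + c * 0) at 1 by ring.
    apply is_lim_seq_plus'; [apply is_lim_seq_const|].
    apply is_lim_seq_mult'; [apply is_lim_seq_const|].
    apply is_lim_seq_geom. rewrite Rabs_pos_eq; lra.
Qed.

Lemma picard_lim_approx T N n t : Rabs t <= T ->
  Rabs (picard_lim t (S n) - picard_iter (S N) t (S n))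
    <= b n * ((1 / 2) ^ N * exp (L T * Rabs t)).
Proof.
  intros HT. unfold picard_lim.
  assert (HM : ex_series (fun k => b n * exp (L T * Rabs t) * (1 / 2) ^ k))
    by apply ex_series_scal_R, ex_series_half.
  assert (Hst : forall k, Rabs (picard_iter (S k) t (S n) - picard_iter k t (S n))
     <= b n * exp (L T * Rabs t) * (1 / 2) ^ k).
  { intros k. eapply Rle_trans; [apply (picard_iter_step T); exact HT|]. right. ring. }
  rewrite (Series_split _ N) by (eapply ex_series_dom; [exact Hst | exact HM]).
  assert (E : sum_n (fun k => picard_iter (S k) t (S n) - picard_iter k t (S n)) N
     = picard_iter (S N) t (S n)).
  { generalize N. clear. intros N. induction N as [|N IH].
    - rewrite sum_O. apply Rminus_0_r.
    - rewrite sum_Sn, IH. apply Rplus_minus. }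
  rewrite E.
  match goal with |- Rabs (?a + ?s - ?a) <= _ => replace (a + s - a) with s by ring end.
  eapply Rle_trans.
  - apply Rabs_Series_le; [intros k; apply Hst | apply (ex_series_shift (fun k => b n * exp (L T * Rabs t) * (1 / 2) ^ k) (S N)), HM].
  - rewrite Series_scal_l, Series_half. right. simpl. field.
Qed.

Lemma picard_lim_admissible : admissible picard_lim.
Proof.
  split; intros n t.
  - unfold picard_lim.
    apply (Series_dominated (locally t)) with
      (fun k => b n * exp (L (Rabs t + 1) * (Rabs t + 1)) * (1 / 2) ^ k).
    + apply ex_series_scal_R, ex_series_half.
    + generalize (locally_Rabs_lt t (Rabs t + 1) ltac:(lra)). apply filter_imp.
      intros s Hs k. eapply Rle_trans; [apply (picard_iter_step (Rabs t + 1)); lra|].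
      rewrite Rmult_assoc, (Rmult_comm (exp _)). apply Rmult_le_compat_l; [apply b_nonneg|].
      apply Rmult_le_compat_l; [apply pow_le; lra|]. apply exp_le.
      apply Rmult_le_compat_l; [|lra]. assert (HC := C_ge (Rabs t + 1)). unfold L. lra.
    + intros k. eapply Rle_trans; [apply (picard_iter_step (Rabs t + 1)); lra|].
      rewrite Rmult_assoc, (Rmult_comm (exp _)). apply Rmult_le_compat_l; [apply b_nonneg|].
      apply Rmult_le_compat_l; [apply pow_le; lra|]. apply exp_le.
      apply Rmult_le_compat_l; [|lra]. assert (HC := C_ge (Rabs t + 1)). unfold L. lra.
    + intros k.
      apply (tends_minus (locally t)); apply picard_iter_admissible.
  - apply le_of_half_pow with (b n * exp (L (Rabs t) * Rabs t)). intros N.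
    assert (A := picard_lim_approx (Rabs t) N n t (Rle_refl _)).
    assert (A' := proj2 (picard_iter_admissible (S N)) n t).
    assert (A2 := Rabs_triang_inv (picard_lim t (S n)) (picard_iter (S N) t (S n))).
    lra.
Qed.

Lemma picard_lim_fixpoint n t : picard picard_lim t (S n) = picard_lim t (S n).
Proof.
  apply Rminus_diag_uniq. apply Rabs_eq_0. apply Rle_antisym; [|apply Rabs_pos].
  apply le_of_half_pow with (b n * exp (L (Rabs t) * Rabs t)). intros N.
  assert (A := picard_lim_approx (Rabs t) (S N) n t (Rle_refl _)).
  assert (A' := picard_contraction picard_lim (picard_iter (S N)) (Rabs t) ((1 / 2) ^ N)
    picard_lim_admissible (picard_iter_admissible (S N)) ltac:(apply pow_le; lra)
    (fun k s Hs => picard_lim_approx (Rabs t) N k s Hs) n t (Rle_refl _)).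
  change (picard (picard_iter (S N))) with (picard_iter (S (S N))) in A'.
  assert (A2 := Rabs_triang (picard picard_lim t (S n) - picard_iter (S (S N)) t (S n))
    (picard_iter (S (S N)) t (S n) - picard_lim t (S n))).
  rewrite (Rabs_minus_sym (picard_iter (S (S N)) t (S n))) in A2.
  replace (picard picard_lim t (S n) - picard_iter (S (S N)) t (S n) +
     (picard_iter (S (S N)) t (S n) - picard_lim t (S n)))
    with (picard picard_lim t (S n) - picard_lim t (S n)) in A2 by ring.
  replace ((1 / 2) ^ S N) with ((1 / 2) ^ N / 2) in A by (simpl; field).
  lra.
Qed.

(** The bounds hold mode by mode, so that sums over modes are dominated by convergent series
    of constants, locally uniformly in time. *)
Lemma truncated_solution : exists x v : R -> nat -> R,
  (forall n t, is_derive (fun s => x s (S n)) t (v t (S n))) /\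
  (forall n t, is_derive (fun s => v s (S n)) t
     (- (INR (S n) ^ 2 * (INR (S n) ^ 2 + m + trunc (x t))) * x t (S n))) /\
  (forall n, x 0 (S n) = c0 (S n)) /\ (forall n, v 0 (S n) = v0 (S n)) /\
  (forall n t, Rabs (x t (S n)) <= amp m c0 v0 (S n) * exp (3 / 2 * R0 * Rabs t)) /\
  (forall n t, Rabs (v t (S n))
     <= omega m (S n) * amp m c0 v0 (S n) * exp (3 / 2 * R0 * Rabs t)).
Proof.
  assert (Hx := picard_lim_admissible).
  exists picard_lim, (picard_d picard_lim).
  refine (conj _ (conj _ (conj _ (conj _ (conj _ _))))).
  - intros n t. eapply (is_derive_ext (V := R_NormedModule));
      [|apply (is_derive_picard picard_lim n t Hx)].
    intros s. apply picard_lim_fixpoint.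
  - intros n t.
    replace (- (INR (S n) ^ 2 * (INR (S n) ^ 2 + m + trunc (picard_lim t))) * picard_lim t (S n))
      with (- (INR (S n) ^ 2 * (INR (S n) ^ 2 + m)) * picard picard_lim t (S n)
     - INR (S n) ^ 2 * (trunc (picard_lim t) * picard_lim t (S n)))
     by (rewrite picard_lim_fixpoint; ring).
    apply is_derive_picard_d, Hx.
  - intros n. rewrite <- picard_lim_fixpoint. unfold picard, duh.
    rewrite !RInt_point, Rmult_0_r, cos_0, sin_0. unfold zero; simpl. ring.
  - intros n. unfold picard_d, duh_d.
    rewrite !RInt_point, Rmult_0_r, cos_0, sin_0. unfold zero; simpl. ring.
  - intros n t. apply Hx.
  - intros n t. apply picard_d_bound, Hx.
Qed.
End Picard.

(** * The quartic normal form *)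

(** Restores the carrier [R] in an equation stated over one of the algebraic structures of
    [R], for the sake of [ring] and [field]. *)
Ltac eqR := match goal with |- @eq _ ?a ?b => change (@eq R a b) end.

Lemma sum_n_S (f : nat -> R) N : sum_n f (S N) = sum_n f N + f (S N).
Proof. apply (sum_Sn f N). Qed.

Lemma sum_n_plus_R (f g : nat -> R) N :
  sum_n (fun n => f n + g n) N = sum_n f N + sum_n g N.
Proof. apply (sum_n_plus (G := R_AbelianMonoid)). Qed.

Lemma sum_n_scal_R (a : R) (f : nat -> R) N : sum_n (fun n => a * f n) N = a * sum_n f N.
Proof. apply (sum_n_mult_l (K := R_Ring)). Qed.

Lemma Rabs_sum_n_le (f g : nat -> R) N :
  (forall n, Rabs (f n) <= g n) -> Rabs (sum_n f N) <= sum_n g N.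
Proof.
  intros H. induction N as [|N IH]; [rewrite !sum_O; apply H|].
  rewrite !sum_n_S. eapply Rle_trans; [apply Rabs_triang|]. specialize (H (S N)). lra.
Qed.

Lemma sum_n_nonneg (f : nat -> R) N : (forall n, 0 <= f n) -> 0 <= sum_n f N.
Proof.
  intros H. induction N as [|N IH]; [rewrite sum_O; apply H|].
  rewrite sum_n_S. specialize (H (S N)). lra.
Qed.

Lemma sum_n_mult_sum_n (f g : nat -> R) N :
  sum_n (fun i => sum_n (fun k => f i * g k) N) N = sum_n f N * sum_n g N.
Proof.
  rewrite (sum_n_ext (G := R_AbelianMonoid) _ (fun i => sum_n g N * f i)).
  - rewrite sum_n_scal_R. eqR. ring.
  - intros i. rewrite sum_n_scal_R. apply Rmult_comm.
Qed.

Lemma oscillator_derivatives (q l a : R) (X V : R -> R) (t : R) :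
  l <> 0 /\ is_derive X t (V t) /\ is_derive V t (- (q * (l + a)) * X t) ->
  is_derive (fun s => q * X s ^ 2 + V s ^ 2 / l) t (- a * (2 * q * X t * V t / l)) /\
  is_derive (fun s => q * X s ^ 2 - V s ^ 2 / l) t ((2 * l + a) * (2 * q * X t * V t / l)) /\
  is_derive (fun s => 2 * q * X s * V s / l) t
    (- 2 * q * (q * X t ^ 2 - V t ^ 2 / l)
     - a * (q / l * (q * X t ^ 2 - V t ^ 2 / l + (q * X t ^ 2 + V t ^ 2 / l)))).
Proof.
  intros [Hl [D1 D2]].
  assert (E1 : Derive (fun s : R => X s) t = V t) by apply (is_derive_unique _ _ _ D1).
  assert (E2 : Derive (fun s : R => V s) t = - (q * (l + a)) * X t)
    by apply (is_derive_unique _ _ _ D2).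
  refine (conj _ (conj _ _)); (auto_derive;
    [repeat split; eexists; eassumption | rewrite E1, E2; field; exact Hl]).
Qed.

Lemma is_derive_eq (f : R -> R) (t l l' : R) : is_derive f t l -> l = l' -> is_derive f t l'.
Proof. intros H E. now rewrite <- E. Qed.

Section NormalForm.
Variables (m : R) (x v : R -> nat -> R) (al : R -> R).
Hypothesis hm : - 1 / 2 <= m.
Hypothesis Dx : forall n t, is_derive (fun s => x s (S n)) t (v t (S n)).
Hypothesis Dv : forall n t, is_derive (fun s => v s (S n)) t
  (- (INR (S n) ^ 2 * (INR (S n) ^ 2 + m + al t)) * x t (S n)).

Let sq (n : nat) : R := INR (S n) ^ 2.
Let lam (n : nat) : R := sq n + m.
Let Lam : R := 1 + m.

Let Lam_pos : 1 / 2 <= Lam.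
Proof. unfold Lam. lra. Qed.

Let lam_facts n : Lam <= lam n /\ 1 <= sq n /\ sq n <= 2 * lam n.
Proof.
  assert (H := lam_ge m n hm). assert (H1 := S_ge_1 n).
  unfold Lam, lam, sq. repeat split; nra.
Qed.

Let mode_hyps n t : lam n <> 0 /\ is_derive (fun s => x s (S n)) t (v t (S n)) /\
  is_derive (fun s => v s (S n)) t (- (sq n * (lam n + al t)) * x t (S n)).
Proof.
  split; [assert (H := lam_facts n); lra|]. split; [apply Dx|]. apply Dv.
Qed.

(** With [zeta] the square of the complex amplitude of mode [j], weighted so that
    [|zeta| = modeE], these are [modeE = |zeta|], [modeP = Re zeta] and
    [modeR = (j^2 / omega_j) Im zeta]: in these variables the normal form has rational
    coefficients, without the square roots [omega_j]. *)
Definition modeE (t : R) (n : nat) : R :=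
  INR (S n) ^ 2 * x t (S n) ^ 2 + v t (S n) ^ 2 / (INR (S n) ^ 2 + m).
Definition modeP (t : R) (n : nat) : R :=
  INR (S n) ^ 2 * x t (S n) ^ 2 - v t (S n) ^ 2 / (INR (S n) ^ 2 + m).
Definition modeR (t : R) (n : nat) : R :=
  2 * INR (S n) ^ 2 * x t (S n) * v t (S n) / (INR (S n) ^ 2 + m).
Let modeZ (t : R) (n : nat) : R := sq n / lam n * (modeP t n + modeE t n).

Lemma is_derive_modeE n t :
  is_derive (fun s => modeE s n) t (- al t * modeR t n).
Proof. apply (oscillator_derivatives (sq n) (lam n) (al t)), mode_hyps. Qed.

Lemma is_derive_modeP n t :
  is_derive (fun s => modeP s n) t ((2 * lam n + al t) * modeR t n).
Proof. apply (oscillator_derivatives (sq n) (lam n) (al t)), mode_hyps. Qed.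

Lemma is_derive_modeR n t :
  is_derive (fun s => modeR s n) t (- 2 * sq n * modeP t n - al t * modeZ t n).
Proof. apply (oscillator_derivatives (sq n) (lam n) (al t)), mode_hyps. Qed.

Lemma modeE_nonneg t n : 0 <= modeE t n.
Proof.
  assert (H := lam_facts n). unfold modeE. fold (sq n) (lam n).
  apply Rplus_le_le_0_compat.
  - apply Rmult_le_pos; [lra | apply pow2_ge_0].
  - apply Rdiv_le_0_compat; [apply pow2_ge_0 | lra].
Qed.

Lemma modeP_bound t n : Rabs (modeP t n) <= modeE t n.
Proof.
  assert (H := lam_facts n). unfold modeE, modeP. fold (sq n) (lam n).
  assert (0 <= sq n * x t (S n) ^ 2) by (apply Rmult_le_pos; [lra | apply pow2_ge_0]).
  assert (0 <= v t (S n) ^ 2 / lam n) by (apply Rdiv_le_0_compat; [apply pow2_ge_0 | lra]).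
  apply Rabs_le. lra.
Qed.

Lemma modeR_bound t n : Rabs (modeR t n) <= 3 / 2 * modeE t n.
Proof.
  assert (H := lam_facts n). unfold modeE, modeR. fold (sq n) (lam n).
  set (X := x t (S n)). set (V := v t (S n)). set (l := lam n) in *. set (q := sq n) in *.
  clearbody X V l q.
  set (W := V / l).
  replace (2 * q * X * V / l) with (2 * q * X * W) by (unfold W; field; lra).
  replace (V ^ 2 / l) with (l * W ^ 2) by (unfold W; field; lra).
  clearbody W.
  assert (H1 := pow2_ge_0 (q * X - 3 / 2 * (l * W))).
  assert (H2 := pow2_ge_0 (q * X + 3 / 2 * (l * W))).
  assert (H3 : q * (l * W ^ 2) <= 2 * l * (l * W ^ 2)).
  { apply Rmult_le_compat_r; [|lra]. apply Rmult_le_pos; [lra | apply pow2_ge_0]. }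
  assert (HX := pow2_ge_0 X). assert (HW := pow2_ge_0 W).
  assert (H6 : q / 2 * W ^ 2 <= l * W ^ 2) by (apply Rmult_le_compat_r; lra).
  assert (H7 := pow2_ge_0 (3 * X - 2 * W)). assert (H8 := pow2_ge_0 (3 * X + 2 * W)).
  apply Rabs_le. split; nra.
Qed.

Lemma modeZ_bound t n : Rabs (modeZ t n) <= 4 * modeE t n.
Proof.
  assert (H := lam_facts n). unfold modeZ.
  assert (H1 := modeP_bound t n). assert (H2 := modeE_nonneg t n).
  rewrite Rabs_mult, (Rabs_pos_eq (_ / _)) by (apply Rdiv_le_0_compat; lra).
  assert (sq n / lam n <= 2).
  { apply Rmult_le_reg_r with (lam n); [lra|]. unfold Rdiv.
    rewrite Rmult_assoc, Rinv_l; lra. }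
  assert (0 <= sq n / lam n) by (apply Rdiv_le_0_compat; lra).
  assert (Rabs (modeP t n + modeE t n) <= 2 * modeE t n).
  { apply Rabs_le_between in H1. apply Rabs_le. lra. }
  apply Rle_trans with (2 * (2 * modeE t n)); [|lra].
  apply Rmult_le_compat; try lra. apply Rabs_pos.
Qed.

Let ker i k : R := 4 * (sq i + sq k + m).

Let ker_facts i k : 4 * Lam <= ker i k.
Proof.
  unfold ker. assert (H1 := lam_facts i). assert (H2 := lam_facts k).
  unfold lam in H1. lra.
Qed.

Definition actions (N : nat) (t : R) : R := sum_n (modeE t) N.
Let sumR (N : nat) (t : R) : R := sum_n (modeR t) N.
Let sumP1 (N : nat) (t : R) : R := sum_n (fun n => / (2 * lam n) * modeP t n) N.
Let sumR1 (N : nat) (t : R) : R := sum_n (fun n => / (2 * lam n) * modeR t n) N.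

(** Its Poisson bracket with the quadratic Hamiltonian cancels the quartic part of the derivative
    of [actions]. The divisors [2 omega_j] and [2 (omega_j +- omega_k)] of the usual formula
    recombine into [j^2 + m] and [j^2 + k^2 + m], which stay away from zero. *)
Definition corrector (N : nat) (t : R) : R :=
  1 / (4 * PI) * (actions N t * sumP1 N t
    + sum_n (fun i => sum_n (fun k =>
        (modeP t i * modeP t k - modeR t i * modeR t k) / ker i k) N) N).

Let remK (t : R) (i k : nat) : R :=
  (modeR t i * modeP t k + modeP t i * modeR t k
   + modeZ t i * modeR t k + modeR t i * modeZ t k) / ker i k.

Let rem (N : nat) (t : R) : R :=
  1 / (4 * PI) * (actions N t * sumR1 N t - sumR N t * sumP1 N t
    + sum_n (fun i => sum_n (remK t i) N) N).

Let stiff (N : nat) (t : R) : R :=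
  1 / (2 * PI) * sum_n (fun n => INR (S n) ^ 2 * x t (S n) ^ 2) N.

Lemma is_derive_actions N t : is_derive (actions N) t (- al t * sumR N t).
Proof.
  unfold actions, sumR. rewrite <- sum_n_scal_R.
  apply (is_derive_sum_n (K := R_AbsRing) (V := R_NormedModule) (fun n s => modeE s n)).
  intros n _. apply is_derive_modeE.
Qed.

Lemma is_derive_scal_R (a : R) (f : R -> R) t l :
  is_derive f t l -> is_derive (fun s => a * f s) t (a * l).
Proof. intros H. apply (is_derive_scal f t a l H). Qed.

Lemma is_derive_plus_R (f g : R -> R) t l k :
  is_derive f t l -> is_derive g t k -> is_derive (fun s => f s + g s) t (l + k).
Proof. intros H1 H2. apply (is_derive_plus (V := R_NormedModule) f g t l k H1 H2). Qed.

Lemma is_derive_mult_R (f g : R -> R) t l k :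
  is_derive f t l -> is_derive g t k -> is_derive (fun s => f s * g s) t (l * g t + f t * k).
Proof. intros H1 H2. apply (is_derive_mult f g t l k H1 H2). intros; apply Rmult_comm. Qed.

(** The cancellation happens term by term in the double sum: differentiating produces the
    numerators [2 (j^2 + m) + 2 k^2], which simplify with the denominator. *)
Lemma is_derive_pair i k t :
  is_derive (fun s => (modeP s i * modeP s k - modeR s i * modeR s k) / ker i k) t
    (1 / 2 * (modeR t i * modeP t k + modeP t i * modeR t k) + al t * remK t i k).
Proof.
  assert (Hk : ker i k <> 0) by (assert (H := ker_facts i k); lra).
  assert (P1 := is_derive_modeP i t). assert (P2 := is_derive_modeP k t).
  assert (R1 := is_derive_modeR i t). assert (R2 := is_derive_modeR k t).
  assert (D := is_derive_plus_R _ _ _ _ _ (is_derive_mult_R _ _ _ _ _ P1 P2)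
     (is_derive_scal_R (-1) _ _ _ (is_derive_mult_R _ _ _ _ _ R1 R2))).
  apply (is_derive_scal_R (/ ker i k)) in D.
  eapply (is_derive_ext (V := R_NormedModule)); [|eapply is_derive_eq; [exact D|]].
  - intros s. simpl. field. exact Hk.
  - unfold remK. unfold ker, lam in *. field. lra.
Qed.

(** Besides the term of order six there remains the difference between the stiffness and its
    partial sum, which tends to zero as [N] grows. *)
Lemma is_derive_corrected N t :
  is_derive (fun s => actions N s + corrector N s) t
    (- (al t - stiff N t) * sumR N t + al t * rem N t).
Proof.
  assert (DE := is_derive_actions N t).
  assert (DP : is_derive (sumP1 N) t (sumR N t + al t * sumR1 N t)).
  { eapply is_derive_eq.
    - unfold sumP1. apply (is_derive_sum_n (K := R_AbsRing) (V := R_NormedModule)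
        (fun n s => / (2 * lam n) * modeP s n)).
      intros n _. apply is_derive_scal_R, is_derive_modeP.
    - unfold sumR, sumR1. rewrite <- sum_n_scal_R, <- sum_n_plus_R.
      apply sum_n_ext. intros n. eqR. field. assert (H := lam_facts n). lra. }
  assert (DK : is_derive (fun s => sum_n (fun i => sum_n (fun k =>
        (modeP s i * modeP s k - modeR s i * modeR s k) / ker i k) N) N) t
     (sum_n (modeP t) N * sumR N t + al t * sum_n (fun i => sum_n (remK t i) N) N)).
  { eapply is_derive_eq.
    - apply (is_derive_sum_n (K := R_AbsRing) (V := R_NormedModule) (fun i s => sum_n (fun k =>
        (modeP s i * modeP s k - modeR s i * modeR s k) / ker i k) N)).
      intros i _. apply (is_derive_sum_n (K := R_AbsRing) (V := R_NormedModule)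
        (fun k s => (modeP s i * modeP s k - modeR s i * modeR s k) / ker i k)).
      intros k _. apply is_derive_pair.
    - rewrite <- sum_n_scal_R.
      transitivity (1 / 2 * (sum_n (modeR t) N * sum_n (modeP t) N)
         + 1 / 2 * (sum_n (modeP t) N * sum_n (modeR t) N)
         + sum_n (fun i => al t * sum_n (remK t i) N) N); [|unfold sumR; field].
      rewrite <- !sum_n_mult_sum_n, <- !sum_n_scal_R, <- !sum_n_plus_R.
      apply sum_n_ext. intros i.
      rewrite <- !sum_n_scal_R, <- !sum_n_plus_R.
      apply sum_n_ext. intros k. eqR. ring. }
  eapply is_derive_eq.
  - apply is_derive_plus_R; [exact DE|]. unfold corrector. apply is_derive_scal_R.
    apply is_derive_plus_R; [|exact DK]. apply is_derive_mult_R; [exact DE | exact DP].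
  - assert (E : stiff N t = 1 / (4 * PI) * (actions N t + sum_n (modeP t) N)).
    { unfold stiff, actions. rewrite <- sum_n_plus_R.
      transitivity (1 / (4 * PI) * (2 * sum_n (fun n => INR (S n) ^ 2 * x t (S n) ^ 2) N)).
      - field. assert (Hpi := PI_RGT_0). lra.
      - f_equal. rewrite <- sum_n_scal_R. apply sum_n_ext. intros n.
        unfold modeE, modeP. eqR. ring. }
    rewrite E. unfold rem. field. assert (Hpi := PI_RGT_0). lra.
Qed.

Lemma actions_nonneg N t : 0 <= actions N t.
Proof. apply sum_n_nonneg. intros n. apply modeE_nonneg. Qed.

Lemma sumR_bound N t : Rabs (sumR N t) <= 3 / 2 * actions N t.
Proof.
  unfold sumR, actions. rewrite <- sum_n_scal_R. apply Rabs_sum_n_le.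
  intros n. apply modeR_bound.
Qed.

Let scaled_bound (f : nat -> R) (c : R) N t :
  (forall n, Rabs (f n) <= c * modeE t n) -> 
  Rabs (sum_n (fun n => / (2 * lam n) * f n) N) <= c / (2 * Lam) * actions N t.
Proof.
  intros Hf. unfold actions. rewrite <- sum_n_scal_R. apply Rabs_sum_n_le.
  intros n. assert (H := lam_facts n).
  rewrite Rabs_mult, Rabs_pos_eq by (left; apply Rinv_0_lt_compat; lra).
  replace (c / (2 * Lam) * modeE t n) with (/ (2 * Lam) * (c * modeE t n)) by (field; lra).
  apply Rmult_le_compat; [left; apply Rinv_0_lt_compat; lra | apply Rabs_pos | | apply Hf].
  apply Rinv_le_contravar; lra.
Qed.

Let double_bound (f : nat -> nat -> R) (c : R) N t :
  (forall i k, Rabs (f i k) <= c * (modeE t i * modeE t k)) ->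
  Rabs (sum_n (fun i => sum_n (fun k => f i k / ker i k) N) N)
    <= c / (4 * Lam) * actions N t ^ 2.
Proof.
  intros Hf.
  replace (actions N t ^ 2) with (actions N t * actions N t) by ring.
  unfold actions. rewrite <- sum_n_mult_sum_n, <- sum_n_scal_R.
  apply Rabs_sum_n_le. intros i. rewrite <- sum_n_scal_R. apply Rabs_sum_n_le. intros k.
  assert (H := ker_facts i k). unfold Rdiv.
  rewrite Rabs_mult, (Rabs_pos_eq (/ _)) by (left; apply Rinv_0_lt_compat; lra).
  replace (c * / (4 * Lam) * (modeE t i * modeE t k))
    with (c * (modeE t i * modeE t k) * / (4 * Lam)) by ring.
  apply Rmult_le_compat; [apply Rabs_pos | left; apply Rinv_0_lt_compat; lra | apply Hf |].
  apply Rinv_le_contravar; lra.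
Qed.

Let mult_bound a b A B : Rabs a <= A -> Rabs b <= B -> Rabs (a * b) <= A * B.
Proof.
  intros H1 H2. rewrite Rabs_mult. apply Rmult_le_compat; try assumption; apply Rabs_pos.
Qed.

Let pi_bound Q c : Rabs Q <= c -> Rabs (1 / (4 * PI) * Q) <= c / 12.
Proof.
  intros H. assert (Hpi := PI2_3_2). assert (HQ := Rabs_pos Q).
  unfold PI2 in Hpi.
  rewrite Rabs_mult, Rabs_pos_eq by (apply Rdiv_le_0_compat; lra).
  replace (c / 12) with (1 / 12 * c) by field.
  apply Rmult_le_compat; [apply Rdiv_le_0_compat; lra | lra | | exact H].
  unfold Rdiv. apply Rmult_le_compat_l; [lra|]. apply Rinv_le_contravar; lra.
Qed.

Lemma corrector_bound N t : Rabs (corrector N t) <= actions N t ^ 2 / (8 * Lam).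
Proof.
  assert (HE := actions_nonneg N t). set (e := actions N t) in *.
  assert (H1 : Rabs (e * sumP1 N t) <= e * (1 / (2 * Lam) * e)).
  { apply mult_bound; [rewrite Rabs_pos_eq; lra|].
    apply (scaled_bound (modeP t) 1). intros n. rewrite Rmult_1_l. apply modeP_bound. }
  assert (H2 : Rabs (sum_n (fun i => sum_n (fun k =>
        (modeP t i * modeP t k - modeR t i * modeR t k) / ker i k) N) N)
        <= (13 / 4) / (4 * Lam) * e ^ 2).
  { apply (double_bound (fun i k => modeP t i * modeP t k - modeR t i * modeR t k)).
    intros i k. unfold Rminus. eapply Rle_trans; [apply Rabs_triang|].
    rewrite Rabs_Ropp.
    assert (A1 := mult_bound _ _ _ _ (modeP_bound t i) (modeP_bound t k)).
    assert (A2 := mult_bound _ _ _ _ (modeR_bound t i) (modeR_bound t k)). lra. }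
  eapply Rle_trans.
  - unfold corrector. fold e. apply pi_bound.
    eapply Rle_trans; [apply Rabs_triang|].
    apply Rplus_le_compat; [exact H1 | exact H2].
  - apply Rle_trans with (21 / 16 / 12 * (e ^ 2 / Lam)); [right; field; lra|].
    apply Rle_trans with (1 / 8 * (e ^ 2 / Lam)); [|right; field; lra].
    apply Rmult_le_compat_r; [|lra]. apply Rdiv_le_0_compat; [apply pow2_ge_0 | lra].
Qed.

Lemma rem_bound N t : Rabs (rem N t) <= actions N t ^ 2 / (2 * Lam).
Proof.
  assert (HE := actions_nonneg N t). set (e := actions N t) in *.
  assert (H1 : Rabs (e * sumR1 N t) <= e * ((3 / 2) / (2 * Lam) * e)).
  { apply mult_bound; [rewrite Rabs_pos_eq; lra|].
    apply (scaled_bound (modeR t) (3 / 2)). intros n. apply modeR_bound. }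
  assert (H0 : Rabs (sumR N t * sumP1 N t) <= 3 / 2 * e * (1 / (2 * Lam) * e)).
  { apply mult_bound; [apply sumR_bound|].
    apply (scaled_bound (modeP t) 1). intros n. rewrite Rmult_1_l. apply modeP_bound. }
  assert (H2 : Rabs (sum_n (fun i => sum_n (remK t i) N) N) <= 15 / (4 * Lam) * e ^ 2).
  { apply (double_bound (fun i k => modeR t i * modeP t k + modeP t i * modeR t k
      + modeZ t i * modeR t k + modeR t i * modeZ t k)).
    intros i k. 
    assert (A1 := mult_bound _ _ _ _ (modeR_bound t i) (modeP_bound t k)).
    assert (A2 := mult_bound _ _ _ _ (modeP_bound t i) (modeR_bound t k)).
    assert (A3 := mult_bound _ _ _ _ (modeZ_bound t i) (modeR_bound t k)).
    assert (A4 := mult_bound _ _ _ _ (modeR_bound t i) (modeZ_bound t k)).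
    assert (T1 := Rabs_triang (modeR t i * modeP t k) (modeP t i * modeR t k)).
    assert (T2 := Rabs_triang (modeR t i * modeP t k + modeP t i * modeR t k)
      (modeZ t i * modeR t k)).
    eapply Rle_trans; [apply Rabs_triang|]. lra. }
  eapply Rle_trans.
  - unfold rem. fold e. apply pi_bound.
    eapply Rle_trans; [apply Rabs_triang|].
    apply Rplus_le_compat; [|exact H2].
    unfold Rminus. eapply Rle_trans; [apply Rabs_triang|]. rewrite Rabs_Ropp.
    apply Rplus_le_compat; [exact H1 | exact H0].
  - apply Rle_trans with (21 / 4 / 12 * (e ^ 2 / Lam)); [right; field; lra|].
    apply Rle_trans with (1 / 2 * (e ^ 2 / Lam)); [|right; field; lra].
    apply Rmult_le_compat_r; [|lra]. apply Rdiv_le_0_compat; [apply pow2_ge_0 | lra].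
Qed.

(** Mean value theorem for the corrected energy; the corrector itself is small at both ends of
    the interval. *)
Lemma actions_growth N t0 e M tau : 0 <= t0 ->
  (forall t, 0 <= t <= t0 -> actions N t <= e) ->
  (forall t, 0 <= t <= t0 -> Rabs (al t) <= M) ->
  (forall t, 0 <= t <= t0 -> Rabs (al t - stiff N t) <= tau) ->
  actions N t0 <= actions N 0 + actions N 0 ^ 2 / (8 * Lam) + e ^ 2 / (8 * Lam)
    + t0 * (3 / 2 * e * tau + M * (e ^ 2 / (2 * Lam))).
Proof.
  intros Ht He HM Htau.
  assert (Hd : Rabs ((actions N t0 + corrector N t0) - (actions N 0 + corrector N 0))
     <= (3 / 2 * e * tau + M * (e ^ 2 / (2 * Lam))) * Rabs (t0 - 0)).
  { apply (slope_le (fun s => actions N s + corrector N s)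
      (fun t => - (al t - stiff N t) * sumR N t + al t * rem N t)).
    intros t Hz. rewrite Rmin_left, Rmax_right in Hz by lra.
    split; [apply is_derive_corrected|].
    assert (HE := actions_nonneg N t). assert (HE2 := He t Hz).
    eapply Rle_trans; [apply Rabs_triang|]. apply Rplus_le_compat.
    - replace (3 / 2 * e * tau) with (tau * (3 / 2 * e)) by ring.
      apply mult_bound; [rewrite Rabs_Ropp; apply Htau, Hz|].
      eapply Rle_trans; [apply sumR_bound|]. lra.
    - apply mult_bound; [apply HM, Hz|].
      eapply Rle_trans; [apply rem_bound|].
      apply Rmult_le_compat_r; [left; apply Rinv_0_lt_compat; lra|].
      apply pow_incr. lra. }
  rewrite Rminus_0_r, (Rabs_pos_eq t0) in Hd by exact Ht.
  assert (F0 := corrector_bound N 0). assert (F1 := corrector_bound N t0).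
  assert (HE := actions_nonneg N t0).
  assert (F2 : actions N t0 ^ 2 / (8 * Lam) <= e ^ 2 / (8 * Lam)).
  { apply Rmult_le_compat_r; [left; apply Rinv_0_lt_compat; lra|].
    apply pow_incr. split; [lra | apply He; lra]. }
  apply Rabs_le_between in Hd. apply Rabs_le_between in F0. apply Rabs_le_between in F1.
  lra.
Qed.
End NormalForm.

(** * Uniqueness for the Kirchhoff system *)

Lemma Series_le_of_sums (a : nat -> R) (c : R) :
  ex_series a -> (forall N, sum_n a N <= c) -> Series a <= c.
Proof.
  intros Ha H.
  apply (is_lim_seq_le (sum_n a) (fun _ => c) (Series a) c); [exact H | | apply is_lim_seq_const].
  apply (Series_correct a Ha).
Qed.

(** The stiffness [k] is a parameter, so that the same equation serves with and without the
    truncation. *)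
Definition mode_equation (m k : R) (c v : R -> nat -> R) (n : nat) (t : R) : Prop :=
  is_derive (fun s => c s (S n)) t (v t (S n)) /\
  is_derive (fun s => v s (S n)) t
    (- (INR (S n) ^ 2 * (INR (S n) ^ 2 + m + k)) * c t (S n)).

(** Bound in the energy space [H^2 x L^2]. *)
Definition energy_le (c v : nat -> R) (M : R) : Prop :=
  ex_series (fun n => INR (S n) ^ 4 * c (S n) ^ 2) /\
  ex_series (fun n => v (S n) ^ 2) /\
  Series (fun n => INR (S n) ^ 4 * c (S n) ^ 2) <= M /\ Series (fun n => v (S n) ^ 2) <= M.

Lemma amgm2 x y e : 0 < e -> 2 * (Rabs x * Rabs y) <= x ^ 2 / e + e * y ^ 2.
Proof.
  intros He. rewrite <- (pow2_abs x), <- (pow2_abs y).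
  assert (H := pow2_ge_0 (Rabs x - e * Rabs y)).
  apply Rmult_le_reg_r with e; [exact He|].
  replace ((Rabs x ^ 2 / e + e * Rabs y ^ 2) * e) with (Rabs x ^ 2 + e ^ 2 * Rabs y ^ 2)
    by (field; lra). nra.
Qed.

Lemma S_sqr_le_pow4 n : 1 <= INR (S n) ^ 2 <= INR (S n) ^ 4.
Proof.
  assert (H := S_ge_1 n). replace (INR (S n) ^ 4) with (INR (S n) ^ 2 * INR (S n) ^ 2) by ring.
  assert (H1 : 1 <= INR (S n) ^ 2) by nra. nra.
Qed.

Lemma energy_kirch c v M : energy_le c v M ->
  ex_series (fun n => INR (S n) ^ 2 * c (S n) ^ 2) /\ 0 <= kirch c <= M.
Proof.
  intros [H1 [H2 [H3 H4]]].
  assert (Hle : forall n, 0 <= INR (S n) ^ 2 * c (S n) ^ 2 <= INR (S n) ^ 4 * c (S n) ^ 2).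
  { intros n. assert (H := S_sqr_le_pow4 n). assert (Hc := pow2_ge_0 (c (S n))). nra. }
  assert (He : ex_series (fun n => INR (S n) ^ 2 * c (S n) ^ 2)).
  { apply ex_series_dom with (2 := H1). intros n. rewrite Rabs_pos_eq; apply Hle. }
  split; [exact He|]. split; [apply kirch_nonneg, He|].
  unfold kirch. assert (H5 := Series_le _ _ Hle H1).
  assert (H6 := Series_nonneg _ (fun n => proj1 (Hle n)) He).
  assert (Hpi := PI_gt_3).
  apply Rle_trans with (1 * Series (fun n => INR (S n) ^ 2 * c (S n) ^ 2)); [|lra].
  apply Rmult_le_compat_r; [exact H6|].
  apply Rmult_le_reg_r with (2 * PI); [lra|]. field_simplify; lra.
Qed.

Section Uniqueness.
Variables (m T M : R) (c v c' v' : R -> nat -> R).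
Hypothesis Hc : forall n t, 0 <= t <= T -> mode_equation m (kirch (c t)) c v n t.
Hypothesis Hc' : forall n t, 0 <= t <= T -> mode_equation m (kirch (c' t)) c' v' n t.
Hypothesis Hb : forall t, 0 <= t <= T -> energy_le (c t) (v t) M.
Hypothesis Hb' : forall t, 0 <= t <= T -> energy_le (c' t) (v' t) M.
Hypothesis Hinit : forall n, c 0 (S n) = c' 0 (S n) /\ v 0 (S n) = v' 0 (S n).

Let e (t : R) (n : nat) : R :=
  (v t (S n) - v' t (S n)) ^ 2 + INR (S n) ^ 4 * (c t (S n) - c' t (S n)) ^ 2.

Let e_nonneg t n : 0 <= e t n.
Proof.
  apply Rplus_le_le_0_compat; [apply pow2_ge_0|].
  apply Rmult_le_pos; [apply pow_le, pos_INR | apply pow2_ge_0].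
Qed.

Let e_ex t : 0 <= t <= T -> ex_series (e t) /\ Series (e t) <= 8 * M.
Proof.
  intros Ht. destruct (Hb t Ht) as [A1 [A2 [A3 A4]]]. destruct (Hb' t Ht) as [B1 [B2 [B3 B4]]].
  set (g n := 2 * (v t (S n) ^ 2 + v' t (S n) ^ 2)
     + 2 * (INR (S n) ^ 4 * c t (S n) ^ 2 + INR (S n) ^ 4 * c' t (S n) ^ 2)).
  assert (Hg : ex_series g).
  { apply ex_series_plus_R; apply ex_series_scal_R, ex_series_plus_R; assumption. }
  assert (Hle : forall n, Rabs (e t n) <= g n).
  { intros n. rewrite Rabs_pos_eq by apply e_nonneg. unfold e, g.
    assert (H1 := pow2_ge_0 (v t (S n) + v' t (S n))).
    assert (H2 : 0 <= INR (S n) ^ 4 * (c t (S n) + c' t (S n)) ^ 2).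
    { apply Rmult_le_pos; [apply pow_le, pos_INR | apply pow2_ge_0]. }
    nra. }
  split; [apply ex_series_dom with (1 := Hle); exact Hg|].
  assert (H := Rabs_Series_le _ _ Hle Hg). assert (H2 := Rle_abs (Series (e t))).
  unfold g in H.
  rewrite Series_plus, !Series_scal_l, !Series_plus in H
    by (try (apply ex_series_scal_R; apply ex_series_plus_R); assumption).
  lra.
Qed.

Let Cst : R := Rabs m + M + (1 + 4 * M) * (1 + M) + 1.

Let M_nonneg t : 0 <= t <= T -> 0 <= M.
Proof. intros Ht. assert (H := energy_kirch _ _ _ (Hb t Ht)). lra. Qed.

(** The parameter [eta], of the size of the square root of the energy of the difference, makes
    Young's inequality as good as Cauchy-Schwarz. *)
Let kirch_diff t eta : 0 <= t <= T -> 0 < eta -> Series (e t) <= eta ^ 2 ->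
  Rabs (kirch (c t) - kirch (c' t)) <= (1 + 4 * M) * eta.
Proof.
  intros Ht Heta He.
  destruct (e_ex t Ht) as [Ee _].
  destruct (Hb t Ht) as [A1 [A2 [A3 A4]]]. destruct (Hb' t Ht) as [B1 [B2 [B3 B4]]].
  assert (HM := M_nonneg t Ht).
  set (g n := / eta * e t n
     + eta * (2 * (INR (S n) ^ 4 * c t (S n) ^ 2 + INR (S n) ^ 4 * c' t (S n) ^ 2))).
  assert (Hg : ex_series g).
  { apply ex_series_plus_R; [apply ex_series_scal_R, Ee|].
    apply ex_series_scal_R, ex_series_scal_R, ex_series_plus_R; assumption. }
  assert (HS : Series g <= (1 + 4 * M) * eta).
  { unfold g. rewrite Series_plus, !Series_scal_l, Series_plus; try assumption.
    - assert (/ eta * Series (e t) <= eta).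
      { apply Rmult_le_reg_l with eta; [exact Heta|].
        rewrite <- Rmult_assoc, Rinv_r, Rmult_1_l by lra. lra. }
      nra.
    - apply ex_series_scal_R, Ee.
    - apply ex_series_scal_R, ex_series_scal_R, ex_series_plus_R; assumption. }
  assert (Hle : forall n, Rabs (INR (S n) ^ 2 * c t (S n) ^ 2 - INR (S n) ^ 2 * c' t (S n) ^ 2)
    <= g n).
  { intros n. unfold g, e.
    set (J := INR (S n)). set (p := c t (S n)). set (q := c' t (S n)).
    replace (J ^ 2 * p ^ 2 - J ^ 2 * q ^ 2) with ((J ^ 2 * (p - q)) * (p + q)) by ring.
    rewrite Rabs_mult.
    assert (H := amgm2 (J ^ 2 * (p - q)) (p + q) eta Heta).
    assert (HJ : 1 <= J ^ 4) by (destruct (S_sqr_le_pow4 n); unfold J; lra).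
    assert (H0 : 0 <= / eta) by (left; apply Rinv_0_lt_compat, Heta).
    assert (H1 : (p + q) ^ 2 <= 2 * (J ^ 4 * p ^ 2 + J ^ 4 * q ^ 2)).
    { assert (X := pow2_ge_0 (p - q)). assert (X1 := pow2_ge_0 p). assert (X2 := pow2_ge_0 q).
      nra. }
    assert (H2 := pow2_ge_0 (v t (S n) - v' t (S n))).
    assert (H3 := Rmult_le_pos _ _ (Rabs_pos (J ^ 2 * (p - q))) (Rabs_pos (p + q))).
    replace ((J ^ 2 * (p - q)) ^ 2 / eta) with (/ eta * (J ^ 4 * (p - q) ^ 2)) in H
      by (field; lra).
    assert (H4 := Rmult_le_pos _ _ H0 H2). assert (H5 := Rmult_le_compat_l eta _ _ (Rlt_le _ _ Heta) H1).
    lra. }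
  unfold kirch. rewrite <- Rmult_minus_distr_l.
  rewrite <- Series_minus by (apply (energy_kirch _ _ _ (Hb t Ht)) || apply (energy_kirch _ _ _ (Hb' t Ht))).
  assert (Hpi := PI_gt_3).
  rewrite Rabs_mult, (Rabs_pos_eq (1 / _)) by (apply Rdiv_le_0_compat; lra).
  apply Rle_trans with (1 * Series g); [|lra].
  apply Rmult_le_compat; [apply Rdiv_le_0_compat; lra | apply Rabs_pos | |].
  - apply Rmult_le_reg_r with (2 * PI); [lra|]. field_simplify; lra.
  - apply Rabs_Series_le; [exact Hle | exact Hg].
Qed.

Let e' (t : R) (n : nat) : R :=
  - 2 * (m + kirch (c t)) * (INR (S n) ^ 2 * (c t (S n) - c' t (S n))) * (v t (S n) - v' t (S n))
  - 2 * (kirch (c t) - kirch (c' t)) * (INR (S n) ^ 2 * c' t (S n)) * (v t (S n) - v' t (S n)).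

Let is_derive_e n t : 0 <= t <= T -> is_derive (fun s => e s n) t (e' t n).
Proof.
  intros Ht. destruct (Hc n t Ht) as [D1 D2]. destruct (Hc' n t Ht) as [D3 D4].
  unfold e, e'. set (J := INR (S n)) in *. clearbody J.
  assert (A := is_derive_plus_R _ _ _ _ _ D2 (is_derive_scal_R (-1) _ _ _ D4)).
  assert (B := is_derive_plus_R _ _ _ _ _ D1 (is_derive_scal_R (-1) _ _ _ D3)).
  assert (X := is_derive_plus_R _ _ _ _ _ (is_derive_mult_R _ _ _ _ _ A A)
    (is_derive_scal_R (J ^ 4) _ _ _ (is_derive_mult_R _ _ _ _ _ B B))).
  eapply (is_derive_ext (V := R_NormedModule)); [|eapply is_derive_eq; [exact X|]].
  - intros s. simpl. ring.
  - simpl. ring.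
Qed.

Let e'_bound t eta N : 0 <= t <= T -> 0 < eta -> Series (e t) <= eta ^ 2 ->
  Rabs (sum_n (e' t) N) <= Cst * eta ^ 2.
Proof.
  intros Ht Heta He.
  assert (HK := kirch_diff t eta Ht Heta He).
  destruct (e_ex t Ht) as [Ee _]. assert (HM := M_nonneg t Ht).
  destruct (Hb' t Ht) as [B1 [B2 [B3 B4]]].
  destruct (energy_kirch _ _ _ (Hb t Ht)) as [_ Hk].
  set (a := Rabs m + M). set (k := (1 + 4 * M) * eta) in *.
  set (g n := (a + k / eta) * e t n + k * eta * (INR (S n) ^ 4 * c' t (S n) ^ 2)).
  assert (Hk0 : 0 <= k) by (unfold k; apply Rmult_le_pos; lra).
  assert (Hle : forall n, Rabs (e' t n) <= g n).
  { intros n. unfold e', g, e.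
    set (J := INR (S n)). set (d := c t (S n) - c' t (S n)). set (f := v t (S n) - v' t (S n)).
    set (q := c' t (S n)).
    replace (-2 * (m + kirch (c t)) * (J ^ 2 * d) * f) with
      (- ((m + kirch (c t)) * (2 * ((J ^ 2 * d) * f)))) by ring.
    replace (2 * (kirch (c t) - kirch (c' t)) * (J ^ 2 * q) * f) with
      ((kirch (c t) - kirch (c' t)) * (2 * (f * (J ^ 2 * q)))) by ring.
    unfold Rminus at 1. eapply Rle_trans; [apply Rabs_triang|]. rewrite !Rabs_Ropp.
    assert (H1 : Rabs ((m + kirch (c t)) * (2 * (J ^ 2 * d * f))) <= a * (f ^ 2 + J ^ 4 * d ^ 2)).
    { rewrite Rabs_mult. apply Rmult_le_compat; try apply Rabs_pos.
      - unfold a. eapply Rle_trans; [apply Rabs_triang|]. rewrite (Rabs_pos_eq (kirch _)); lra.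
      - apply Rabs_le. assert (X := pow2_ge_0 (J ^ 2 * d - f)).
        assert (Y := pow2_ge_0 (J ^ 2 * d + f)). nra. }
    assert (H2 : Rabs ((kirch (c t) - kirch (c' t)) * (2 * (f * (J ^ 2 * q))))
       <= k * (f ^ 2 / eta + eta * (J ^ 4 * q ^ 2))).
    { rewrite Rabs_mult. apply Rmult_le_compat; try apply Rabs_pos; [exact HK|].
      rewrite !Rabs_mult, <- (Rabs_mult (J ^ 2)), (Rabs_pos_eq 2) by lra.
      eapply Rle_trans; [apply (amgm2 _ _ eta Heta)|]. right. ring. }
    assert (H3 : 0 <= k / eta * (J ^ 4 * d ^ 2)).
    { apply Rmult_le_pos; [apply Rdiv_le_0_compat; assumption|].
      apply Rmult_le_pos; [apply pow_le, pos_INR | apply pow2_ge_0]. }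
    replace ((a + k / eta) * (f ^ 2 + J ^ 4 * d ^ 2) + k * eta * (J ^ 4 * q ^ 2))
      with (a * (f ^ 2 + J ^ 4 * d ^ 2) + k * (f ^ 2 / eta + eta * (J ^ 4 * q ^ 2))
       + k / eta * (J ^ 4 * d ^ 2)) by (field; lra).
    lra. }
  assert (Hg : ex_series g)
    by (apply ex_series_plus_R; apply ex_series_scal_R; assumption).
  assert (Hg0 : forall n, 0 <= g n)
    by (intros n; eapply Rle_trans; [apply Rabs_pos | apply Hle]).
  eapply Rle_trans; [apply (Rabs_sum_n_le _ _ _ Hle)|].
  eapply Rle_trans; [apply (sum_n_le_Series _ _ Hg0 Hg)|].
  unfold g. rewrite Series_plus, !Series_scal_l by (apply ex_series_scal_R; assumption).
  assert (Ha : 0 <= a) by (unfold a; assert (X := Rabs_pos m); lra).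
  assert (Hke : k / eta = 1 + 4 * M) by (unfold k; field; lra).
  apply Rle_trans with ((a + k / eta) * eta ^ 2 + k * eta * M).
  - apply Rplus_le_compat; apply Rmult_le_compat_l; try assumption.
    + rewrite Hke. lra.
    + apply Rmult_le_pos; lra.
  - rewrite Hke. unfold k, Cst. fold a. assert (X := pow2_ge_0 eta). nra.
Qed.

Let Cst_pos t : 0 <= t <= T -> 1 <= Cst.
Proof.
  intros Ht. unfold Cst. assert (HM := M_nonneg t Ht). assert (X := Rabs_pos m). nra.
Qed.

(** Gronwall's lemma in the form of a contraction: the derivative is at most
    [Cst kap exp (2 Cst s)], and the weight makes integration divide by [2 Cst]. *)
Let halving kap : 0 < kap ->
  (forall t, 0 <= t <= T -> Series (e t) <= kap * exp (2 * Cst * t)) ->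
  forall t, 0 <= t <= T -> Series (e t) <= kap / 2 * exp (2 * Cst * t).
Proof.
  intros Hk H t Ht. assert (HC := Cst_pos t Ht).
  apply Series_le_of_sums; [apply e_ex, Ht|]. intros N.
  set (h s := sum_n (e s) N + - kap / 2 * exp (2 * Cst * s)).
  set (h' s := sum_n (e' s) N + - kap / 2 * (2 * Cst * exp (2 * Cst * s))).
  assert (HD : forall s, 0 <= s <= T -> is_derive h s (h' s)).
  { intros s Hs. apply is_derive_plus_R.
    - apply (is_derive_sum_n (K := R_AbsRing) (V := R_NormedModule) (fun n s => e s n)).
      intros n _. apply is_derive_e, Hs.
    - apply is_derive_scal_R. auto_derive; [exact I | ring]. }
  destruct (MVT_gen h 0 t h') as [z [Hz E]].
  - intros s Hs. rewrite Rmin_left, Rmax_right in Hs by lra. apply HD. lra.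
  - intros s Hs. rewrite Rmin_left, Rmax_right in Hs by lra.
    apply continuity_pt_filterlim. eapply is_derive_cont. apply HD. lra.
  - rewrite Rmin_left, Rmax_right in Hz by lra.
    assert (Hz' : 0 <= z <= T) by lra.
    assert (Hp : 0 < kap * exp (2 * Cst * z)) by (apply Rmult_lt_0_compat; [lra | apply exp_pos]).
    assert (Hd := e'_bound z (sqrt (kap * exp (2 * Cst * z))) N Hz' (sqrt_lt_R0 _ Hp)).
    rewrite pow2_sqrt in Hd by lra. specialize (Hd (H z Hz')).
    apply Rabs_le_between in Hd.
    assert (E0 : sum_n (e 0) N = 0).
    { rewrite (sum_n_ext (G := R_AbelianMonoid) _ (fun _ => 0 * 0)).
      - rewrite (sum_n_scal_R 0). apply Rmult_0_l.
      - intros n. unfold e. destruct (Hinit n) as [-> ->]. eqR. ring. }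
    unfold h, h' in E. rewrite E0, Rmult_0_r, exp_0 in E.
    assert (0 <= t - 0) by lra.
    assert (sum_n (e' z) N + - kap / 2 * (2 * Cst * exp (2 * Cst * z)) <= 0) by nra.
    nra.
Qed.

Lemma modes_unique t n : 0 <= t <= T -> c t (S n) = c' t (S n).
Proof.
  intros Ht.
  assert (Hall : forall k s, 0 <= s <= T ->
    Series (e s) <= (8 * M + 1) * (1 / 2) ^ k * exp (2 * Cst * s)).
  { assert (HM := M_nonneg t Ht).
    induction k as [|k IH]; intros s Hs.
    - simpl. rewrite Rmult_1_r. destruct (e_ex s Hs) as [_ He].
      assert (HC := Cst_pos s Hs).
      assert (1 <= exp (2 * Cst * s)).
      { rewrite <- exp_0. apply exp_le. apply Rmult_le_pos; lra. }
      nra.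
    - replace ((8 * M + 1) * (1 / 2) ^ S k) with ((8 * M + 1) * (1 / 2) ^ k / 2)
        by (simpl; field).
      apply halving; [|exact IH | exact Hs].
      apply Rmult_lt_0_compat; [lra | apply pow_lt; lra]. }
  assert (He : Series (e t) <= 0).
  { apply le_of_half_pow with ((8 * M + 1) * exp (2 * Cst * t)). intros k.
    specialize (Hall k t Ht). lra. }
  assert (H1 := term_le_Series (e t) n (e_nonneg t) (proj1 (e_ex t Ht))).
  assert (H2 : INR (S n) ^ 4 * (c t (S n) - c' t (S n)) ^ 2 <= 0).
  { unfold e in H1 at 1. assert (X := pow2_ge_0 (v t (S n) - v' t (S n))). lra. }
  destruct (S_sqr_le_pow4 n) as [X1 X2].
  assert (X3 := pow2_ge_0 (c t (S n) - c' t (S n))).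
  assert (X4 : (c t (S n) - c' t (S n)) ^ 2 = 0) by nra.
  rewrite <- Rsqr_pow2 in X4. apply Rsqr_0_uniq in X4. lra.
Qed.
End Uniqueness.

(** * Sine series *)

Lemma Series_single (a : nat -> R) k : (forall n, n <> k -> a n = 0) -> Series a = a k.
Proof.
  intros H.
  assert (Hs : is_series a (a k)).
  { apply (tends_iff eventually). intros eps He. exists k. intros N HN.
    assert (E : sum_n a N = a k).
    { induction N as [|N IH].
      - rewrite sum_O. f_equal. lia.
      - rewrite sum_n_S. destruct (Nat.eq_dec k (S N)) as [Hk | Hk].
        + rewrite <- Hk.
          assert (Z : sum_n a N = 0); [|eqR; rewrite Z; ring].
          assert (HN' : (N < k)%nat) by lia. clear -HN' H.
          induction N as [|N IH]; [rewrite sum_O; apply H; lia|].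
          rewrite sum_n_S, IH by lia. rewrite H by lia. eqR. ring.
        + rewrite IH by lia. rewrite (H (S N)) by lia. eqR. ring. }
    change (Rabs (sum_n a N - a k) < eps).
    rewrite E, Rminus_diag, Rabs_R0. exact He. }
  apply is_series_unique, Hs.
Qed.

Definition phi_d (j : nat) (x : R) : R := sqrt (2 / PI) * (INR j * cos (INR j * x)).

Lemma sqrt_2_PI : 0 <= sqrt (2 / PI) <= 1 /\ sqrt (2 / PI) ^ 2 = 2 / PI.
Proof.
  assert (Hpi := PI_gt_3).
  assert (H : 0 <= 2 / PI) by (apply Rdiv_le_0_compat; lra).
  split; [|apply pow2_sqrt, H].
  split; [apply sqrt_pos|]. rewrite <- sqrt_1. apply sqrt_le_1_alt.
  apply Rmult_le_reg_r with PI; [lra|]. unfold Rdiv. rewrite Rmult_assoc, Rinv_l; lra.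
Qed.

Lemma is_derive_phi j x : is_derive (phi j) x (phi_d j x).
Proof.
  unfold phi, phi_d. set (J := INR j). clearbody J.
  auto_derive; [exact I | ring].
Qed.

Lemma is_derive_phi_d j x : is_derive (phi_d j) x (- INR j ^ 2 * phi j x).
Proof.
  unfold phi, phi_d. set (J := INR j). clearbody J.
  auto_derive; [exact I | ring].
Qed.

Lemma phi_continuous j x : continuous (phi j) x.
Proof. eapply is_derive_cont. apply is_derive_phi. Qed.

Lemma phi_d_continuous j x : continuous (phi_d j) x.
Proof. eapply is_derive_cont. apply is_derive_phi_d. Qed.

Lemma phi_bound j x : Rabs (phi j x) <= 1.
Proof.
  unfold phi. assert (H := sqrt_2_PI).
  rewrite Rabs_mult, (Rabs_pos_eq (sqrt _)) by apply H.
  assert (H1 : Rabs (sin (INR j * x)) <= 1) by apply Rabs_le, SIN_bound.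
  assert (H2 := Rabs_pos (sin (INR j * x))). nra.
Qed.

Lemma phi_d_bound j x : Rabs (phi_d j x) <= INR j.
Proof.
  unfold phi_d. assert (H := sqrt_2_PI).
  rewrite !Rabs_mult, (Rabs_pos_eq (sqrt _)) by apply H.
  rewrite (Rabs_pos_eq (INR j)) by apply pos_INR.
  assert (H1 : Rabs (cos (INR j * x)) <= 1) by apply Rabs_le, COS_bound.
  assert (H2 := Rabs_pos (cos (INR j * x))). assert (H3 := pos_INR j).
  assert (H4 : 0 <= INR j * Rabs (cos (INR j * x)) <= INR j) by (split; [apply Rmult_le_pos | ]; nra).
  nra.
Qed.

Lemma phi_0 j : phi j 0 = 0.
Proof. unfold phi. rewrite Rmult_0_r, sin_0. ring. Qed.

Lemma phi_PI j : phi j PI = 0.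
Proof.
  unfold phi. rewrite (sin_eq_0_1 (INR j * PI)); [ring|].
  exists (Z.of_nat j). now rewrite <- INR_IZR_INZ.
Qed.

Lemma RInt_FTC (F f : R -> R) a b :
  (forall x, is_derive F x (f x)) -> (forall x, continuous f x) ->
  RInt f a b = F b - F a.
Proof.
  intros HF Hf. apply (is_RInt_unique (V := R_CompleteNormedModule)).
  apply (is_RInt_derive (V := R_CompleteNormedModule) F f); auto.
Qed.

Lemma cont_plus (f g : R -> R) x : continuous f x -> continuous g x ->
  continuous (fun t => f t + g t) x.
Proof. intros Hf Hg. apply (continuous_plus (V := R_NormedModule) f g x Hf Hg). Qed.

Lemma cont_scal (a : R) (f : R -> R) x : continuous f x -> continuous (fun t => a * f t) x.
Proof. intros Hf. apply cont_mult; [apply continuous_const | exact Hf]. Qed.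

Lemma RInt_plus_cont (f g : R -> R) a b :
  (forall x, continuous f x) -> (forall x, continuous g x) ->
  RInt (fun x => f x + g x) a b = RInt f a b + RInt g a b.
Proof.
  intros Hf Hg. apply (RInt_plus (V := R_CompleteNormedModule) f g);
    apply ex_RInt_cont; assumption.
Qed.

Lemma RInt_scal_cont (f : R -> R) k a b : (forall x, continuous f x) ->
  RInt (fun x => k * f x) a b = k * RInt f a b.
Proof.
  intros Hf. apply (RInt_scal (V := R_CompleteNormedModule) f). apply ex_RInt_cont, Hf.
Qed.

(** Two eigenfunctions of [d^2/dx^2] with the same boundary values: the Wronskian gives the
    orthogonality. *)
Lemma phi_ortho i k : i <> k -> RInt (fun x => phi (S i) x * phi (S k) x) 0 PI = 0.
Proof.
  intros Hik.
  set (a := INR (S i)). set (c := INR (S k)).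
  assert (Hne : a ^ 2 - c ^ 2 <> 0).
  { assert (Ha : 0 < a) by apply S_pos. assert (Hc : 0 < c) by apply S_pos.
    assert (a <> c) by (intros E; apply INR_eq in E; lia).
    replace (a ^ 2 - c ^ 2) with ((a - c) * (a + c)) by ring.
    apply Rmult_integral_contrapositive_currified; lra. }
  assert (C : forall x, continuous (fun x => phi (S i) x * phi (S k) x) x)
    by (intros; apply cont_mult; apply phi_continuous).
  apply Rmult_eq_reg_l with (a ^ 2 - c ^ 2); [|exact Hne].
  rewrite <- RInt_scal_cont by exact C.
  rewrite (RInt_FTC (fun x => phi (S i) x * phi_d (S k) x + (-1) * (phi_d (S i) x * phi (S k) x))).
  - rewrite !phi_0, !phi_PI. eqR. ring.
  - intros x. eapply is_derive_eq.
    + exact (is_derive_plus_R _ _ _ _ _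
        (is_derive_mult_R _ _ _ _ _ (is_derive_phi (S i) x) (is_derive_phi_d (S k) x))
        (is_derive_scal_R (-1) _ _ _
          (is_derive_mult_R _ _ _ _ _ (is_derive_phi_d (S i) x) (is_derive_phi (S k) x)))).
    + fold a c. ring.
  - intros x. apply cont_scal, C.
Qed.

Lemma phi_norm k : RInt (fun x => phi (S k) x * phi (S k) x) 0 PI = 1.
Proof.
  assert (C : forall x, continuous (fun x => phi (S k) x * phi (S k) x) x)
    by (intros; apply cont_mult; apply phi_continuous).
  assert (Hj := S_pos k). destruct sqrt_2_PI as [_ Hs].
  assert (Hpi := PI_RGT_0).
  (* [x / pi - phi phi' / (2 j^2)] is a primitive of [phi^2]. *)
  rewrite (RInt_FTC (fun x => / PI * x + (-1) * (/ (2 * INR (S k) ^ 2) * (phi (S k) x * phi_d (S k) x)))).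
  - rewrite phi_0, phi_PI. eqR. field. split; lra.
  - intros x. eapply is_derive_eq.
    + exact (is_derive_plus_R _ _ _ _ _ (is_derive_scal_R (/ PI) _ _ _ (is_derive_id (K := R_AbsRing) x))
        (is_derive_scal_R (-1) _ _ _ (is_derive_scal_R (/ (2 * INR (S k) ^ 2)) _ _ _
          (is_derive_mult_R _ _ _ _ _ (is_derive_phi (S k) x) (is_derive_phi_d (S k) x))))).
    + unfold one; simpl one. unfold phi, phi_d. set (J := INR (S k)) in *.
      set (s := sqrt (2 / PI)) in *. clearbody J s.
      assert (E := sin2_cos2 (J * x)). unfold Rsqr in E.
      set (sn := sin (J * x)) in *. set (cs := cos (J * x)) in *. clearbody sn cs.
      assert (E2 : cs * cs = 1 - sn * sn) by lra.
      replace (/ PI) with (s ^ 2 / 2) by (rewrite Hs; field; lra).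
      simpl. 
      transitivity (s * s / 2 - s * s / 2 * (cs * cs) + s * s / 2 * (sn * sn)).
      * field. lra.
      * rewrite E2. field.
  - exact C.
Qed.

Lemma phi_d_gram i k :
  RInt (fun x => phi_d (S i) x * phi_d (S k) x) 0 PI
  = INR (S k) ^ 2 * RInt (fun x => phi (S i) x * phi (S k) x) 0 PI.
Proof.
  assert (C1 : forall x, continuous (fun x => phi (S i) x * phi (S k) x) x)
    by (intros; apply cont_mult; apply phi_continuous).
  assert (C2 : forall x, continuous (fun x => phi_d (S i) x * phi_d (S k) x) x)
    by (intros; apply cont_mult; apply phi_d_continuous).
  apply Rminus_diag_uniq.
  transitivity (RInt (fun x => phi_d (S i) x * phi_d (S k) x
     + - INR (S k) ^ 2 * (phi (S i) x * phi (S k) x)) 0 PI).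
  - rewrite RInt_plus_cont, RInt_scal_cont; [ring | exact C1 | exact C2 |].
    intros x. apply cont_scal, C1.
  - rewrite (RInt_FTC (fun x => phi (S i) x * phi_d (S k) x)).
    + rewrite phi_0, phi_PI. eqR. ring.
    + intros x. eapply is_derive_eq; [exact (is_derive_mult_R _ _ _ _ _
        (is_derive_phi (S i) x) (is_derive_phi_d (S k) x))|]. ring.
    + intros x. apply cont_plus; [apply C2 | apply cont_scal, C1].
Qed.

Lemma Series_continuous (a : nat -> R -> R) (M : nat -> R) x :
  ex_series M -> (forall n, continuous (a n) x) -> (forall n y, Rabs (a n y) <= M n) ->
  continuous (fun y => Series (fun n => a n y)) x.
Proof.
  intros HM Hc Hb. apply (Series_dominated (locally x)) with M.
  - exact HM.
  - apply filter_forall. intros y n. apply Hb.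
  - intros n. apply Hb.
  - exact Hc.
Qed.

Lemma continuous_bounded (g : R -> R) a b : a <= b -> (forall x, continuous g x) ->
  exists G, 0 <= G /\ forall x, a <= x <= b -> Rabs (g x) <= G.
Proof.
  intros Hab Hg.
  destruct (continuity_ab_maj (fun x => Rabs (g x)) a b Hab) as [z [Hz _]].
  - intros x _. apply continuity_pt_filterlim.
    apply (continuous_comp g Rabs); [apply Hg | apply continuous_Rabs].
  - exists (Rabs (g z)). split; [apply Rabs_pos | exact Hz].
Qed.

(** Uniform convergence; the factor [g] is an eigenfunction in Parseval's formula and a derivative
    of the test function in the weak formulation. *)
Lemma RInt_Series (a : nat -> R -> R) (M : nat -> R) (g : R -> R) (A B : R) :
  A <= B -> ex_series M -> (forall n x, continuous (a n) x) ->
  (forall n x, Rabs (a n x) <= M n) -> (forall x, continuous g x) ->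
  is_series (fun n => RInt (fun x => a n x * g x) A B)
    (RInt (fun x => Series (fun n => a n x) * g x) A B).
Proof.
  intros HAB HM Hc Hb Hg.
  destruct (continuous_bounded g A B HAB Hg) as [G [HG0 HG]].
  assert (HF : forall x, continuous (fun y => Series (fun n => a n y)) x)
    by (intros x; apply Series_continuous with M; auto).
  assert (Hsum : forall N, (forall x, continuous (fun x => sum_n (fun n => a n x) N) x) /\
    sum_n (fun n => RInt (fun x => a n x * g x) A B) N
    = RInt (fun x => sum_n (fun n => a n x) N * g x) A B).
  { induction N as [|N [IH1 IH2]].
    - split.
      + intros x. apply (continuous_ext (a 0%nat)); [intros; now rewrite sum_O | apply Hc].
      + rewrite sum_O. apply RInt_ext. intros x _. now rewrite sum_O.
    - split.
      + intros x. apply (continuous_ext (fun x => sum_n (fun n => a n x) N + a (S N) x)).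
        * intros y. now rewrite sum_n_S.
        * apply cont_plus; [apply IH1 | apply Hc].
      + transitivity (sum_n (fun n => RInt (fun x => a n x * g x) A B) N
          + RInt (fun x => a (S N) x * g x) A B); [apply sum_n_S|].
        rewrite IH2, <- RInt_plus_cont by (intros; apply cont_mult; auto).
        apply RInt_ext. intros x _. rewrite sum_n_S. eqR. ring. }
  apply (tends_iff eventually). intros eps He.
  destruct (Series_tail_small M (eps / (1 + (B - A) * G)) HM) as [N0 HN0].
  { apply Rdiv_lt_0_compat; [exact He|]. assert (0 <= (B - A) * G) by (apply Rmult_le_pos; lra). lra. }
  exists N0. intros N HN. specialize (HN0 N HN). destruct (Hsum N) as [H1 H2].
  change (Rabs (sum_n (fun n => RInt (fun x => a n x * g x) A B) N
    - RInt (fun x => Series (fun n => a n x) * g x) A B) < eps).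
  rewrite H2.
  set (tail := Rabs (Series (fun k => M (S N + k)%nat))) in *.
  set (d x := sum_n (fun n => a n x) N * g x + (-1) * (Series (fun n => a n x) * g x)).
  assert (Hd : forall x, continuous d x).
  { intros x. apply cont_plus; [|apply cont_scal]; apply cont_mult; auto. }
  replace (_ - _) with (RInt d A B).
  2: { unfold d. rewrite RInt_plus_cont, RInt_scal_cont; [eqR; ring | | |];
       intros x; try apply cont_scal; apply cont_mult; auto. }
  assert (Hbound : Rabs (RInt d A B) <= (B - A) * (tail * G)).
  { apply abs_RInt_le_const; [exact HAB | apply ex_RInt_cont, Hd |].
    intros x Hx. unfold d.
    replace (sum_n (fun n => a n x) N * g x + -1 * (Series (fun n => a n x) * g x))
      with (- (Series (fun n => a n x) - sum_n (fun n => a n x) N) * g x) by ring.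
    rewrite Rabs_mult, Rabs_Ropp.
    apply Rmult_le_compat; [apply Rabs_pos | apply Rabs_pos | | apply HG, Hx].
    rewrite (Series_split (fun n => a n x) N)
      by (apply ex_series_dom with M; [intros n; apply Hb | exact HM]).
    replace (_ + _ - _) with (Series (fun k => a (S N + k)%nat x)) by ring.
    eapply Rle_trans; [|apply Rle_abs].
    apply Rabs_Series_le; [intros k; apply Hb | apply (ex_series_shift M (S N)), HM]. }
  assert (HBG : 0 <= (B - A) * G) by (apply Rmult_le_pos; lra).
  assert (Htl : tail * (1 + (B - A) * G) < eps).
  { replace eps with (eps / (1 + (B - A) * G) * (1 + (B - A) * G)) by (field; lra).
    apply Rmult_lt_compat_r; lra. }
  assert (Htp : 0 <= tail) by apply Rabs_pos.
  eapply Rle_lt_trans; [exact Hbound|]. nra.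
Qed.

Definition sine_series (c : nat -> R) (x : R) : R := Series (fun n => c (S n) * phi (S n) x).
Definition cosine_series (c : nat -> R) (x : R) : R := Series (fun n => c (S n) * phi_d (S n) x).

Lemma sine_term_bound c n x : Rabs (c (S n) * phi (S n) x) <= Rabs (c (S n)).
Proof.
  rewrite Rabs_mult. assert (H := phi_bound (S n) x). assert (H1 := Rabs_pos (c (S n))).
  assert (H2 := Rabs_pos (phi (S n) x)). nra.
Qed.

Lemma cosine_term_bound c n x : Rabs (c (S n) * phi_d (S n) x) <= INR (S n) ^ 1 * Rabs (c (S n)).
Proof.
  rewrite Rabs_mult, pow_1, Rmult_comm. apply Rmult_le_compat_r; [apply Rabs_pos|].
  apply phi_d_bound.
Qed.

Lemma ex_series_lower (c : nat -> R) k l : (k <= l)%nat ->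
  ex_series (fun n => INR (S n) ^ l * Rabs (c (S n))) ->
  ex_series (fun n => INR (S n) ^ k * Rabs (c (S n))).
Proof.
  intros Hkl. apply ex_series_dom. intros n.
  rewrite Rabs_mult, Rabs_Rabsolu, Rabs_pos_eq by apply pow_le, pos_INR.
  apply Rmult_le_compat_r; [apply Rabs_pos|]. apply Rle_pow; [apply S_ge_1 | exact Hkl].
Qed.

Lemma ex_series_abs0 (c : nat -> R) :
  ex_series (fun n => INR (S n) ^ 0 * Rabs (c (S n))) -> ex_series (fun n => Rabs (c (S n))).
Proof. apply ex_series_ext. intros n. simpl. ring. Qed.

Lemma is_derive_sine_series c x : ex_series (fun n => INR (S n) ^ 1 * Rabs (c (S n))) ->
  is_derive (sine_series c) x (cosine_series c x).
Proof.
  intros H. unfold sine_series, cosine_series.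
  apply (is_derive_Series (fun n y => c (S n) * phi (S n) y)
    (fun n y => c (S n) * phi_d (S n) y) (fun n => INR (S n) ^ 1 * Rabs (c (S n))) x 1);
    [lra | exact H | |].
  - apply ex_series_dom with (fun n => Rabs (c (S n))); [intros n; apply sine_term_bound|].
    apply ex_series_abs0, (ex_series_lower c 0 1); [lia | exact H].
  - intros n y _. split; [apply is_derive_scal_R, is_derive_phi | apply cosine_term_bound].
Qed.

Lemma is_derive_cosine_series c x : ex_series (fun n => INR (S n) ^ 2 * Rabs (c (S n))) ->
  is_derive (cosine_series c) x (sine_series (fun j => - INR j ^ 2 * c j) x).
Proof.
  intros H. unfold sine_series, cosine_series.
  rewrite (Series_ext _ (fun n => c (S n) * (- INR (S n) ^ 2 * phi (S n) x)))
    by (intros n; ring).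
  apply (is_derive_Series (fun n y => c (S n) * phi_d (S n) y)
    (fun n y => c (S n) * (- INR (S n) ^ 2 * phi (S n) y))
    (fun n => INR (S n) ^ 2 * Rabs (c (S n))) x 1); [lra | exact H | |].
  - apply ex_series_dom with (fun n => INR (S n) ^ 1 * Rabs (c (S n)));
      [intros n; apply cosine_term_bound|].
    apply (ex_series_lower c 1 2); [lia | exact H].
  - intros n y _. split; [apply is_derive_scal_R, is_derive_phi_d |].
    rewrite !Rabs_mult, Rabs_Ropp, (Rabs_pos_eq (INR _ ^ 2)) by apply pow2_ge_0.
    assert (H1 := phi_bound (S n) y). assert (H2 := Rabs_pos (c (S n))).
    assert (H3 := pow2_ge_0 (INR (S n))). assert (H4 := Rmult_le_pos _ _ H3 H2). nra.
Qed.

Lemma sine_series_coef c f k : ex_series (fun n => Rabs (c (S n))) ->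
  (forall x, 0 <= x <= PI -> f x = sine_series c x) -> coef f (S k) = c (S k).
Proof.
  intros Hc Hf. assert (Hpi := PI_RGT_0). unfold coef.
  rewrite (RInt_ext _ (fun x => Series (fun n => c (S n) * phi (S n) x) * phi (S k) x)).
  2: { intros x Hx. rewrite Rmin_left, Rmax_right in Hx by lra. rewrite Hf by lra. reflexivity. }
  rewrite <- (is_series_unique _ _ (RInt_Series (fun n x => c (S n) * phi (S n) x)
    (fun n => Rabs (c (S n))) (phi (S k)) 0 PI ltac:(lra) Hc
    (fun n x => cont_scal _ _ _ (phi_continuous _ x)) (fun n x => sine_term_bound c n x)
    (phi_continuous (S k)))).
  assert (E : forall n, RInt (fun x => c (S n) * phi (S n) x * phi (S k) x) 0 PI
     = c (S n) * RInt (fun x => phi (S n) x * phi (S k) x) 0 PI).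
  { intros n. rewrite <- RInt_scal_cont by (intros; apply cont_mult; apply phi_continuous).
    apply RInt_ext. intros x _. apply Rmult_assoc. }
  rewrite (Series_single _ k).
  - rewrite E, phi_norm. ring.
  - intros n Hn. rewrite E, phi_ortho by exact Hn. ring.
Qed.

(** The sum is exchanged with the integral twice, once for each factor of the square. *)
Lemma cosine_parseval c : ex_series (fun n => INR (S n) ^ 1 * Rabs (c (S n))) ->
  RInt (fun x => cosine_series c x ^ 2) 0 PI = Series (fun n => INR (S n) ^ 2 * c (S n) ^ 2).
Proof.
  intros Hc. assert (Hpi := PI_RGT_0).
  assert (Cu : forall x, continuous (cosine_series c) x).
  { intros x. apply Series_continuous with (fun n => INR (S n) ^ 1 * Rabs (c (S n)));
      [exact Hc | | intros n y; apply cosine_term_bound].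
    intros n. apply cont_scal, phi_d_continuous. }
  assert (E : forall g : R -> R, (forall x, continuous g x) ->
    RInt (fun x => cosine_series c x * g x) 0 PI
    = Series (fun n => c (S n) * RInt (fun x => phi_d (S n) x * g x) 0 PI)).
  { intros g Hg. symmetry. apply is_series_unique.
    eapply (is_series_ext (V := R_NormedModule)).
    2: apply (RInt_Series (fun n x => c (S n) * phi_d (S n) x)
      (fun n => INR (S n) ^ 1 * Rabs (c (S n))) g 0 PI ltac:(lra) Hc
      (fun n x => cont_scal _ _ _ (phi_d_continuous _ x)) (fun n x => cosine_term_bound c n x) Hg).
    intros n. simpl. rewrite <- RInt_scal_cont
      by (intros; apply cont_mult; [apply phi_d_continuous | apply Hg]).
    apply RInt_ext. intros x _. apply Rmult_assoc. }
  transitivity (RInt (fun x => cosine_series c x * cosine_series c x) 0 PI).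
  { apply RInt_ext. intros x _. eqR. ring. }
  rewrite E by exact Cu. apply Series_ext. intros n.
  rewrite (RInt_ext _ (fun x => cosine_series c x * phi_d (S n) x))
    by (intros; apply Rmult_comm).
  rewrite E by apply phi_d_continuous.
  rewrite (Series_single _ n).
  - rewrite phi_d_gram, phi_norm. ring.
  - intros k Hk. rewrite phi_d_gram, phi_ortho by exact Hk. ring.
Qed.

(** * The weak formulation in terms of modes *)

Section TestFunction.
Variable eta : R -> R.
Hypothesis Heta : test_function eta.

Lemma test_derive x : is_derive eta x (Derive eta x).
Proof. apply Derive_correct. apply (proj1 Heta 1%nat x). Qed.

Lemma test_derive2 x : is_derive (Derive eta) x (Derive_n eta 2 x).
Proof. apply Derive_correct. apply (proj1 Heta 2%nat x). Qed.

Lemma test_continuous x : continuous eta x.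
Proof. eapply is_derive_cont. apply test_derive. Qed.

Lemma test_continuous1 x : continuous (Derive eta) x.
Proof. eapply is_derive_cont. apply test_derive2. Qed.

Lemma test_continuous2 x : continuous (Derive_n eta 2) x.
Proof. apply (ex_derive_continuous (V := R_NormedModule)). apply (proj1 Heta 3%nat x). Qed.

Lemma test_ends : eta 0 = 0 /\ eta PI = 0.
Proof.
  destruct Heta as [_ [a [b [Ha [Hab [Hb H]]]]]]. split; apply H; [left | right]; lra.
Qed.

Lemma test_parts1 n :
  RInt (fun x => phi_d (S n) x * Derive eta x) 0 PI = INR (S n) ^ 2 * coef eta (S n).
Proof.
  destruct test_ends as [E0 E1].
  assert (C1 : forall x, continuous (fun x => phi_d (S n) x * Derive eta x) x)
    by (intros; apply cont_mult; [apply phi_d_continuous | apply test_continuous1]).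
  assert (C2 : forall x, continuous (fun x => eta x * phi (S n) x) x)
    by (intros; apply cont_mult; [apply test_continuous | apply phi_continuous]).
  unfold coef. apply Rminus_diag_uniq.
  transitivity (RInt (fun x => phi_d (S n) x * Derive eta x
     + - INR (S n) ^ 2 * (eta x * phi (S n) x)) 0 PI).
  - rewrite RInt_plus_cont, RInt_scal_cont; [eqR; ring | exact C2 | exact C1 |].
    intros x. apply cont_scal, C2.
  - rewrite (RInt_FTC (fun x => phi_d (S n) x * eta x)).
    + rewrite E0, E1. eqR. ring.
    + intros x. eapply is_derive_eq; [exact (is_derive_mult_R _ _ _ _ _
        (is_derive_phi_d (S n) x) (test_derive x))|]. ring.
    + intros x. apply cont_plus; [apply C1 | apply cont_scal, C2].
Qed.

Lemma test_parts2 n :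
  RInt (fun x => phi (S n) x * Derive_n eta 2 x) 0 PI = - INR (S n) ^ 2 * coef eta (S n).
Proof.
  destruct test_ends as [E0 E1].
  assert (C1 : forall x, continuous (fun x => phi (S n) x * Derive_n eta 2 x) x)
    by (intros; apply cont_mult; [apply phi_continuous | apply test_continuous2]).
  assert (C2 : forall x, continuous (fun x => eta x * phi (S n) x) x)
    by (intros; apply cont_mult; [apply test_continuous | apply phi_continuous]).
  unfold coef. apply Rminus_diag_uniq.
  transitivity (RInt (fun x => phi (S n) x * Derive_n eta 2 x
     + INR (S n) ^ 2 * (eta x * phi (S n) x)) 0 PI).
  - rewrite RInt_plus_cont, RInt_scal_cont; [eqR; ring | exact C2 | exact C1 |].
    intros x. apply cont_scal, C2.
  - rewrite (RInt_FTC (fun x => phi (S n) x * Derive eta x + (-1) * (phi_d (S n) x * eta x))).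
    + rewrite E0, E1, phi_0, phi_PI. eqR. ring.
    + intros x. eapply is_derive_eq; [exact (is_derive_plus_R _ _ _ _ _
        (is_derive_mult_R _ _ _ _ _ (is_derive_phi (S n) x) (test_derive2 x))
        (is_derive_scal_R (-1) _ _ _ (is_derive_mult_R _ _ _ _ _
        (is_derive_phi_d (S n) x) (test_derive x))))|]. ring.
    + intros x. apply cont_plus; [apply C1 | apply cont_scal, C2].
Qed.

(** Two integrations by parts. *)
Lemma test_coef_decay : exists C, 0 <= C /\ forall n, INR (S n) ^ 2 * Rabs (coef eta (S n)) <= C.
Proof.
  assert (Hpi := PI_RGT_0).
  destruct (continuous_bounded (Derive_n eta 2) 0 PI ltac:(lra) test_continuous2) as [G [HG0 HG]].
  exists (PI * G). split; [apply Rmult_le_pos; lra|]. intros n.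
  rewrite <- (Rabs_pos_eq (INR (S n) ^ 2)) by apply pow2_ge_0.
  rewrite <- Rabs_mult.
  rewrite <- Rabs_Ropp, Ropp_mult_distr_l, <- test_parts2.
  eapply Rle_trans; [apply (abs_RInt_le_const _ 0 PI (1 * G)); [lra | |]|].
  - apply ex_RInt_cont. intros; apply cont_mult; [apply phi_continuous | apply test_continuous2].
  - intros t Ht. rewrite Rabs_mult. apply Rmult_le_compat; try apply Rabs_pos; [|apply HG, Ht].
    apply phi_bound.
  - right. eqR. ring.
Qed.

(** The summability required holds for [d] in [h^(s-2)] as soon as [s > 1/2], which covers
    [u_tt]. *)
Lemma test_pairing_summable (d : nat -> R) :
  ex_series (fun n => Rabs (d (S n)) / INR (S n) ^ 2) ->
  ex_series (fun n => d (S n) * coef eta (S n)).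
Proof.
  intros Hd. destruct test_coef_decay as [C [HC0 HC]].
  apply ex_series_dom with (fun n => C * (Rabs (d (S n)) / INR (S n) ^ 2)).
  - intros n. rewrite Rabs_mult.
    assert (HJ : 0 < INR (S n) ^ 2) by (apply pow_lt, S_pos).
    replace (C * (Rabs (d (S n)) / INR (S n) ^ 2)) with (Rabs (d (S n)) * (C / INR (S n) ^ 2))
      by (field; apply Rgt_not_eq, S_pos).
    apply Rmult_le_compat_l; [apply Rabs_pos|].
    apply Rmult_le_reg_l with (INR (S n) ^ 2); [exact HJ|].
    replace (INR (S n) ^ 2 * (C / INR (S n) ^ 2)) with C by (field; apply Rgt_not_eq, S_pos).
    apply HC.
  - apply ex_series_scal_R, Hd.
Qed.
End TestFunction.

Lemma locally_open_interval a b x : a < x < b -> locally x (fun y => a < y < b).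
Proof.
  intros Hx. apply filter_and; [apply open_gt | apply open_lt]; lra.
Qed.

Section SineFunction.
Variables (f : R -> R) (c : nat -> R).
Hypothesis Hc : ex_series (fun n => INR (S n) ^ 2 * Rabs (c (S n))).
Hypothesis Hf : forall x, 0 <= x <= PI -> f x = sine_series c x.

Let Hc1 : ex_series (fun n => INR (S n) ^ 1 * Rabs (c (S n))).
Proof. apply (ex_series_lower c 1 2); [lia | exact Hc]. Qed.

Lemma sine_function_Derive x : 0 < x < PI -> Derive f x = cosine_series c x.
Proof.
  intros Hx. rewrite (Derive_ext_loc f (sine_series c)).
  - apply is_derive_unique, is_derive_sine_series, Hc1.
  - generalize (locally_open_interval 0 PI x Hx). apply filter_imp. intros y Hy. apply Hf. lra.
Qed.

Lemma sine_function_Derive2 x : 0 < x < PI ->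
  Derive_n f 2 x = sine_series (fun j => - INR j ^ 2 * c j) x.
Proof.
  intros Hx. change (Derive_n f 2 x) with (Derive (Derive f) x).
  rewrite (Derive_ext_loc (Derive f) (cosine_series c)).
  - apply is_derive_unique, is_derive_cosine_series, Hc.
  - generalize (locally_open_interval 0 PI x Hx). apply filter_imp. apply sine_function_Derive.
Qed.

Lemma sine_function_kirch : 1 / (2 * PI) * RInt (fun y => Derive f y ^ 2) 0 PI = kirch c.
Proof.
  assert (Hpi := PI_RGT_0). unfold kirch. f_equal. rewrite <- cosine_parseval by exact Hc1.
  apply RInt_ext. intros x Hx. rewrite Rmin_left, Rmax_right in Hx by lra.
  now rewrite sine_function_Derive.
Qed.

(** The sine series of [f] is integrated term by term against the derivatives of [eta], which are
    then moved to the eigenfunctions; [eta] vanishes at both ends. *)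
Lemma sine_function_weak (eta : R -> R) q : test_function eta ->
  is_series (fun n => INR (S n) ^ 2 * (INR (S n) ^ 2 + q) * c (S n) * coef eta (S n))
    (RInt (fun x => Derive_n f 2 x * Derive_n eta 2 x + q * Derive f x * Derive eta x) 0 PI).
Proof.
  intros He. assert (Hpi := PI_RGT_0).
  set (c2 j := - INR j ^ 2 * c j).
  assert (Hc2 : ex_series (fun n => Rabs (c2 (S n)))).
  { eapply ex_series_ext_R; [|exact Hc]. intros n. simpl. unfold c2.
    rewrite Rabs_mult, Rabs_Ropp, (Rabs_pos_eq (INR _ ^ 2)) by apply pow2_ge_0. reflexivity. }
  assert (Ce1 := test_continuous1 eta He). assert (Ce2 := test_continuous2 eta He).
  assert (S2 := RInt_Series (fun n x => c2 (S n) * phi (S n) x)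
    (fun n => Rabs (c2 (S n))) (Derive_n eta 2) 0 PI ltac:(lra) Hc2
    (fun n x => cont_scal _ _ _ (phi_continuous _ x)) (fun n x => sine_term_bound c2 n x) Ce2).
  assert (S1 := RInt_Series (fun n x => c (S n) * phi_d (S n) x)
      (fun n => INR (S n) ^ 1 * Rabs (c (S n))) (Derive eta) 0 PI ltac:(lra) Hc1
      (fun n x => cont_scal _ _ _ (phi_d_continuous _ x)) (fun n x => cosine_term_bound c n x) Ce1).
  apply (is_series_scal (V := R_NormedModule) q) in S1.
  assert (Sp := is_series_plus (V := R_NormedModule) _ _ _ _ S2 S1).
  assert (Cs2 : forall x, continuous (fun x => sine_series c2 x) x).
  { intros x. apply Series_continuous with (fun n => Rabs (c2 (S n)));
      [exact Hc2 | | intros n y; apply sine_term_bound].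
    intros n. apply cont_scal, phi_continuous. }
  assert (Cs1 : forall x, continuous (fun x => cosine_series c x) x).
  { intros x. apply Series_continuous with (fun n => INR (S n) ^ 1 * Rabs (c (S n)));
      [exact Hc1 | | intros n y; apply cosine_term_bound].
    intros n. apply cont_scal, phi_d_continuous. }
  rewrite (RInt_ext _ (fun x => sine_series c2 x * Derive_n eta 2 x
    + q * (cosine_series c x * Derive eta x))).
  2: { intros x Hx. rewrite Rmin_left, Rmax_right in Hx by lra.
       rewrite sine_function_Derive, sine_function_Derive2 by exact Hx. fold c2. eqR. ring. }
  rewrite RInt_plus_cont, RInt_scal_cont.
  - eapply (is_series_ext (V := R_NormedModule)); [|exact Sp].
    intros n.
    change (RInt (fun x => c2 (S n) * phi (S n) x * Derive_n eta 2 x) 0 PI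
      + q * RInt (fun x => c (S n) * phi_d (S n) x * Derive eta x) 0 PI
      = INR (S n) ^ 2 * (INR (S n) ^ 2 + q) * c (S n) * coef eta (S n)).
    rewrite (RInt_ext (fun x => c2 (S n) * phi (S n) x * Derive_n eta 2 x)
      (fun x => c2 (S n) * (phi (S n) x * Derive_n eta 2 x))) by (intros; apply Rmult_assoc).
    rewrite (RInt_ext (fun x => c (S n) * phi_d (S n) x * Derive eta x)
      (fun x => c (S n) * (phi_d (S n) x * Derive eta x))) by (intros; apply Rmult_assoc).
    rewrite !RInt_scal_cont.
    + rewrite test_parts1, test_parts2 by exact He. unfold c2. ring.
    + intros; apply cont_mult; [apply phi_d_continuous | apply Ce1].
    + intros; apply cont_mult; [apply phi_continuous | apply Ce2].
  - intros x. apply cont_mult; [apply Cs1 | apply Ce1].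
  - intros x. apply cont_mult; [apply Cs2 | apply Ce2].
  - intros x. apply cont_scal, cont_mult; [apply Cs1 | apply Ce1].
Qed.
End SineFunction.

(** * Bump functions and the fundamental lemma for sine coefficients *)

(** The factors [1 / t^k] make the family stable under differentiation. *)
Definition flat (k : nat) (t : R) : R :=
  if Rlt_dec 0 t then exp (- / t) / t ^ k else 0.

Lemma flat_neg k t : t <= 0 -> flat k t = 0.
Proof. intros H. unfold flat. destruct (Rlt_dec 0 t); [lra | reflexivity]. Qed.

Lemma flat_pos k t : 0 < t -> flat k t = exp (- / t) / t ^ k.
Proof. intros H. unfold flat. destruct (Rlt_dec 0 t); [reflexivity | lra]. Qed.

Lemma exp_ge_pow y n : 0 <= y -> y ^ n / INR (fact n) <= exp y.
Proof.
  intros Hy. eapply Rle_trans; [|apply (exp_ge_taylor y n Hy)].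
  destruct n as [|n]; [simpl; lra|].
  rewrite tech5. assert (0 <= sum_f_R0 (fun k => y ^ k / INR (fact k)) n); [|lra].
  apply cond_pos_sum. intros k. apply Rdiv_le_0_compat; [apply pow_le, Hy|].
  apply INR_fact_lt_0.
Qed.

Lemma flat_bound k t : Rabs (flat k t) <= INR (fact (S k)) * Rabs t.
Proof.
  assert (Hf := INR_fact_lt_0 (S k)).
  destruct (Rle_dec t 0) as [H | H].
  - rewrite flat_neg, Rabs_R0 by exact H. apply Rmult_le_pos; [lra | apply Rabs_pos].
  - assert (Ht : 0 < t) by lra. rewrite flat_pos by exact Ht.
    assert (Hk : 0 < t ^ k) by apply pow_lt, Ht.
    assert (Hi : 0 < / t) by apply Rinv_0_lt_compat, Ht.
    rewrite Rabs_pos_eq by (apply Rdiv_le_0_compat; [left; apply exp_pos | exact Hk]).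
    rewrite (Rabs_pos_eq t) by lra.
    assert (H1 := exp_ge_pow (/ t) (S k) (Rlt_le _ _ Hi)).
    rewrite exp_Ropp.
    assert (Hp : 0 < (/ t) ^ S k) by apply pow_lt, Hi.
    assert (H2 : / exp (/ t) <= INR (fact (S k)) * t ^ S k).
    { replace (INR (fact (S k)) * t ^ S k) with (/ ((/ t) ^ S k / INR (fact (S k)))).
      - apply Rinv_le_contravar; [|exact H1]. apply Rdiv_lt_0_compat; assumption.
      - rewrite pow_inv. field. split; [apply pow_nonzero; lra | lra]. }
    apply Rmult_le_reg_r with (t ^ k); [exact Hk|].
    unfold Rdiv. rewrite Rmult_assoc, Rinv_l, Rmult_1_r by lra.
    simpl in H2 |- *. lra.
Qed.

Lemma is_derive_flat k t : is_derive (flat k) t (flat (S (S k)) t - INR k * flat (S k) t).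
Proof.
  destruct (Rtotal_order t 0) as [H | [H | H]].
  - rewrite !flat_neg by lra.
    apply (is_derive_ext_loc (V := R_NormedModule) (fun _ => 0)).
    + generalize (open_lt 0 t H). apply filter_imp. intros y Hy. symmetry. apply flat_neg. lra.
    + eapply is_derive_eq; [apply (is_derive_const (V := R_NormedModule))|].
      unfold zero. simpl. ring.
  - (* At [0] the difference quotient of [flat k] is [flat (S k)], which is [O(t)]. *)
    subst t. rewrite !flat_neg by lra. apply is_derive_tends.
    apply (tends_squeeze (locally' 0))
      with (fun y => INR (fact (S (S k))) * Rabs y).
    + exists (mkposreal 1 Rlt_0_1). intros y _ Hy.
      replace (_ - _) with (flat (S k) y).
      * apply flat_bound.
      * rewrite (flat_neg k 0) by lra. unfold flat. destruct (Rlt_dec 0 y).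
        -- simpl. field. split; [apply pow_nonzero|]; lra.
        -- unfold Rdiv. rewrite !Rminus_0_r, !Rmult_0_l. ring.
    + replace 0 with (INR (fact (S (S k))) * Rabs 0) at 2 by (rewrite Rabs_R0; ring).
      intros P HP.
      assert (Hc : continuous (fun y => INR (fact (S (S k))) * Rabs y) 0)
        by apply cont_scal, continuous_Rabs.
      specialize (Hc P HP). unfold filtermap, locally', within in *.
      revert Hc. apply filter_imp. auto.
  - rewrite !flat_pos by exact H.
    apply (is_derive_ext_loc (V := R_NormedModule) (fun y => exp (- / y) * / y ^ k)).
    + generalize (open_gt 0 t H). apply filter_imp. intros y Hy. symmetry. apply flat_pos, Hy.
    + assert (Hk : t ^ k <> 0) by (apply pow_nonzero; lra).
      auto_derive; [split; [lra | split; [exact Hk | exact I]]|].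
      destruct k as [|k]; [simpl; field; lra|].
      assert (Hk' : t ^ k <> 0) by (apply pow_nonzero; lra).
      replace (pred (S k)) with k by reflexivity.
      rewrite S_INR. change (t ^ S (S (S k))) with (t * (t * (t * t ^ k))).
      change (t ^ S (S k)) with (t * (t * t ^ k)). change (t ^ S k) with (t * t ^ k).
      set (p := t ^ k) in *. set (E := exp _). clearbody p E. field. lra.
Qed.

(** A class of functions supported in [[-d, d]], containing a positive bump and closed under
    differentiation: hence all its members are smooth. *)
Inductive bump_class (d : R) : (R -> R) -> Prop :=
| bump_mono a i k : bump_class d (fun z => a * z ^ i * flat k (d ^ 2 - z ^ 2))
| bump_plus f g : bump_class d f -> bump_class d g -> bump_class d (fun z => f z + g z).

Lemma bump_class_support d f z : bump_class d f -> d ^ 2 <= z ^ 2 -> f z = 0.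
Proof.
  intros H Hz. induction H as [a i k | f g _ IHf _ IHg].
  - rewrite flat_neg by lra. ring.
  - rewrite IHf, IHg. ring.
Qed.

Lemma bump_class_derive d f : bump_class d f ->
  exists g, bump_class d g /\ forall z, is_derive f z (g z).
Proof.
  intros H. induction H as [a i k | f g _ [f' [Cf Df]] _ [g' [Cg Dg]]].
  - exists (fun z => (a * INR i) * z ^ pred i * flat k (d ^ 2 - z ^ 2)
      + ((-2 * a) * z ^ S i * flat (S (S k)) (d ^ 2 - z ^ 2)
         + (2 * a * INR k) * z ^ S i * flat (S k) (d ^ 2 - z ^ 2))).
    split; [repeat constructor|]. intros z.
    assert (Dq : is_derive (fun z => d ^ 2 - z ^ 2) z (-2 * z))
      by (auto_derive; [exact I | ring]).
    assert (D := is_derive_comp (flat k) (fun z => d ^ 2 - z ^ 2) z _ _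
      (is_derive_flat k (d ^ 2 - z ^ 2)) Dq).
    assert (Di : is_derive (fun z => a * z ^ i) z (a * (INR i * z ^ pred i)))
      by (auto_derive; [exact I | ring]).
    eapply is_derive_eq; [exact (is_derive_mult_R _ _ _ _ _ Di D)|].
    unfold scal; simpl; unfold mult; simpl. ring.
  - exists (fun z => f' z + g' z). split; [constructor; assumption|].
    intros z. apply is_derive_plus_R; auto.
Qed.

Lemma bump_class_smooth d f y : bump_class d f -> forall n,
  (exists g, bump_class d g /\ forall x, Derive_n (fun x => f (x - y)) n x = g (x - y)) /\
  forall x, ex_derive_n (fun x => f (x - y)) n x.
Proof.
  intros Hf.
  assert (Hsh : forall (g g' : R -> R) (x : R), (forall z : R, is_derive g z (g' z)) ->
    is_derive (fun x => g (x - y)) x (g' (x - y))).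
  { intros g g' x Hg.
    assert (Dq : is_derive (fun x => x - y) x 1) by (auto_derive; [exact I | ring]).
    eapply is_derive_eq; [exact (is_derive_comp g (fun x => x - y) x _ _ (Hg (x - y)) Dq)|].
    apply Rmult_1_l. }
  assert (H : forall n, exists g, bump_class d g /\
    forall x, Derive_n (fun x => f (x - y)) n x = g (x - y)).
  { induction n as [|n [g [Cg Eg]]].
    - exists f. split; [exact Hf | reflexivity].
    - destruct (bump_class_derive d g Cg) as [g' [Cg' Dg]].
      exists g'. split; [exact Cg'|]. intros x. simpl.
      rewrite (Derive_ext _ (fun x => g (x - y))) by exact Eg.
      apply is_derive_unique, Hsh, Dg. }
  intros n. split; [apply H|]. intros x. destruct n as [|n]; [exact I|].
  destruct (H n) as [g [Cg Eg]]. destruct (bump_class_derive d g Cg) as [g' [_ Dg]].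
  simpl. apply (ex_derive_ext (fun x => g (x - y))); [intros; symmetry; apply Eg|].
  eexists. apply Hsh, Dg.
Qed.

(** The trivial factors make [bump d] a generator of [bump_class d] by conversion. *)
Definition bump (d z : R) : R := 1 * z ^ 0 * flat 0 (d ^ 2 - z ^ 2).

Lemma bump_in_class d : bump_class d (bump d).
Proof. apply (bump_mono d 1 0 0). Qed.

Lemma bump_even d z : bump d (- z) = bump d z.
Proof. unfold bump. simpl. f_equal. f_equal. ring. Qed.

Lemma bump_nonneg d z : 0 <= bump d z.
Proof.
  unfold bump. rewrite Rmult_1_l, pow_O, Rmult_1_l.
  destruct (Rle_dec (d ^ 2 - z ^ 2) 0) as [H | H].
  - rewrite flat_neg; lra.
  - rewrite flat_pos by lra. simpl. unfold Rdiv. rewrite Rinv_1, Rmult_1_r. left. apply exp_pos.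
Qed.

Lemma bump_pos d z : - d < z < d -> 0 < bump d z.
Proof.
  intros H. unfold bump. rewrite Rmult_1_l, pow_O, Rmult_1_l, flat_pos by nra.
  simpl. unfold Rdiv. rewrite Rinv_1, Rmult_1_r. apply exp_pos.
Qed.

Lemma bump_class_continuous d f z : bump_class d f -> continuous f z.
Proof.
  intros H. destruct (bump_class_derive d f H) as [g [_ D]].
  eapply is_derive_cont. apply D.
Qed.

Lemma bump_continuous d z : continuous (bump d) z.
Proof. apply (bump_class_continuous d), bump_in_class. Qed.

Definition bump_mass (d : R) : R := RInt (bump d) (- d) d.

(** Cosine transform of the bump: the factor by which mollification with it multiplies
    the [j]-th sine coefficient. *)
Definition bump_factor (d : R) (j : nat) : R :=
  RInt (fun z => bump d z * cos (INR j * z)) (- d) d.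

Lemma bump_mass_pos d : 0 < d -> 0 < bump_mass d.
Proof.
  intros Hd. apply RInt_gt_0; [lra | intros; apply bump_pos; lra |].
  intros; apply bump_continuous.
Qed.

Lemma bump_cos_continuous d j z : continuous (fun z => bump d z * cos (INR j * z)) z.
Proof. apply cont_mult; [apply bump_continuous | apply cont_cos_lin]. Qed.

Lemma bump_factor_near d j : 0 < d ->
  Rabs (bump_factor d j - bump_mass d) <= INR j * d * bump_mass d.
Proof.
  intros Hd.
  replace (bump_factor d j - bump_mass d)
    with (RInt (fun z => bump d z * cos (INR j * z) + (-1) * bump d z) (- d) d).
  2: { rewrite RInt_plus_cont, RInt_scal_cont; [unfold bump_factor, bump_mass; eqR; ring
       | apply bump_continuous | apply bump_cos_continuous |].
       intros x. apply cont_scal, bump_continuous. }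
  assert (C : forall x, continuous (fun z => bump d z * cos (INR j * z) + (-1) * bump d z) x).
  { intros x. apply cont_plus; [apply bump_cos_continuous | apply cont_scal, bump_continuous]. }
  eapply Rle_trans; [apply abs_RInt_le; [lra | apply ex_RInt_cont, C]|].
  unfold bump_mass. rewrite <- RInt_scal_cont by apply bump_continuous.
  apply RInt_le; [lra | | |].
  - apply ex_RInt_cont. intros x.
    apply (continuous_comp (fun z => bump d z * cos (INR j * z) + (-1) * bump d z) Rabs);
      [apply C | apply continuous_Rabs].
  - apply ex_RInt_cont. intros x. apply cont_scal, bump_continuous.
  - intros z Hz.
    replace (bump d z * cos (INR j * z) + -1 * bump d z)
      with (bump d z * (cos (INR j * z) - cos 0)) by (rewrite cos_0; ring).
    rewrite Rabs_mult, (Rabs_pos_eq (bump d z)), Rmult_comm by apply bump_nonneg.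
    apply Rmult_le_compat_r; [apply bump_nonneg|].
    eapply Rle_trans; [apply (slope_le cos (fun s => - sin s) 1)|].
    + intros s _. split; [auto_derive; [exact I | ring]|].
      rewrite Rabs_Ropp. apply Rabs_le, SIN_bound.
    + rewrite Rminus_0_r, Rmult_1_l, Rabs_mult, (Rabs_pos_eq (INR j)) by apply pos_INR.
      apply Rmult_le_compat_l; [apply pos_INR|]. apply Rabs_le. lra.
Qed.

Lemma bump_factor_le d j : 0 < d -> Rabs (bump_factor d j) <= bump_mass d.
Proof.
  intros Hd. unfold bump_factor.
  eapply Rle_trans; [apply abs_RInt_le; [lra | apply ex_RInt_cont, bump_cos_continuous]|].
  apply RInt_le; [lra | | apply ex_RInt_cont, bump_continuous |].
  - apply ex_RInt_cont. intros x.
    apply (continuous_comp (fun z => bump d z * cos (INR j * z)) Rabs);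
      [apply bump_cos_continuous | apply continuous_Rabs].
  - intros z _. rewrite Rabs_mult, (Rabs_pos_eq (bump d z)) by apply bump_nonneg.
    assert (H := bump_nonneg d z).
    assert (H1 : Rabs (cos (INR j * z)) <= 1) by apply Rabs_le, COS_bound. nra.
Qed.

(** Two integrations by parts, without boundary terms. *)
Lemma bump_factor_decay d : 0 < d ->
  exists C, forall n, INR (S n) ^ 2 * Rabs (bump_factor d (S n)) <= C.
Proof.
  intros Hd.
  destruct (bump_class_derive d _ (bump_in_class d)) as [g [Cg Dg]].
  destruct (bump_class_derive d _ Cg) as [h [Ch Dh]].
  assert (Hc : forall z, continuous h z) by (intros; apply (bump_class_continuous d), Ch).
  destruct (continuous_bounded h (- d) d ltac:(lra) Hc) as [G [HG0 HG]].
  exists (2 * d * G). intros n. set (J := INR (S n)).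
  assert (HJ : 0 < J) by apply S_pos.
  assert (C2 : forall z, continuous (fun z => h z * cos (J * z)) z)
    by (intros; apply cont_mult; [apply Hc | apply cont_cos_lin]).
  assert (E : J ^ 2 * bump_factor d (S n) = - RInt (fun z => h z * cos (J * z)) (- d) d).
  { apply Rminus_diag_uniq. unfold bump_factor. fold J.
    transitivity (RInt (fun z => J ^ 2 * (bump d z * cos (J * z)) + h z * cos (J * z)) (- d) d).
    - rewrite RInt_plus_cont, RInt_scal_cont; [eqR; ring | apply bump_cos_continuous | | exact C2].
      intros x. apply cont_scal, bump_cos_continuous.
    - rewrite (RInt_FTC (fun z => J * (bump d z * sin (J * z)) + g z * cos (J * z))).
      + assert (Z : forall f, bump_class d f -> f d = 0 /\ f (- d) = 0).
        { intros f Cf. split; apply (bump_class_support d f _ Cf); right; ring. }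
        destruct (Z _ (bump_in_class d)) as [-> ->]. destruct (Z _ Cg) as [-> ->].
        eqR. ring.
      + intros z.
        assert (Ds : is_derive (fun z => sin (J * z)) z (J * cos (J * z)))
          by (auto_derive; [exact I | ring]).
        assert (Dc : is_derive (fun z => cos (J * z)) z (- J * sin (J * z)))
          by (auto_derive; [exact I | ring]).
        eapply is_derive_eq; [exact (is_derive_plus_R _ _ _ _ _
          (is_derive_scal_R J _ _ _ (is_derive_mult_R _ _ _ _ _ (Dg z) Ds))
          (is_derive_mult_R _ _ _ _ _ (Dh z) Dc))|]. cbv beta. ring.
      + intros z. apply cont_plus; [apply cont_scal, bump_cos_continuous | apply C2]. }
  rewrite <- (Rabs_pos_eq (J ^ 2)) by apply pow2_ge_0.
  rewrite <- Rabs_mult, E, Rabs_Ropp.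
  eapply Rle_trans; [apply (abs_RInt_le_const _ (- d) d (G * 1)); [lra | apply ex_RInt_cont, C2 |]|].
  - intros z Hz. rewrite Rabs_mult. apply Rmult_le_compat; try apply Rabs_pos; [apply HG, Hz|].
    apply Rabs_le, COS_bound.
  - right. eqR. ring.
Qed.

Lemma bump_test_function d y : 0 < d -> d < y < PI - d ->
  test_function (fun x => bump d (x - y)).
Proof.
  intros Hd Hy. split.
  - intros n x. apply (bump_class_smooth d _ y (bump_in_class d)).
  - exists (y - d), (y + d). repeat split; try lra.
    intros x Hx. apply (bump_class_support d _ _ (bump_in_class d)). nra.
Qed.

(** The bump is even, so that only the cosine part of the translated eigenfunction survives. *)
Lemma bump_coef d y j : 0 < d -> d < y < PI - d ->
  coef (fun x => bump d (x - y)) j = bump_factor d j * phi j y.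
Proof.
  intros Hd Hy. unfold coef.
  set (g x := bump d (x - y) * phi j x).
  assert (Cg : forall x, continuous g x).
  { intros x. apply cont_mult; [|apply phi_continuous].
    apply (continuous_comp (fun x => x - y) (bump d)); [|apply bump_continuous].
    apply (ex_derive_continuous (V := R_NormedModule)). auto_derive. exact I. }
  assert (Hz : forall a b, a <= b -> b <= y - d \/ y + d <= a -> RInt g a b = 0).
  { intros a b Hab Ho. rewrite (RInt_ext _ (fun _ => 0)).
    - rewrite (RInt_const (V := R_CompleteNormedModule)). apply Rmult_0_r.
    - intros x Hx. rewrite Rmin_left, Rmax_right in Hx by lra. unfold g.
      rewrite (bump_class_support d _ _ (bump_in_class d)); [apply Rmult_0_l | nra]. }
  rewrite <- (RInt_Chasles (V := R_CompleteNormedModule) g 0 (y - d) PI)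
    by apply ex_RInt_cont, Cg.
  rewrite <- (RInt_Chasles (V := R_CompleteNormedModule) g (y - d) (y + d) PI)
    by apply ex_RInt_cont, Cg.
  rewrite (Hz 0 (y - d)), (Hz (y + d) PI) by lra.
  assert (E : RInt g (y - d) (y + d) = RInt (fun z => g (z + y)) (- d) d).
  { replace (y - d) with (1 * - d + y) by ring. replace (y + d) with (1 * d + y) by ring.
    rewrite <- (RInt_comp_lin (V := R_CompleteNormedModule) g 1 y (- d) d)
      by apply ex_RInt_cont, Cg.
    apply RInt_ext. intros x _. rewrite Rmult_1_l. f_equal. ring. }
  change (0 + (RInt g (y - d) (y + d) + 0) = bump_factor d j * phi j y).
  rewrite E, Rplus_0_l, Rplus_0_r.
  set (J := INR j). set (s := sqrt (2 / PI)).
  set (odd z := bump d z * sin (J * z)).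
  assert (Co : forall z, continuous odd z)
    by (intros; apply cont_mult; [apply bump_continuous | apply cont_sin_lin]).
  assert (Hodd : RInt odd (- d) d = 0).
  { assert (R1 := RInt_reflect odd (- d) d Co). rewrite Ropp_involutive in R1.
    rewrite (RInt_ext (fun z => odd (- z)) (fun z => (-1) * odd z)) in R1.
    2: { intros z _. unfold odd. rewrite bump_even.
         replace (J * - z) with (- (J * z)) by ring. rewrite sin_neg. eqR. ring. }
    rewrite RInt_scal_cont in R1 by exact Co.
    assert (R2 := opp_RInt_swap (V := R_CompleteNormedModule) odd (- d) d (ex_RInt_cont _ _ _ Co)).
    change (- RInt odd (- d) d = RInt odd d (- d)) in R2. lra. }
  rewrite (RInt_ext _ (fun z => s * sin (J * y) * (bump d z * cos (J * z))
      + s * cos (J * y) * odd z)).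
  - rewrite RInt_plus_cont, !RInt_scal_cont, Hodd;
      [unfold bump_factor, phi; fold J s; eqR; ring | exact Co | apply bump_cos_continuous | |].
    + intros z. apply cont_scal, bump_cos_continuous.
    + intros z. apply cont_scal, Co.
  - intros z _. unfold g, phi, odd. fold J s.
    replace (z + y - y) with z by ring. rewrite Rmult_plus_distr_l, sin_plus. eqR. ring.
Qed.

(** At a positive interior maximum the midpoint identity forces the maximal value to be taken
    on both sides, arbitrarily close to one of the end points, where [D] vanishes. *)
Lemma midpoint_le_0 (D : R -> R) :
  (forall x, continuous D x) -> D 0 = 0 -> D PI = 0 ->
  (forall a c, 0 < a -> a < c -> c < PI -> D a + D c = 2 * D ((a + c) / 2)) ->
  forall x, 0 <= x <= PI -> D x <= 0.
Proof.
  intros HD H0 HP Hmid x Hx. assert (Hpi := PI_RGT_0).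
  destruct (continuity_ab_maj D 0 PI ltac:(lra)) as [z [Hz Hz2]].
  { intros c _. apply continuity_pt_filterlim, HD. }
  apply Rle_trans with (D z); [apply Hz, Hx|].
  apply Rnot_lt_le. intros Hpos.
  assert (Hz0 : 0 < z < PI).
  { split; apply Rnot_le_lt; intros Hc.
    - replace z with 0 in Hpos by lra. lra.
    - replace z with PI in Hpos by lra. lra. }
  assert (Hnear : forall a, 0 < a < PI -> 0 < 2 * z - a < PI -> a <> z -> D z <= D a).
  { intros a Ha Hb Hne.
    assert (E : D a + D (2 * z - a) = 2 * D z).
    { destruct (Rlt_dec a (2 * z - a)).
      - rewrite Hmid by lra. do 2 f_equal. field.
      - rewrite Rplus_comm, Hmid by lra. do 2 f_equal. field. }
    assert (Hb2 := Hz (2 * z - a) ltac:(lra)). lra. }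
  destruct (Rle_dec z (PI / 2)) as [Hzz | Hzz].
  - assert (Hc := proj1 (tends_iff (locally 0) D (D 0)) (HD 0) (D z) Hpos).
    destruct Hc as [r Hr].
    set (a := Rmin (r / 2) (z / 2)).
    assert (Ha : 0 < a <= r / 2 /\ a <= z / 2).
    { unfold a. assert (H := cond_pos r). split; [split|]; [apply Rmin_glb_lt; lra | apply Rmin_l | apply Rmin_r]. }
    assert (Hb : ball 0 r a).
    { change (Rabs (a - 0) < r). rewrite Rminus_0_r, Rabs_pos_eq; assert (H := cond_pos r); lra. }
    specialize (Hr a Hb). rewrite H0, Rminus_0_r in Hr.
    assert (H1 := Hnear a ltac:(lra) ltac:(lra) ltac:(lra)).
    assert (H2 := Rle_abs (D a)). lra.
  - assert (Hc := proj1 (tends_iff (locally PI) D (D PI)) (HD PI) (D z) Hpos).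
    destruct Hc as [r Hr].
    set (a := Rmin (r / 2) ((PI - z) / 2)).
    assert (Ha : 0 < a <= r / 2 /\ a <= (PI - z) / 2).
    { unfold a. assert (H := cond_pos r). split; [split|]; [apply Rmin_glb_lt; lra | apply Rmin_l | apply Rmin_r]. }
    assert (Hb : ball PI r (PI - a)).
    { change (Rabs (PI - a - PI) < r). replace (PI - a - PI) with (- a) by ring.
      rewrite Rabs_Ropp, Rabs_pos_eq; assert (H := cond_pos r); lra. }
    specialize (Hr (PI - a) Hb). rewrite HP, Rminus_0_r in Hr.
    assert (H1 := Hnear (PI - a) ltac:(lra) ltac:(lra) ltac:(lra)).
    assert (H2 := Rle_abs (D (PI - a))). lra.
Qed.

Lemma affine_midpoint (D D' : R -> R) a c :
  a < c -> (forall x, a <= x <= c -> is_derive D x (D' x) /\ is_derive D' x 0) ->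
  D a + D c = 2 * D ((a + c) / 2).
Proof.
  intros Hac H.
  assert (H1 : forall x, a <= x <= c -> D' x = D' a).
  { intros x Hx. apply Rminus_diag_uniq, Rabs_eq_0, Rle_antisym; [|apply Rabs_pos].
    rewrite <- (Rmult_0_l (Rabs (x - a))). apply (slope_le D' (fun _ => 0)).
    intros z Hz. rewrite Rmin_left, Rmax_right in Hz by lra.
    split; [apply H; lra | rewrite Rabs_R0; lra]. }
  assert (H2 : forall x, a <= x <= c -> D x = D a + D' a * (x - a)).
  { intros x Hx.
    assert (E : Rabs ((D x + (- D' a) * x) - (D a + (- D' a) * a)) <= 0 * Rabs (x - a)).
    { apply (slope_le (fun x => D x + (- D' a) * x) (fun x => D' x + (- D' a) * 1)).
      intros z Hz. rewrite Rmin_left, Rmax_right in Hz by lra. split.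
      - apply is_derive_plus_R; [apply H; lra|].
        apply is_derive_scal_R, (is_derive_id (K := R_AbsRing)).
      - rewrite (H1 z) by lra. rewrite Rmult_1_r, Rplus_opp_r, Rabs_R0. lra. }
    rewrite Rmult_0_l in E. apply Rabs_le_between in E. lra. }
  rewrite (H2 c), (H2 ((a + c) / 2)) by lra. field.
Qed.

Section Fundamental.
Variable d : nat -> R.
Hypothesis Hd : ex_series (fun n => Rabs (d (S n)) / INR (S n) ^ 2).
Hypothesis Hzero : forall eta, test_function eta -> Series (fun n => d (S n) * coef eta (S n)) = 0.

(** Up to the sign, [c] is the second primitive of the distribution [sum d_n phi_n], and [cm r]
    its mollification by a bump of width [r]. *)
Let c (j : nat) : R := d j / INR j ^ 2.
Let cm (r : R) (j : nat) : R := c j * (bump_factor r j / bump_mass r).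

Let c_abs n : Rabs (c (S n)) = Rabs (d (S n)) / INR (S n) ^ 2.
Proof.
  unfold c. unfold Rdiv. rewrite Rabs_mult, Rabs_inv, (Rabs_pos_eq (_ ^ 2)); [reflexivity|].
  apply pow2_ge_0.
Qed.

Let Hc : ex_series (fun n => Rabs (c (S n))).
Proof.
  eapply ex_series_ext_R; [|exact Hd].
  intros n. symmetry. apply c_abs.
Qed.

Let J_ne n : INR (S n) <> 0.
Proof. apply Rgt_not_eq, S_pos. Qed.

Let cm_summable r : 0 < r -> ex_series (fun n => INR (S n) ^ 2 * Rabs (cm r (S n))).
Proof.
  intros Hr. destruct (bump_factor_decay r Hr) as [C HC].
  assert (Hm := bump_mass_pos r Hr).
  apply ex_series_dom with (fun n => C / bump_mass r * Rabs (c (S n))).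
  2: apply ex_series_scal_R, Hc.
  intros n.
  rewrite Rabs_pos_eq by (apply Rmult_le_pos; [apply pow2_ge_0 | apply Rabs_pos]).
  unfold cm. rewrite Rabs_mult. unfold Rdiv at 1. rewrite Rabs_mult, Rabs_inv.
  rewrite (Rabs_pos_eq (bump_mass r)) by lra.
  replace (INR (S n) ^ 2 * (Rabs (c (S n)) * (Rabs (bump_factor r (S n)) * / bump_mass r)))
    with (INR (S n) ^ 2 * Rabs (bump_factor r (S n)) * (/ bump_mass r * Rabs (c (S n)))) by ring.
  replace (C / bump_mass r * Rabs (c (S n))) with (C * (/ bump_mass r * Rabs (c (S n))))
    by (unfold Rdiv; ring).
  apply Rmult_le_compat_r; [|apply HC].
  apply Rmult_le_pos; [left; apply Rinv_0_lt_compat, Hm | apply Rabs_pos].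
Qed.

Let cm_second_derivative r y : 0 < r -> r < y < PI - r ->
  sine_series (fun j => - INR j ^ 2 * cm r j) y = 0.
Proof.
  intros Hr Hy. assert (Hm := bump_mass_pos r Hr).
  rewrite <- (Rmult_0_r (- / bump_mass r)), <- (Hzero _ (bump_test_function r y Hr Hy)).
  rewrite <- Series_scal_l. unfold sine_series. apply Series_ext. intros n.
  rewrite bump_coef by assumption. unfold cm, c. field. split; [lra | apply J_ne].
Qed.

Let cm_midpoint r a b : 0 < r -> r < a -> a < b -> b < PI - r ->
  sine_series (cm r) a + sine_series (cm r) b = 2 * sine_series (cm r) ((a + b) / 2).
Proof.
  intros Hr Ha Hab Hb. apply affine_midpoint with (cosine_series (cm r)); [exact Hab|].
  intros x Hx. split.
  - apply is_derive_sine_series, (ex_series_lower _ 1 2); [lia | apply cm_summable, Hr].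
  - rewrite <- (cm_second_derivative r x Hr) by lra.
    apply is_derive_cosine_series, cm_summable, Hr.
Qed.

Let cm_tends x : filterlim (fun k : nat => sine_series (cm (/ INR (S k))) x) eventually
  (locally (sine_series c x)).
Proof.
  assert (Hr : forall k, 0 < / INR (S k)) by (intros; apply Rinv_0_lt_compat, S_pos).
  assert (Hinv : filterlim (fun k => / INR (S k)) eventually (locally 0)).
  { assert (H := is_lim_seq_inv _ _ (proj1 (is_lim_seq_incr_1 _ _) is_lim_seq_INR)
      ltac:(discriminate)). exact H. }
  unfold sine_series.
  apply (Series_dominated eventually) with (fun n => Rabs (c (S n))).
  - exact Hc.
  - apply filter_forall. intros k n. eapply Rle_trans; [apply sine_term_bound|].
    unfold cm. rewrite Rabs_mult. rewrite <- (Rmult_1_r (Rabs (c (S n)))) at 2.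
    apply Rmult_le_compat_l; [apply Rabs_pos|].
    assert (Hm := bump_mass_pos _ (Hr k)).
    unfold Rdiv. rewrite Rabs_mult, Rabs_inv, (Rabs_pos_eq (bump_mass _)) by lra.
    apply Rmult_le_reg_r with (bump_mass (/ INR (S k))); [exact Hm|].
    rewrite Rmult_assoc, Rinv_l, Rmult_1_r, Rmult_1_l by lra. apply bump_factor_le, Hr.
  - intros n. apply sine_term_bound.
  - intros n. apply (tends_mult eventually); [|apply tends_const, eventually_filter].
    rewrite <- (Rmult_1_r (c (S n))). unfold cm.
    apply (tends_mult eventually); [apply tends_const, eventually_filter|].
    apply (tends_squeeze eventually) with (fun k => INR (S n) * / INR (S k)).
    + apply filter_forall. intros k. assert (Hm := bump_mass_pos _ (Hr k)).
      replace (bump_factor (/ INR (S k)) (S n) / bump_mass (/ INR (S k)) - 1)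
        with ((bump_factor (/ INR (S k)) (S n) - bump_mass (/ INR (S k)))
           * / bump_mass (/ INR (S k))) by (field; apply Rgt_not_eq, Hm).
      rewrite Rabs_mult, Rabs_inv, (Rabs_pos_eq (bump_mass _)) by lra.
      apply Rmult_le_reg_r with (bump_mass (/ INR (S k))); [exact Hm|].
      rewrite Rmult_assoc, Rinv_l, Rmult_1_r by lra. apply bump_factor_near, Hr.
    + rewrite <- (Rmult_0_r (INR (S n))).
      apply (tends_mult eventually); [apply tends_const, eventually_filter | exact Hinv].
Qed.

Let midpoint a b : 0 < a -> a < b -> b < PI ->
  sine_series c a + sine_series c b = 2 * sine_series c ((a + b) / 2).
Proof.
  intros Ha Hab Hb.
  assert (L1 := tends_plus eventually _ _ _ _ (cm_tends a) (cm_tends b)).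
  assert (L2 := tends_mult eventually _ _ _ _ (tends_const eventually 2) (cm_tends ((a + b) / 2))).
  apply (filterlim_locally_unique (V := R_NormedModule) (F := eventually)
    (fun k : nat => sine_series (cm (/ INR (S k))) a + sine_series (cm (/ INR (S k))) b));
    [exact L1|].
  eapply filterlim_ext_loc; [|exact L2].
  assert (Hinv : filterlim (fun k => / INR (S k)) eventually (locally 0)).
  { assert (H := is_lim_seq_inv _ _ (proj1 (is_lim_seq_incr_1 _ _) is_lim_seq_INR)
      ltac:(discriminate)). exact H. }
  assert (Hmin : 0 < Rmin a (PI - b)) by (apply Rmin_glb_lt; lra).
  generalize (proj1 (tends_iff eventually _ _) Hinv _ Hmin). apply filter_imp.
  intros k Hk. rewrite Rminus_0_r in Hk.
  assert (Hr : 0 < / INR (S k)) by apply Rinv_0_lt_compat, S_pos.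
  rewrite Rabs_pos_eq in Hk by lra.
  assert (M1 := Rmin_l a (PI - b)). assert (M2 := Rmin_r a (PI - b)).
  symmetry. apply cm_midpoint; lra.
Qed.

(** Testing against translates of a bump says that the mollified distribution vanishes away from
    the end points, so that its second primitive is affine there. As the width of the bump
    tends to zero, the continuous function [sum d_n n^-2 phi_n] inherits the midpoint identity;
    it vanishes at both ends, hence everywhere. *)
Lemma coef_zero_of_test n : d (S n) = 0.
Proof.
  assert (Hpi := PI_RGT_0).
  assert (Cont : forall x, continuous (sine_series c) x).
  { intros x. apply Series_continuous with (fun n => Rabs (c (S n)));
      [exact Hc | | intros k y; apply sine_term_bound].
    intros k. apply cont_scal, phi_continuous. }
  assert (E0 : sine_series c 0 = 0).
  { unfold sine_series. rewrite (Series_ext _ (fun n => 0 * 0)) by (intros; rewrite phi_0; ring).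
    rewrite Series_scal_l. ring. }
  assert (E1 : sine_series c PI = 0).
  { unfold sine_series. rewrite (Series_ext _ (fun n => 0 * 0)) by (intros; rewrite phi_PI; ring).
    rewrite Series_scal_l. ring. }
  assert (Z : forall x, 0 <= x <= PI -> sine_series c x = 0).
  { intros x Hx. apply Rle_antisym.
    - apply midpoint_le_0; assumption.
    - assert (H : - sine_series c x <= 0); [|lra].
      apply (midpoint_le_0 (fun x => - sine_series c x)); try (rewrite ?E0, ?E1; ring); [| | exact Hx].
      + intros y. apply (continuous_opp (V := R_NormedModule)), Cont.
      + intros a b Ha Hab Hb. assert (M := midpoint a b Ha Hab Hb). lra. }
  assert (Ec : c (S n) = 0).
  { rewrite <- (sine_series_coef c (fun _ => 0) n Hc) by (intros; symmetry; auto).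
    unfold coef. rewrite (RInt_ext _ (fun _ => 0)) by (intros; apply Rmult_0_l).
    rewrite (RInt_const (V := R_CompleteNormedModule)). apply Rmult_0_r. }
  unfold c in Ec. apply Rmult_eq_reg_r with (/ INR (S n) ^ 2).
  - rewrite Rmult_0_l. exact Ec.
  - apply Rinv_neq_0_compat, pow_nonzero, J_ne.
Qed.
End Fundamental.

(** * Weak solutions solve the Kirchhoff system and are unique *)

Lemma in_interval_locally a b t : in_interval a b t -> locally t (in_interval a b).
Proof.
  intros [Ha Hb]. apply filter_and.
  - destruct a as [a | |]; simpl in *; try tauto.
    + apply (open_gt a t Ha).
    + apply filter_true.
  - destruct b as [b | |]; simpl in *; try tauto.
    + apply (open_lt b t Hb).
    + apply filter_true.
Qed.

Lemma in_interval_between a b t x : in_interval a b 0 -> in_interval a b t ->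
  Rmin 0 t <= x <= Rmax 0 t -> in_interval a b x.
Proof.
  intros [A1 A2] [B1 B2] Hx. unfold in_interval, Rmin, Rmax in *.
  destruct (Rle_dec 0 t); destruct a; destruct b; simpl in *; try tauto; lra.
Qed.

Lemma h_derivative_is_derive a b r c d n t : h_derivative a b r c d -> in_interval a b t ->
  is_derive (fun s => c s (S n)) t (d t (S n)).
Proof.
  intros H Ht. destruct (H t Ht) as [H1 [H2 H3]].
  apply is_derive_tends.
  assert (L : filterlim (fun s => (c s (S n) - c t (S n)) / (s - t) - d t (S n))
    (locally' t) (locally 0)).
  { apply (h_norm_tends_coef (locally' t) r
      (fun tau j => (c tau j - c t j) / (tau - t) - d t j) n); [|exact H3].
    generalize (in_interval_locally a b t Ht). unfold locally', within. apply filter_imp.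
    intros s Hs _. destruct (H s Hs) as [Hc _].
    apply in_h_minus; [|exact H2].
    apply in_h_dom with (fun j => / (s - t) * (c s j - c t j)).
    - intros k. right. f_equal. unfold Rdiv. apply Rmult_comm.
    - apply in_h_scal, in_h_minus; assumption. }
  assert (L2 := tends_plus (locally' t) _ _ _ _ L
     (tends_const (locally' t) (d t (S n)))).
  rewrite Rplus_0_l in L2. eapply filterlim_ext; [|exact L2].
  intros s. simpl. ring.
Qed.

(** The embedding of [h^s] into [l^1]. *)
Lemma h_norm_embedding s : 1 / 2 < s -> exists Z, 0 <= Z /\ forall f, in_h s f ->
  Series (fun n => Rabs (f (S n))) <= Z * h_norm s f.
Proof.
  intros Hs. set (z n := Rpower (INR (S n)) (- (2 * s))).
  assert (Hz : ex_series z) by (apply ex_series_Rpower; lra).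
  assert (HZ0 : 0 <= Series z)
    by (apply Series_nonneg; [intros n; left; apply Rpower_pos | exact Hz]).
  exists (1 + Series z). split; [lra|]. intros f Hf.
  assert (Hsum := in_h_summable s f Hs Hf).
  destruct (Rle_lt_or_eq_dec 0 (h_norm s f) (h_norm_pos s f)) as [Hpos | Heq].
  - set (e := h_norm s f) in *.
    set (g n := / e * (f (S n) ^ 2 * Rpower (INR (S n)) (2 * s)) + e * z n).
    assert (Hg : ex_series g)
      by (apply ex_series_plus_R; apply ex_series_scal_R; [exact Hf | exact Hz]).
    apply Rle_trans with (Series g).
    + apply Series_le; [|exact Hg]. intros n. split; [apply Rabs_pos|].
      unfold g, z. set (P := Rpower (INR (S n)) s).
      assert (HP : 0 < P) by apply Rpower_pos.
      rewrite Rpower_Ropp, <- Rpower_sqr. fold P.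
      assert (A := amgm2 (f (S n) * P) (/ P) e Hpos).
      rewrite Rabs_mult, (Rabs_pos_eq P), (Rabs_pos_eq (/ P)) in A
        by (try (left; apply Rinv_0_lt_compat); lra).
      replace (Rabs (f (S n)) * P * / P) with (Rabs (f (S n))) in A by (field; lra).
      replace ((f (S n) * P) ^ 2 / e) with (/ e * (f (S n) ^ 2 * P ^ 2)) in A by (field; lra).
      rewrite pow_inv in A. assert (X := Rabs_pos (f (S n))). lra.
    + unfold g. rewrite Series_plus, !Series_scal_l by (apply ex_series_scal_R; assumption).
      rewrite <- h_norm_sqr by exact Hf. fold e. right. field. lra.
  - rewrite <- Heq, Rmult_0_r.
    rewrite (Series_ext _ (fun n => 0 * 0)); [rewrite Series_scal_l; lra|].
    intros n. rewrite Rmult_0_l. apply Rle_antisym; [|apply Rabs_pos].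
    assert (H := h_norm_term s f n Hf). rewrite <- Heq in H.
    assert (Hp := Rpower_pos (INR (S n)) s). assert (X := Rabs_pos (f (S n))). nra.
Qed.

Lemma in_H_sine_series s k f : 1 / 2 < s -> in_H (s + INR k) f ->
  ex_series (fun n => INR (S n) ^ k * Rabs (coef f (S n))) /\
  forall x, 0 <= x <= PI -> f x = sine_series (coef f) x.
Proof.
  intros Hs [H1 H2]. split; [apply in_h_summable_pow with s; assumption|].
  intros x Hx. symmetry. apply is_series_unique, H2, Hx.
Qed.

Lemma coef_ext f g j : (forall x, 0 <= x <= PI -> f x = g x) -> coef f j = coef g j.
Proof.
  intros H. unfold coef. apply RInt_ext. intros x Hx. assert (Hpi := PI_RGT_0).
  rewrite Rmin_left, Rmax_right in Hx by lra. rewrite H by lra. reflexivity.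
Qed.

Section WeakSolution.
Variables (m s : R) (u0 v0 : R -> R) (a b : Rbar) (u : R -> R -> R).
Hypothesis hs : 1 / 2 < s.

(** The residual of the equations of the modes lies in [h^(s-2)] and is orthogonal to all test
    functions. The initial velocity is prescribed pointwise in [x]; it is identified with the
    derivative in [h^s] through the embedding into continuous functions. *)
Lemma weak_solution_modes : weak_solution m s u0 v0 a b u ->
  in_interval a b 0 /\ (forall t, in_interval a b t -> in_H (s + 2) (u t)) /\
  exists v,
    (forall n t, in_interval a b t -> mode_equation m (kirch (coef (u t))) (fun t => coef (u t)) v n t) /\
    h_continuous a b (s + 2) (fun t => coef (u t)) /\ h_continuous a b s v /\
    (forall n, coef (u 0) (S n) = coef u0 (S n)) /\ (forall n, v 0 (S n) = coef v0 (S n)).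
Proof.
  intros [H0 [HH [Hu0 [Hv0 [v [w [Cu [Du [Cv [Dv [Cw Heq]]]]]]]]]]].
  split; [exact H0|]. split; [exact HH|]. exists v.
  split; [|split; [exact Cu | split; [exact Cv | split]]].
  - intros n t Ht. split; [apply (h_derivative_is_derive a b s _ _ n t Du Ht)|].
    assert (D := h_derivative_is_derive a b (s - 2) _ _ n t Dv Ht).
    eapply is_derive_eq; [exact D|].
    destruct (in_H_sine_series s 2 (u t) hs) as [Hc2 Hsin].
    { simpl INR. replace (s + (1 + 1)) with (s + 2) by ring. apply HH, Ht. }
    assert (Hcs : in_h (s + 2) (coef (u t))) by apply Cu, Ht.
    assert (Hw : in_h (s - 2) (w t)) by apply Cw, Ht.
    set (q := m + kirch (coef (u t))).
    set (e j := INR j ^ 2 * (INR j ^ 2 + q) * coef (u t) j).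
    assert (He : in_h (s - 2) e).
    { apply in_h_weight with (k := INR 4) (C := 1 + Rabs q) (c := coef (u t)).
      - intros k. rewrite Rpower_S_pow. unfold e. rewrite !Rabs_mult.
        apply Rmult_le_compat_r; [apply Rabs_pos|].
        destruct (S_sqr_le_pow4 k) as [X1 X2].
        rewrite (Rabs_pos_eq (_ ^ 2)) by lra.
        replace (INR (S k) ^ 4) with (INR (S k) ^ 2 * INR (S k) ^ 2) by ring.
        set (J := INR (S k) ^ 2) in *.
        assert (X3 := Rabs_triang J q). rewrite (Rabs_pos_eq J) in X3 by lra.
        assert (X4 := Rabs_pos q).
        apply Rle_trans with (J * (J * (1 + Rabs q))); [|right; ring].
        apply Rmult_le_compat_l; [lra|]. nra.
      - replace (s - 2 + INR 4) with (s + 2) by (simpl; ring). exact Hcs. }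
    assert (Hd : in_h (s - 2) (fun j => w t j + e j)) by (apply in_h_plus; assumption).
    assert (Hsum : forall g, in_h (s - 2) g -> ex_series (fun n => Rabs (g (S n)) / INR (S n) ^ 2)).
    { intros g Hg.
      assert (Hg' : in_h s (fun j => g j / INR j ^ 2)).
      { apply in_h_weight with (k := - INR 2) (C := 1) (c := g).
        2: { replace (s + - INR 2) with (s - 2) by (simpl; ring). exact Hg. }
        intros k. rewrite Rpower_Ropp, Rpower_S_pow. unfold Rdiv. rewrite Rabs_mult, Rabs_inv.
        rewrite (Rabs_pos_eq (_ ^ 2)) by apply pow2_ge_0. right. ring. }
      apply in_h_summable in Hg'; [|exact hs].
      eapply ex_series_ext_R; [|exact Hg'].
      intros k. simpl. unfold Rdiv. rewrite Rabs_mult, Rabs_inv.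
      rewrite (Rabs_pos_eq (_ * _)); [reflexivity|]. apply (pow2_ge_0 (INR (S k))). }
    assert (Hz := coef_zero_of_test (fun j => w t j + e j) (Hsum _ Hd)).
    simpl in Hz. cut (w t (S n) + e (S n) = 0); [unfold e, q; intros X; lra|].
    apply Hz. clear Hz n D. intros eta Heta.
    specialize (Heq eta t Heta Ht).
    rewrite (sine_function_kirch (u t) (coef (u t)) Hc2 Hsin) in Heq. fold q in Heq.
    rewrite <- (is_series_unique _ _ (sine_function_weak (u t) (coef (u t)) Hc2 Hsin eta q Heta))
      in Heq.
    rewrite <- Heq, <- Series_plus.
    + apply Series_ext. intros n. unfold e. ring.
    + apply (test_pairing_summable eta Heta (w t)), Hsum, Hw.
    + apply (test_pairing_summable eta Heta e), Hsum, He.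
  - intros n. apply coef_ext, Hu0.
  - assert (Hv : in_h s (v 0)) by apply Cv, H0.
    assert (Hvs := in_h_summable s (v 0) hs Hv).
    intros n. symmetry. apply sine_series_coef; [exact Hvs|].
    intros x Hx. specialize (Hv0 x Hx).
    rewrite <- (is_derive_unique _ _ _ Hv0). apply is_derive_unique. apply is_derive_tends.
    destruct (Du 0 H0) as [Hc0 [_ Hlim]].
    destruct (h_norm_embedding s hs) as [Z [HZ0 HZ]].
    set (f tau j := (coef (u tau) j - coef (u 0) j) / (tau - 0) - v 0 j) in *.
    apply (tends_squeeze (locally' 0))
      with (fun tau => Z * h_norm s (f tau)).
    + generalize (in_interval_locally a b 0 H0). unfold locally', within. apply filter_imp.
      intros tau Htau Hne.
      destruct (Du tau Htau) as [Hct _].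
      assert (Hq : in_h s (fun j => (coef (u tau) j - coef (u 0) j) / (tau - 0))).
      { apply in_h_dom with (fun j => / (tau - 0) * (coef (u tau) j - coef (u 0) j)).
        - intros k. right. f_equal. unfold Rdiv. apply Rmult_comm.
        - apply in_h_scal, in_h_minus; assumption. }
      assert (Hf : in_h s (f tau)) by (apply in_h_minus; assumption).
      destruct (in_H_sine_series s 2 (u tau) hs) as [_ S1].
      { simpl INR. replace (s + (1 + 1)) with (s + 2) by ring. apply HH, Htau. }
      destruct (in_H_sine_series s 2 (u 0) hs) as [_ S2].
      { simpl INR. replace (s + (1 + 1)) with (s + 2) by ring. apply HH, H0. }
      rewrite S1, S2 by exact Hx.
      assert (Hexs : forall g, in_h s g -> ex_series (fun n => g (S n) * phi (S n) x)).
      { intros g Hg. apply ex_series_dom with (fun n => Rabs (g (S n)));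
          [intros k; apply sine_term_bound | apply in_h_summable with s; assumption]. }
      assert (E : (sine_series (coef (u tau)) x - sine_series (coef (u 0)) x) / (tau - 0)
         - sine_series (v 0) x = Series (fun n => f tau (S n) * phi (S n) x)).
      { unfold sine_series. rewrite <- Series_minus by (apply Hexs; assumption).
        unfold Rdiv at 1. rewrite Rmult_comm, <- Series_scal_l, <- Series_minus.
        - apply Series_ext. intros k. unfold f, Rdiv. ring.
        - eapply ex_series_ext_R; [|apply (Hexs _ Hq)].
          intros k. simpl. unfold Rdiv. ring.
        - apply Hexs, Hv. }
      rewrite E. eapply Rle_trans; [|apply HZ, Hf].
      apply Rabs_Series_le; [intros k; apply sine_term_bound|].
      apply in_h_summable with s; assumption.
    + assert (L := tends_mult (locally' 0) _ _ _ _
        (tends_const (locally' 0) Z) Hlim).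
      rewrite Rmult_0_r in L. exact L.
Qed.
End WeakSolution.

(** Used to pass from local to uniform bounds on a compact interval, and for the continuity
    argument in the energy estimate. *)
Lemma real_induction (Q : R -> Prop) T : 0 <= T ->
  (forall t, 0 <= t <= T -> (forall x, 0 <= x < t -> Q x) ->
     exists d, 0 < d /\ forall x, 0 <= x <= T -> x < t + d -> Q x) ->
  forall x, 0 <= x <= T -> Q x.
Proof.
  intros HT H.
  set (E x := 0 <= x <= T /\ forall y, 0 <= y < x -> Q y).
  destruct (completeness E) as [sg [Hub Hlub]].
  - exists T. intros x [Hx _]. lra.
  - exists 0. split; [lra|]. intros y Hy. lra.
  - assert (Hsg : 0 <= sg <= T).
    { split; [apply Hub; split; [lra | intros y Hy; lra]|]. apply Hlub. intros x [Hx _]. lra. }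
    assert (Hbelow : forall x, 0 <= x < sg -> Q x).
    { intros x Hx.
      destruct (Classical_Prop.classic (Q x)) as [Hq | Hq]; [exact Hq|exfalso].
      assert (sg <= x); [|lra]. apply Hlub. intros y [Hy1 Hy2].
      apply Rnot_lt_le. intros Hxy. apply Hq, Hy2. lra. }
    destruct (H sg Hsg Hbelow) as [d [Hd Hq]].
    destruct (Rle_lt_or_eq_dec sg T (proj2 Hsg)) as [Hlt | Heq].
    + exfalso. assert (Hm : Rmin T (sg + d / 2) <= sg).
      { apply Hub. split.
        - split; [apply Rmin_glb; lra | apply Rmin_l].
        - intros y Hy. assert (M1 := Rmin_l T (sg + d / 2)). assert (M2 := Rmin_r T (sg + d / 2)).
          apply Hq; lra. }
      assert (sg < Rmin T (sg + d / 2)) by (apply Rmin_glb_lt; lra). lra.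
    + intros x Hx. apply Hq; [exact Hx | lra].
Qed.

Lemma locally_bounded_bounded (P : R -> R -> Prop) T : 0 <= T ->
  (forall t M M', P t M -> M <= M' -> P t M') ->
  (forall t, 0 <= t <= T -> exists M, locally t (fun x => P x M)) ->
  exists M, forall t, 0 <= t <= T -> P t M.
Proof.
  intros HT Hmono Hloc.
  assert (H : forall x, 0 <= x <= T -> exists M, forall t, 0 <= t <= x -> P t M).
  { apply (real_induction _ T HT). intros t Ht Hbelow.
    destruct (Hloc t Ht) as [M0 [d Hd]]. assert (Hd0 := cond_pos d).
    exists d. split; [exact Hd0|]. intros x Hx Hxt.
    assert (Hnear : forall z, t - d / 2 <= z -> z <= x -> P z M0).
    { intros z Hz1 Hz2. apply Hd. change (Rabs (z - t) < d). apply Rabs_def1; lra. }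
    destruct (Rle_dec (t - d / 2) 0) as [Hs | Hs].
    - exists M0. intros z Hz. apply Hnear; lra.
    - destruct (Hbelow (t - d / 2)) as [M1 HM1]; [lra|].
      exists (Rmax M0 M1). intros z Hz.
      destruct (Rle_dec z (t - d / 2)) as [Hz2 | Hz2].
      + apply Hmono with M1; [apply HM1; lra | apply Rmax_r].
      + apply Hmono with M0; [apply Hnear; lra | apply Rmax_l]. }
  destruct (H T) as [M HM]; [lra|]. exists M. exact HM.
Qed.

Lemma energy_le_mono c v M M' : energy_le c v M -> M <= M' -> energy_le c v M'.
Proof. intros [H1 [H2 [H3 H4]]] H. unfold energy_le. repeat split; try assumption; lra. Qed.

Lemma h_norm_sqr_triangle r c d : in_h r c -> in_h r d ->
  h_norm r c ^ 2 <= 2 * h_norm r (fun j => c j - d j) ^ 2 + 2 * h_norm r d ^ 2.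
Proof.
  intros Hc Hd. assert (Hm := in_h_minus r c d Hc Hd).
  rewrite !h_norm_sqr by assumption.
  rewrite <- !Series_scal_l, <- Series_plus by (apply ex_series_scal_R; assumption).
  apply Series_le.
  - intros n. split; [apply h_term_pos|].
    assert (Hp := Rpower_pos (INR (S n)) (2 * r)).
    set (P := Rpower (INR (S n)) (2 * r)) in *.
    assert (X : c (S n) ^ 2 <= 2 * (c (S n) - d (S n)) ^ 2 + 2 * d (S n) ^ 2).
    { assert (X := pow2_ge_0 (c (S n) - 2 * d (S n))). nra. }
    nra.
  - apply ex_series_plus_R; apply ex_series_scal_R; assumption.
Qed.

Lemma h_norm_bounds_series r k c : in_h r c -> INR k <= 2 * r ->
  ex_series (fun n => INR (S n) ^ k * c (S n) ^ 2) /\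
  Series (fun n => INR (S n) ^ k * c (S n) ^ 2) <= h_norm r c ^ 2.
Proof.
  intros Hc Hk. rewrite h_norm_sqr by exact Hc.
  assert (H : forall n, 0 <= INR (S n) ^ k * c (S n) ^ 2
     <= c (S n) ^ 2 * Rpower (INR (S n)) (2 * r)).
  { intros n. assert (X := pow2_ge_0 (c (S n))).
    assert (Y : 0 <= INR (S n) ^ k) by apply pow_le, pos_INR.
    split; [apply Rmult_le_pos; assumption|].
    rewrite Rmult_comm. apply Rmult_le_compat_l; [exact X|].
    rewrite <- Rpower_S_pow. apply Rpower_S_le, Hk. }
  split.
  - apply ex_series_dom with (2 := Hc). intros n. rewrite Rabs_pos_eq; apply H.
  - apply Series_le; assumption.
Qed.

Lemma h_continuous_locally_bounded a b s c v t : 1 / 2 < s ->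
  h_continuous a b (s + 2) c -> h_continuous a b s v -> in_interval a b t ->
  exists M, locally t (fun x => energy_le (c x) (v x) M).
Proof.
  intros Hs Hc Hv Ht. destruct (Hc t Ht) as [C1 C2]. destruct (Hv t Ht) as [V1 V2].
  exists (2 + 2 * h_norm (s + 2) (c t) ^ 2 + 2 * h_norm s (v t) ^ 2).
  assert (C3 := proj1 (tends_iff (locally t) _ _) C2 1 Rlt_0_1).
  assert (V3 := proj1 (tends_iff (locally t) _ _) V2 1 Rlt_0_1).
  generalize (filter_and _ _ (in_interval_locally a b t Ht) (filter_and _ _ C3 V3)).
  apply filter_imp. intros x [Hx [Hcx Hvx]].
  rewrite Rminus_0_r in Hcx, Hvx.
  rewrite Rabs_pos_eq in Hcx by apply h_norm_pos.
  rewrite Rabs_pos_eq in Hvx by apply h_norm_pos.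
  destruct (Hc x Hx) as [Cx _]. destruct (Hv x Hx) as [Vx _].
  assert (T1 := h_norm_sqr_triangle _ _ _ Cx C1). assert (T2 := h_norm_sqr_triangle _ _ _ Vx V1).
  destruct (h_norm_bounds_series (s + 2) 4 (c x) Cx) as [B1 B2]; [simpl; lra|].
  destruct (h_norm_bounds_series s 0 (v x) Vx) as [B3 B4]; [simpl; lra|].
  assert (P1 := h_norm_pos (s + 2) (fun j => c x j - c t j)).
  assert (P2 := h_norm_pos s (fun j => v x j - v t j)).
  assert (Q1 := pow2_ge_0 (h_norm (s + 2) (c t))). assert (Q2 := pow2_ge_0 (h_norm s (v t))).
  assert (Z1 : h_norm (s + 2) (fun j => c x j - c t j) ^ 2 <= 1) by nra.
  assert (Z2 : h_norm s (fun j => v x j - v t j) ^ 2 <= 1) by nra.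
  assert (E : forall n, INR (S n) ^ 0 * v x (S n) ^ 2 = v x (S n) ^ 2)
    by (intros; simpl; ring).
  rewrite (Series_ext _ _ E) in B4.
  split; [exact B1|]. split; [|lra].
  eapply ex_series_ext_R; [exact E | exact B3].
Qed.

(** The system is reversible, so that negative times reduce to positive ones. *)
Lemma mode_equation_reverse m k c v n t : mode_equation m k c v n (- t) ->
  mode_equation m k (fun x => c (- x)) (fun x j => - v (- x) j) n t.
Proof.
  intros [D1 D2].
  assert (Dn : is_derive (fun x : R => - x) t (-1)) by (auto_derive; [exact I | ring]).
  split.
  - eapply is_derive_eq; [exact (is_derive_comp (fun x => c x (S n)) (fun x => - x) t _ _ D1 Dn)|].
    unfold scal; simpl; unfold mult; simpl. ring.
  - assert (D := is_derive_scal_R (-1) _ _ _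
      (is_derive_comp (fun x => v x (S n)) (fun x => - x) t _ _ D2 Dn)).
    eapply (is_derive_ext (V := R_NormedModule)); [|eapply is_derive_eq; [exact D|]].
    + intros x. simpl. ring.
    + set (J := INR (S n)). unfold scal. simpl. unfold mult. simpl. ring.
Qed.

Lemma locally_opp (P : R -> Prop) t : locally (- t) P -> locally t (fun x => P (- x)).
Proof.
  intros [d Hd]. exists d. intros x Hx. apply Hd.
  assert (E : forall p q : R, Rabs (- p - - q) = Rabs (p - q)).
  { intros p q. rewrite <- Rabs_Ropp. f_equal. ring. }
  change (Rabs (- x - - t) < d). rewrite E. exact Hx.
Qed.

Lemma energy_le_opp c v M : energy_le c v M -> energy_le c (fun j => - v j) M.
Proof.
  intros [H1 [H2 [H3 H4]]].
  assert (E : forall n, v (S n) ^ 2 = (- v (S n)) ^ 2) by (intros; ring).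
  split; [exact H1|]. split; [|split; [exact H3|]].
  - eapply ex_series_ext_R; [exact E | exact H2].
  - rewrite <- (Series_ext _ _ E). exact H4.
Qed.

Lemma modes_agree_forward m T c v c' v' : 0 <= T ->
  (forall n t, 0 <= t <= T -> mode_equation m (kirch (c t)) c v n t) ->
  (forall n t, 0 <= t <= T -> mode_equation m (kirch (c' t)) c' v' n t) ->
  (forall t, 0 <= t <= T -> exists M, locally t (fun x => energy_le (c x) (v x) M)) ->
  (forall t, 0 <= t <= T -> exists M, locally t (fun x => energy_le (c' x) (v' x) M)) ->
  (forall n, c 0 (S n) = c' 0 (S n) /\ v 0 (S n) = v' 0 (S n)) ->
  forall n, c T (S n) = c' T (S n).
Proof.
  intros HT H H' L L' I0 n.
  destruct (locally_bounded_bounded (fun t M => energy_le (c t) (v t) M) T HT) as [M HM];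
    [intros t; apply energy_le_mono | exact L |].
  destruct (locally_bounded_bounded (fun t M => energy_le (c' t) (v' t) M) T HT) as [M' HM'];
    [intros t; apply energy_le_mono | exact L' |].
  apply (modes_unique m T (Rmax M M') c v c' v' H H'); [| | exact I0 | lra].
  - intros t Ht. apply energy_le_mono with M; [apply HM, Ht | apply Rmax_l].
  - intros t Ht. apply energy_le_mono with M'; [apply HM', Ht | apply Rmax_r].
Qed.

Theorem weak_solution_unique m s u0 v0 a b a' b' u u' t x : 1 / 2 < s ->
  weak_solution m s u0 v0 a b u -> weak_solution m s u0 v0 a' b' u' ->
  in_interval a b t -> in_interval a' b' t -> 0 <= x <= PI -> u' t x = u t x.
Proof.
  intros Hs W W' Ht Ht' Hx.
  destruct (weak_solution_modes m s u0 v0 a b u Hs W) as [I0 [HH [v [E [C1 [C2 [J1 J2]]]]]]].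
  destruct (weak_solution_modes m s u0 v0 a' b' u' Hs W')
    as [I0' [HH' [v' [E' [C1' [C2' [J1' J2']]]]]]].
  assert (Hin := in_interval_between a b t). assert (Hin' := in_interval_between a' b' t).
  assert (Hcoef : forall n, coef (u t) (S n) = coef (u' t) (S n)).
  { intros n. destruct (Rle_dec 0 t) as [Hpos | Hneg].
    - assert (B : forall z, 0 <= z <= t -> in_interval a b z /\ in_interval a' b' z).
      { intros z Hz. split; [apply Hin | apply Hin']; try assumption;
        rewrite Rmin_left, Rmax_right; lra. }
      apply (modes_agree_forward m t (fun t => coef (u t)) v (fun t => coef (u' t)) v').
      + exact Hpos.
      + intros k z Hz. apply E, B, Hz.
      + intros k z Hz. apply E', B, Hz.
      + intros z Hz. apply (h_continuous_locally_bounded a b s); try assumption. apply B, Hz.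
      + intros z Hz. apply (h_continuous_locally_bounded a' b' s); try assumption. apply B, Hz.
      + intros k. rewrite J1, J1', J2, J2'. split; reflexivity.
    - assert (B : forall z, 0 <= z <= - t -> in_interval a b (- z) /\ in_interval a' b' (- z)).
      { intros z Hz. split; [apply Hin | apply Hin']; try assumption;
        rewrite Rmin_right, Rmax_left; lra. }
      assert (R1 : forall f : R -> nat -> R, f t (S n) = (fun z => f (- z)) (- t) (S n))
        by (intros f; simpl; now rewrite Ropp_involutive).
      rewrite (R1 (fun t => coef (u t))), (R1 (fun t => coef (u' t))).
      apply (modes_agree_forward m (- t) (fun z => coef (u (- z))) (fun z j => - v (- z) j)
        (fun z => coef (u' (- z))) (fun z j => - v' (- z) j)).
      + lra.
      + intros k z Hz. apply (mode_equation_reverse m _ (fun t => coef (u t))), E, B, Hz.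
      + intros k z Hz. apply (mode_equation_reverse m _ (fun t => coef (u' t))), E', B, Hz.
      + intros z Hz. destruct (h_continuous_locally_bounded a b s _ v (- z) Hs C1 C2) as [M HM];
          [apply B, Hz|].
        exists M. apply locally_opp in HM. revert HM. apply filter_imp.
        intros y. apply energy_le_opp.
      + intros z Hz. destruct (h_continuous_locally_bounded a' b' s _ v' (- z) Hs C1' C2') as [M HM];
          [apply B, Hz|].
        exists M. apply locally_opp in HM. revert HM. apply filter_imp.
        intros y. apply energy_le_opp.
      + intros k. rewrite Ropp_0, J1, J1', J2, J2'. split; reflexivity. }
  assert (S1 : forall u, in_H (s + 2) u -> u x = sine_series (coef u) x).
  { intros w Hw. apply (in_H_sine_series s 2 w Hs); [|exact Hx].
    simpl INR. replace (s + (1 + 1)) with (s + 2) by ring. exact Hw. }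
  rewrite (S1 (u t)), (S1 (u' t)) by auto.
  apply Series_ext. intros n. now rewrite Hcoef.
Qed.

(** * Long-time control of the energy *)

Lemma kirch_le_energy m x v t : - 1 / 2 <= m -> ex_series (modeE m x v t) ->
  (forall n, 0 <= INR (S n) ^ 2 * x t (S n) ^ 2 <= modeE m x v t n) /\
  ex_series (fun n => INR (S n) ^ 2 * x t (S n) ^ 2) /\
  0 <= kirch (x t) <= Series (modeE m x v t) / 6.
Proof.
  intros hm He.
  assert (H : forall n, 0 <= INR (S n) ^ 2 * x t (S n) ^ 2 <= modeE m x v t n).
  { intros n. split; [apply Rmult_le_pos; apply pow2_ge_0|].
    unfold modeE. assert (Hl := lam_ge m n hm).
    assert (0 <= v t (S n) ^ 2 / (INR (S n) ^ 2 + m)); [|lra].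
    apply Rdiv_le_0_compat; [apply pow2_ge_0 | lra]. }
  assert (Hx : ex_series (fun n => INR (S n) ^ 2 * x t (S n) ^ 2)).
  { apply ex_series_dom with (2 := He). intros n. rewrite Rabs_pos_eq; apply H. }
  split; [exact H|]. split; [exact Hx|].
  split; [apply kirch_nonneg, Hx|].
  unfold kirch. assert (Hpi := PI_gt_3).
  assert (H2 := Series_le _ _ H He).
  assert (H3 := Series_nonneg _ (fun n => proj1 (H n)) Hx).
  assert (Hinv : 1 / (2 * PI) <= 1 / 6).
  { unfold Rdiv. apply Rmult_le_compat_l; [lra|]. apply Rinv_le_contravar; lra. }
  assert (0 <= 1 / (2 * PI)) by (apply Rdiv_le_0_compat; lra).
  apply Rle_trans with (1 / 6 * Series (modeE m x v t)); [|lra].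
  apply Rmult_le_compat; assumption.
Qed.

Lemma Series_tail_le (a g : nat -> R) N : (forall n, Rabs (a n) <= g n) -> ex_series g ->
  Rabs (Series a - sum_n a N) <= Series (fun k => g (S N + k)%nat).
Proof.
  intros H Hg. rewrite (Series_split a N) by (apply ex_series_dom with g; assumption).
  replace (_ + _ - _) with (Series (fun k => a (S N + k)%nat)) by ring.
  apply Rabs_Series_le; [intros k; apply H | apply (ex_series_shift g (S N)), Hg].
Qed.

Section LongTime.
Variables (m : R) (x v : R -> nat -> R) (al : R -> R) (g : nat -> R) (T e2 : R).
Hypothesis hm : - 1 / 2 <= m.
Hypothesis Dx : forall n t, is_derive (fun s => x s (S n)) t (v t (S n)).
Hypothesis Dv : forall n t, is_derive (fun s => v s (S n)) t
  (- (INR (S n) ^ 2 * (INR (S n) ^ 2 + m + al t)) * x t (S n)).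
Hypothesis hT : 0 <= T.
Hypothesis Hg : ex_series g.
Hypothesis Hdom : forall t n, - 1 <= t <= T + 1 -> modeE m x v t n <= g n.
Hypothesis He2 : 0 < e2.
Hypothesis Hsmall : e2 <= (1 + m) / 50.
Hypothesis Htime : T * e2 ^ 2 <= (1 + m) / 10.
Hypothesis Hal : forall t, 0 <= t <= T -> Series (modeE m x v t) <= 3 * e2 -> al t = kirch (x t).
Hypothesis Hinit : Series (modeE m x v 0) <= 2 * e2.

Let E_abs t n : - 1 <= t <= T + 1 -> Rabs (modeE m x v t n) <= g n.
Proof. intros Ht. rewrite Rabs_pos_eq by (apply modeE_nonneg, hm). apply Hdom, Ht. Qed.

Let E_ex t : - 1 <= t <= T + 1 -> ex_series (modeE m x v t).
Proof. intros Ht. apply ex_series_dom with g; [intros n; apply E_abs, Ht | exact Hg]. Qed.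

(** The corrected energy has derivative of order six in the amplitude, which on the time scale
    considered amounts to a small fraction of [e2]. Truncation errors of the finite sums
    vanish thanks to the domination by [g]. *)
Let improvement t0 : 0 <= t0 <= T ->
  (forall t, 0 <= t <= t0 -> Series (modeE m x v t) <= 3 * e2) ->
  Series (modeE m x v t0) <= 5 / 2 * e2.
Proof.
  intros Ht0 HE.
  set (del := e2 / 10 / (9 / 2 * T * e2 + 1)).
  assert (Hq : 0 < 9 / 2 * T * e2 + 1).
  { assert (0 <= 9 / 2 * T * e2); [|lra]. apply Rmult_le_pos; lra. }
  assert (Hdel : 0 < del) by (apply Rdiv_lt_0_compat; lra).
  destruct (Series_tail_small g del Hg Hdel) as [N HN]. specialize (HN N (le_n N)).
  set (tau := Series (fun k => g (S N + k)%nat)) in *.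
  assert (Htau : tau <= del) by (assert (X := Rle_abs tau); lra).
  assert (Htau0 : 0 <= tau).
  { apply Series_nonneg; [|apply (ex_series_shift g (S N)), Hg]. intros k.
    eapply Rle_trans; [apply Rabs_pos | apply (E_abs 0); lra]. }
  assert (Hact : forall t, - 1 <= t <= T + 1 -> actions m x v N t <= Series (modeE m x v t)).
  { intros t Ht. apply sum_n_le_Series; [intros n; apply modeE_nonneg, hm | apply E_ex, Ht]. }
  assert (HK : forall t, 0 <= t <= t0 -> al t = kirch (x t) /\ 0 <= kirch (x t) <= e2 / 2 /\
     Rabs (al t - 1 / (2 * PI) * sum_n (fun n => INR (S n) ^ 2 * x t (S n) ^ 2) N) <= tau).
  { intros t Ht. assert (Ht' : - 1 <= t <= T + 1) by lra.
    destruct (kirch_le_energy m x v t hm (E_ex t Ht')) as [K1 [K2 K3]].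
    assert (Hb := HE t Ht).
    assert (Ea : al t = kirch (x t)) by (apply Hal; [lra | exact Hb]).
    split; [exact Ea|]. split; [lra|]. rewrite Ea. unfold kirch.
    rewrite <- Rmult_minus_distr_l, Rabs_mult.
    assert (Hpi := PI_gt_3).
    rewrite (Rabs_pos_eq (1 / _)) by (apply Rdiv_le_0_compat; lra).
    apply Rle_trans with (1 * tau); [|lra].
    apply Rmult_le_compat; [apply Rdiv_le_0_compat; lra | apply Rabs_pos | |].
    - apply Rmult_le_reg_r with (2 * PI); [lra|]. field_simplify; lra.
    - apply Series_tail_le; [|exact Hg]. intros n. rewrite Rabs_pos_eq by apply K1.
      eapply Rle_trans; [apply K1 | apply Hdom, Ht']. }
  assert (G := actions_growth m x v al hm Dx Dv N t0 (3 * e2) (e2 / 2) tau (proj1 Ht0)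
    (fun t Ht => Rle_trans _ _ _ (Hact t ltac:(lra)) (HE t Ht))
    (fun t Ht => Rle_trans _ _ _ (Req_le _ _ (f_equal Rabs (proj1 (HK t Ht))))
       (Rle_trans _ _ _ (Req_le _ _ (Rabs_pos_eq _ (proj1 (proj1 (proj2 (HK t Ht))))))
          (proj2 (proj1 (proj2 (HK t Ht))))))
    (fun t Ht => proj2 (proj2 (HK t Ht)))).
  assert (A0 : 0 <= actions m x v N 0) by (apply actions_nonneg, hm).
  assert (A1 : actions m x v N 0 <= 2 * e2) by (eapply Rle_trans; [apply Hact; lra | exact Hinit]).
  assert (Htail : Series (modeE m x v t0) - actions m x v N t0 <= tau).
  { eapply Rle_trans; [apply Rle_abs|]. apply Series_tail_le; [|exact Hg].
    intros n. apply E_abs. lra. }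
  set (L := 1 + m) in *. assert (HL : 1 / 2 <= L) by (unfold L; lra).
  assert (B1 : actions m x v N 0 ^ 2 / (8 * L) <= (2 * e2) ^ 2 / (8 * L)).
  { apply Rmult_le_compat_r; [left; apply Rinv_0_lt_compat; lra|]. apply pow_incr. lra. }
  assert (Hr : e2 / L <= 1 / 50).
  { apply Rmult_le_reg_r with L; [lra|]. unfold Rdiv at 1. rewrite Rmult_assoc, Rinv_l; lra. }
  assert (B2 : (2 * e2) ^ 2 / (8 * L) + (3 * e2) ^ 2 / (8 * L) <= 4 / 100 * e2).
  { replace ((2 * e2) ^ 2 / (8 * L) + (3 * e2) ^ 2 / (8 * L)) with (13 / 8 * (e2 / L) * e2)
      by (field; lra).
    apply Rmult_le_compat_r; lra. }
  assert (B3 : t0 * (e2 / 2 * ((3 * e2) ^ 2 / (2 * L))) <= 3 / 10 * e2).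
  { replace (t0 * (e2 / 2 * ((3 * e2) ^ 2 / (2 * L)))) with (9 / 4 * (t0 * e2 ^ 2 / L) * e2)
      by (field; lra).
    apply Rmult_le_compat_r; [lra|].
    assert (X : t0 * e2 ^ 2 / L <= 1 / 10); [|lra].
    apply Rmult_le_reg_r with L; [lra|]. unfold Rdiv. rewrite Rmult_assoc, Rinv_l by lra.
    assert (t0 * e2 ^ 2 <= T * e2 ^ 2) by (apply Rmult_le_compat_r; [apply pow2_ge_0 | lra]).
    lra. }
  assert (B4 : t0 * (3 / 2 * (3 * e2) * tau) + tau <= e2 / 10).
  { apply Rle_trans with (tau * (9 / 2 * T * e2 + 1)).
    - assert (t0 * (tau * e2) <= T * (tau * e2)); [|lra].
      apply Rmult_le_compat_r; [apply Rmult_le_pos; lra | lra].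
    - apply Rle_trans with (del * (9 / 2 * T * e2 + 1)); [apply Rmult_le_compat_r; lra|].
      unfold del. right. field. lra. }
  lra.
Qed.

Let E_continuous t : 0 <= t <= T -> continuous (fun s => Series (modeE m x v s)) t.
Proof.
  intros Ht. apply (Series_dominated (locally t)) with g.
  - exact Hg.
  - assert (Hnear : locally t (fun y => - 1 < y < T + 1)) by exact (locally_open_interval (-1) (T + 1) t ltac:(lra)).
    revert Hnear. apply filter_imp. intros y Hy n. apply E_abs. lra.
  - intros n. apply E_abs. lra.
  - intros n. apply (ex_derive_continuous (V := R_NormedModule) (fun s => modeE m x v s n)).
    eexists. apply (is_derive_modeE m x v al hm Dx Dv).
Qed.

(** Since [5/2 < 3], the times up to which the energy is at most [3 e2] form an open and closed
    subset of the interval. *)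
Lemma long_time_energy t : 0 <= t <= T -> Series (modeE m x v t) <= 5 / 2 * e2.
Proof.
  assert (H : forall t, 0 <= t <= T -> Series (modeE m x v t) <= 3 * e2).
  { apply (real_induction _ T hT). intros t0 Ht0 Hbelow.
    assert (H0 : Series (modeE m x v t0) <= 3 * e2).
    { apply Rnot_lt_le. intros Hlt.
      destruct (Rle_lt_or_eq_dec 0 t0 (proj1 Ht0)) as [Hpos | Hz].
      2: { rewrite <- Hz in Hlt. lra. }
      destruct (proj1 (tends_iff (locally t0) _ _) (E_continuous t0 Ht0)
        (Series (modeE m x v t0) - 3 * e2) ltac:(lra)) as [d Hd].
      assert (Hd0 := cond_pos d).
      set (z := Rmax 0 (t0 - d / 2)).
      assert (Hz : 0 <= z < t0 /\ t0 - d / 2 <= z).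
      { unfold z. split; [split|]; [apply Rmax_l | apply Rmax_lub_lt; lra | apply Rmax_r]. }
      assert (Hb : ball t0 d z) by (change (Rabs (z - t0) < d); apply Rabs_def1; lra).
      specialize (Hd z Hb). apply Rabs_def2 in Hd. specialize (Hbelow z (proj1 Hz)). lra. }
    assert (H1 : Series (modeE m x v t0) <= 5 / 2 * e2).
    { apply improvement; [exact Ht0|]. intros z Hz.
      destruct (Rle_lt_or_eq_dec z t0 (proj2 Hz)) as [Hlt | ->]; [apply Hbelow; lra | exact H0]. }
    destruct (proj1 (tends_iff (locally t0) _ _) (E_continuous t0 Ht0) (e2 / 2) ltac:(lra))
      as [d Hd].
    exists d. split; [apply cond_pos|]. intros z Hz Hzd.
    destruct (Rlt_dec z t0) as [Hlt | Hge]; [apply Hbelow; lra|].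
    assert (Hb : ball t0 d z).
    { change (Rabs (z - t0) < d). assert (Hd0 := cond_pos d). apply Rabs_def1; lra. }
    specialize (Hd z Hb). apply Rabs_def2 in Hd. lra. }
  intros Ht. apply improvement; [exact Ht|]. intros z Hz. apply H. lra.
Qed.
End LongTime.

(** * From modes to weak solutions *)

(** The mean value theorem dominates the difference quotients by the same sequence as the
    derivatives, and dominated convergence applies. *)
Lemma h_derivative_dominated a b r (c d : R -> nat -> R) (B : nat -> R) :
  in_h r B -> (forall t, in_h r (c t)) ->
  (forall n t, is_derive (fun s => c s (S n)) t (d t (S n))) ->
  (forall T, exists K, 0 <= K /\ forall t n, Rabs t <= T -> Rabs (d t (S n)) <= K * B (S n)) ->
  h_derivative a b r c d.
Proof.
  intros HB Hc D Hd t _.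
  destruct (Hd (Rabs t + 1)) as [K [HK0 HK]].
  assert (HKB : in_h r (fun j => K * B j)) by apply in_h_scal, HB.
  split; [apply Hc|]. split.
  { apply in_h_dom with (2 := HKB). intros n.
    eapply Rle_trans; [apply HK; lra | apply Rle_abs]. }
  apply (h_norm_dominated (locally' t)) with (fun j => 2 * (K * B j)).
  - apply in_h_scal, HKB.
  - exists (mkposreal 1 Rlt_0_1). intros s Hs Hne n.
    assert (Hs' : Rabs (s - t) < 1) by exact Hs.
    assert (Hnear : forall z, Rmin t s <= z <= Rmax t s -> Rabs z <= Rabs t + 1).
    { intros z Hz. assert (X : Rabs (z - t) <= 1).
      { apply Rabs_def2 in Hs'. unfold Rmin, Rmax in Hz.
        destruct (Rle_dec t s); apply Rabs_le; lra. }
      assert (Y := Rabs_triang_inv z t). lra. }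
    assert (Hpos : 0 < Rabs (s - t)) by (apply Rabs_pos_lt, Rminus_eq_contra, Hne).
    assert (Hq : Rabs ((c s (S n) - c t (S n)) / (s - t)) <= K * B (S n)).
    { unfold Rdiv. rewrite Rabs_mult, Rabs_inv.
      apply Rmult_le_reg_r with (Rabs (s - t)); [exact Hpos|].
      rewrite Rmult_assoc, Rinv_l, Rmult_1_r by lra.
      apply (slope_le (fun z => c z (S n)) (fun z => d z (S n))). intros z Hz.
      split; [apply D | apply HK, Hnear, Hz]. }
    assert (Hdt : Rabs (d t (S n)) <= K * B (S n)) by (apply HK; lra).
    unfold Rminus. eapply Rle_trans; [apply Rabs_triang|]. rewrite Rabs_Ropp.
    unfold Rminus in Hq. lra.
  - intros n.
    assert (L := tends_minus (locally' t) _ _ _ _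
      (proj1 (is_derive_tends _ _ _) (D n t))
      (tends_const (locally' t) (d t (S n)))).
    rewrite Rminus_diag in L. exact L.
Qed.

Lemma h_continuous_dominated a b r (c : R -> nat -> R) (B : nat -> R) :
  in_h r B -> (forall n t, continuous (fun s => c s (S n)) t) ->
  (forall T, exists K, 0 <= K /\ forall t n, Rabs t <= T -> Rabs (c t (S n)) <= K * B (S n)) ->
  h_continuous a b r c.
Proof.
  intros HB C Hb t _.
  destruct (Hb (Rabs t + 1)) as [K [HK0 HK]].
  assert (HKB : in_h r (fun j => K * B j)) by apply in_h_scal, HB.
  split.
  { apply in_h_dom with (2 := HKB). intros n.
    eapply Rle_trans; [apply HK; lra | apply Rle_abs]. }
  apply (h_norm_dominated (locally t)) with (fun j => 2 * (K * B j)).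
  - apply in_h_scal, HKB.
  - generalize (locally_Rabs_lt t (Rabs t + 1) ltac:(lra)). apply filter_imp.
    intros s Hs n. unfold Rminus. eapply Rle_trans; [apply Rabs_triang|]. rewrite Rabs_Ropp.
    assert (A1 := HK s n (Rlt_le _ _ Hs)). assert (A2 := HK t n ltac:(lra)). lra.
  - intros n.
    assert (L := tends_minus (locally t) _ _ _ _ (C n t) (tends_const (locally t) (c t (S n)))).
    rewrite Rminus_diag in L. exact L.
Qed.

Lemma amp_nonneg m c0 v0 n : - 1 / 2 <= m -> 0 <= amp m c0 v0 (S n).
Proof.
  intros hm. unfold amp. apply Rplus_le_le_0_compat; [apply Rabs_pos|].
  apply Rdiv_le_0_compat; [apply Rabs_pos | apply omega_pos, hm].
Qed.

Lemma amp_in_h m s c0 v0 : - 1 / 2 <= m -> in_h (s + 2) c0 -> in_h s v0 ->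
  in_h (s + 2) (amp m c0 v0).
Proof.
  intros hm Hc Hv. unfold amp. apply in_h_plus.
  - apply in_h_dom with (2 := Hc). intros n. rewrite Rabs_Rabsolu. lra.
  - apply in_h_weight with (k := - INR 2) (C := 3 / 2) (c := v0).
    + intros n. rewrite Rpower_Ropp, Rpower_S_pow.
      assert (Hw := omega_pos m n hm). assert (Hj := sqr_le_omega m n hm).
      assert (HJ : 0 < INR (S n) ^ 2) by (apply pow_lt, S_pos).
      unfold Rdiv at 1. rewrite Rabs_mult, Rabs_Rabsolu, Rabs_inv, (Rabs_pos_eq (omega _ _)) by lra.
      rewrite Rmult_comm. apply Rmult_le_compat_r; [apply Rabs_pos|].
      apply Rmult_le_reg_r with (omega m (S n)); [exact Hw|].
      rewrite Rinv_l by lra.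
      apply Rmult_le_reg_l with (INR (S n) ^ 2); [exact HJ|].
      replace (INR (S n) ^ 2 * (3 / 2 * / INR (S n) ^ 2 * omega m (S n)))
        with (3 / 2 * omega m (S n)) by (field; apply Rgt_not_eq, S_pos).
      lra.
    + replace (s + 2 + - INR 2) with s by (simpl; ring). exact Hv.
Qed.

Section Construction.
Variables (m s R0 : R) (u0 v0 : R -> R) (x v : R -> nat -> R).
Hypothesis hm : - 1 / 2 <= m.
Hypothesis hs : 1 / 2 < s.
Hypothesis hR : 0 < R0.
Hypothesis hu0 : in_H (s + 2) u0.
Hypothesis hv0 : in_H s v0.

Let am : nat -> R := amp m (coef u0) (coef v0).
Let K : R := 3 / 2 * R0.

Hypothesis Dx : forall n t, is_derive (fun s => x s (S n)) t (v t (S n)).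
Hypothesis Dv : forall n t, is_derive (fun s => v s (S n)) t
  (- (INR (S n) ^ 2 * (INR (S n) ^ 2 + m + trunc R0 (x t))) * x t (S n)).
Hypothesis Ix : forall n, x 0 (S n) = coef u0 (S n).
Hypothesis Iv : forall n, v 0 (S n) = coef v0 (S n).
Hypothesis Bx : forall n t, Rabs (x t (S n)) <= am (S n) * exp (K * Rabs t).
Hypothesis Bv : forall n t, Rabs (v t (S n)) <= omega m (S n) * am (S n) * exp (K * Rabs t).

Let am_nonneg n : 0 <= am (S n).
Proof. apply amp_nonneg, hm. Qed.

Let am_in : in_h (s + 2) am.
Proof. apply amp_in_h; [exact hm | apply hu0 | apply hv0]. Qed.

Let am_summable k : (k <= 2)%nat -> ex_series (fun n => INR (S n) ^ k * am (S n)).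
Proof.
  intros Hk.
  assert (H : ex_series (fun n => INR (S n) ^ 2 * Rabs (am (S n)))).
  { apply (in_h_summable_pow s 2); [exact hs|]. simpl INR.
    replace (s + (1 + 1)) with (s + 2) by ring. exact am_in. }
  apply (ex_series_lower _ k 2 Hk) in H.
  eapply ex_series_ext_R; [|exact H].
  intros n. simpl. now rewrite Rabs_pos_eq by apply am_nonneg.
Qed.

Let exp_le_T t T : Rabs t <= T -> exp (K * Rabs t) <= exp (K * T).
Proof. intros H. apply exp_le, Rmult_le_compat_l; [unfold K; lra | exact H]. Qed.

Let Bx_T t T n : Rabs t <= T -> Rabs (x t (S n)) <= exp (K * T) * am (S n).
Proof.
  intros H. eapply Rle_trans; [apply Bx|]. rewrite Rmult_comm.
  apply Rmult_le_compat_r; [apply am_nonneg | apply exp_le_T, H].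
Qed.

Let Bv_T t T n : Rabs t <= T ->
  Rabs (v t (S n)) <= ((2 + Rabs m) * exp (K * T)) * (INR (S n) ^ 2 * am (S n)).
Proof.
  intros H. eapply Rle_trans; [apply Bv|].
  replace ((2 + Rabs m) * exp (K * T) * (INR (S n) ^ 2 * am (S n)))
    with ((2 + Rabs m) * INR (S n) ^ 2 * am (S n) * exp (K * T)) by ring.
  assert (Hw := omega_pos m n hm). assert (Hl := omega_le m n hm).
  apply Rmult_le_compat; [ | left; apply exp_pos | | apply exp_le_T, H].
  - apply Rmult_le_pos; [lra | apply am_nonneg].
  - apply Rmult_le_compat_r; [apply am_nonneg | exact Hl].
Qed.

Let x_summable t : ex_series (fun n => INR (S n) ^ 2 * Rabs (x t (S n))).
Proof.
  apply ex_series_dom with (fun n => exp (K * Rabs t) * (INR (S n) ^ 2 * am (S n))).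
  - intros n. rewrite Rabs_mult, Rabs_Rabsolu, Rabs_pos_eq by apply pow2_ge_0.
    replace (exp (K * Rabs t) * (INR (S n) ^ 2 * am (S n)))
      with (INR (S n) ^ 2 * (exp (K * Rabs t) * am (S n))) by ring.
    apply Rmult_le_compat_l; [apply pow2_ge_0 | apply Bx_T; lra].
  - apply ex_series_scal_R, am_summable; lia.
Qed.

Definition mode_sum (t y : R) : R := sine_series (x t) y.

Lemma mode_sum_coef t n : coef (mode_sum t) (S n) = x t (S n).
Proof.
  apply sine_series_coef; [|reflexivity].
  apply ex_series_abs0, (ex_series_lower _ 0 2); [lia | apply x_summable].
Qed.

Lemma mode_sum_in_H t : in_H (s + 2) (mode_sum t).
Proof.
  split.
  - apply in_h_dom with (c := fun j => exp (K * Rabs t) * am j); [|apply in_h_scal, am_in].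
    intros n. rewrite mode_sum_coef. eapply Rle_trans; [apply Bx_T, Rle_refl | apply Rle_abs].
  - intros y _.
    apply (is_series_ext (V := R_NormedModule) (fun n => x t (S n) * phi (S n) y)).
    { intros n. now rewrite mode_sum_coef. }
    apply (Series_correct (fun n => x t (S n) * phi (S n) y)).
    apply ex_series_dom with (fun n => Rabs (x t (S n))); [intros n; apply sine_term_bound|].
    apply ex_series_abs0, (ex_series_lower _ 0 2); [lia | apply x_summable].
Qed.

Let trunc_x_continuous t : continuous (fun s => trunc R0 (x s)) t.
Proof.
  apply (trunc_continuous m R0 (coef u0) (coef v0) hm hR).
  - apply (h_norm_bounds_series (s + 2) 2 am am_in). simpl. lra.
  - split; [|exact Bx].
    intros n z. eapply is_derive_cont. apply Dx.
Qed.

Let trunc_x_bounds t : 0 <= trunc R0 (x t) <= R0.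
Proof.
  apply (trunc_bounds m R0 (coef u0) (coef v0) hm hR).
  - apply (h_norm_bounds_series (s + 2) 2 am am_in). simpl. lra.
  - split; [|exact Bx].
    intros n z. eapply is_derive_cont. apply Dx.
Qed.

Let w (t : R) (j : nat) : R := - (INR j ^ 2 * (INR j ^ 2 + m + trunc R0 (x t))) * x t j.

Let Bw_T t T n : Rabs t <= T ->
  Rabs (w t (S n)) <= ((1 + Rabs m + R0) * exp (K * T)) * (INR (S n) ^ 4 * am (S n)).
Proof.
  intros H. unfold w.
  rewrite Rabs_mult, Rabs_Ropp, Rabs_mult, (Rabs_pos_eq (_ ^ 2)) by apply pow2_ge_0.
  replace ((1 + Rabs m + R0) * exp (K * T) * (INR (S n) ^ 4 * am (S n)))
    with (INR (S n) ^ 2 * ((1 + Rabs m + R0) * INR (S n) ^ 2) * (exp (K * T) * am (S n))) by ring.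
  apply Rmult_le_compat;
    [apply Rmult_le_pos; [apply pow2_ge_0 | apply Rabs_pos] | apply Rabs_pos | | apply Bx_T, H].
  apply Rmult_le_compat_l; [apply pow2_ge_0|].
  destruct (S_sqr_le_pow4 n) as [HJ _]. assert (Ht := trunc_x_bounds t).
  assert (Hm := Rabs_pos m).
  eapply Rle_trans; [apply Rabs_triang|].
  assert (A := Rabs_triang (INR (S n) ^ 2) m).
  rewrite (Rabs_pos_eq (_ ^ 2)) in A by lra. rewrite (Rabs_pos_eq (trunc _ _)) by lra.
  nra.
Qed.

Let am_pow_in k r : r + INR k = s + 2 -> in_h r (fun j => INR j ^ k * am j).
Proof.
  intros Hr. apply in_h_weight with (k := INR k) (C := 1) (c := am).
  - intros n. rewrite Rpower_S_pow, Rabs_mult.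
    rewrite (Rabs_pos_eq (_ ^ k)) by apply pow_le, pos_INR. lra.
  - rewrite Hr. exact am_in.
Qed.

Let coef_derive n t : is_derive (fun z => coef (mode_sum z) (S n)) t (v t (S n)).
Proof.
  eapply (is_derive_ext (V := R_NormedModule)); [|apply Dx].
  intros z. symmetry. apply mode_sum_coef.
Qed.

Let is_derive_mode_sum y : 0 <= y <= PI -> is_derive (fun t => mode_sum t y) 0 (v0 y).
Proof.
  intros Hy.
  assert (E : v0 y = Series (fun n => v 0 (S n) * phi (S n) y)).
  { rewrite <- (is_series_unique _ _ (proj2 hv0 y Hy)).
    apply Series_ext. intros n. now rewrite Iv. }
  rewrite E. unfold mode_sum, sine_series.
  apply (is_derive_Series (fun n t => x t (S n) * phi (S n) y)
    (fun n t => v t (S n) * phi (S n) y)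
    (fun n => ((2 + Rabs m) * exp (K * 1)) * (INR (S n) ^ 2 * am (S n))) 0 1).
  - lra.
  - apply ex_series_scal_R, am_summable. lia.
  - apply ex_series_dom with (fun n => Rabs (x 0 (S n))); [intros n; apply sine_term_bound|].
    apply ex_series_abs0, (ex_series_lower _ 0 2); [lia | apply x_summable].
  - intros n t Ht. rewrite Rminus_0_r in Ht. split.
    + eapply is_derive_eq; [exact (is_derive_mult_R _ _ _ _ _ (Dx n t)
        (is_derive_const (K := R_AbsRing) (V := R_NormedModule) (phi (S n) y) t))|].
      unfold zero. simpl. ring.
    + eapply Rle_trans; [apply sine_term_bound|]. apply Bv_T. lra.
Qed.

(** With [b_n] the initial amplitudes, which are in [h^(s+2)], the sequences [b_n], [n^2 b_n] and
    [n^4 b_n] dominate [u], [u_t] and [u_tt]; this is the loss of two derivatives for each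
    derivative in time. *)
Lemma mode_sum_weak_solution a b : in_interval a b 0 ->
  (forall t, in_interval a b t -> trunc R0 (x t) = kirch (x t)) ->
  weak_solution m s u0 v0 a b mode_sum.
Proof.
  intros H0 Htr.
  assert (Hcd : forall T, 0 <= (2 + Rabs m) * exp (K * T)).
  { intros T. apply Rmult_le_pos; [|left; apply exp_pos]. assert (X := Rabs_pos m). lra. }
  assert (Hce : forall T, 0 <= (1 + Rabs m + R0) * exp (K * T)).
  { intros T. apply Rmult_le_pos; [|left; apply exp_pos]. assert (X := Rabs_pos m). lra. }
  split; [exact H0|]. split; [intros; apply mode_sum_in_H|]. split; [|split].
  { intros y Hy. symmetry. unfold mode_sum, sine_series.
    rewrite <- (is_series_unique _ _ (proj2 hu0 y Hy)).
    apply Series_ext. intros n. now rewrite Ix. }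
  { exact is_derive_mode_sum. }
  exists v, w.
  assert (Cv : forall n t, continuous (fun z => v z (S n)) t).
  { intros n t. eapply is_derive_cont. apply Dv. }
  split; [|split; [|split; [|split; [|split]]]].
  - apply h_continuous_dominated with am; [exact am_in | |].
    + intros n t. eapply is_derive_cont. apply coef_derive.
    + intros T. exists (exp (K * T)). split; [left; apply exp_pos|].
      intros t n Ht. rewrite mode_sum_coef. apply Bx_T, Ht.
  - apply h_derivative_dominated with (fun j => INR j ^ 2 * am j).
    + apply am_pow_in. simpl. ring.
    + intros t. apply in_h_le with (s + 2); [lra | apply mode_sum_in_H].
    + apply coef_derive.
    + intros T. exists ((2 + Rabs m) * exp (K * T)). split; [apply Hcd|].
      intros t n Ht. apply Bv_T, Ht.
  - apply h_continuous_dominated with (fun j => INR j ^ 2 * am j).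
    + apply am_pow_in. simpl. ring.
    + exact Cv.
    + intros T. exists ((2 + Rabs m) * exp (K * T)). split; [apply Hcd|].
      intros t n Ht. apply Bv_T, Ht.
  - apply h_derivative_dominated with (fun j => INR j ^ 4 * am j).
    + apply am_pow_in. simpl. ring.
    + intros t. apply in_h_le with s; [lra|].
      apply in_h_dom with
        (c := fun j => ((2 + Rabs m) * exp (K * Rabs t)) * (INR j ^ 2 * am j)).
      * intros n. eapply Rle_trans; [apply Bv_T, Rle_refl | apply Rle_abs].
      * apply in_h_scal, am_pow_in. simpl. ring.
    + exact Dv.
    + intros T. exists ((1 + Rabs m + R0) * exp (K * T)). split; [apply Hce|].
      intros t n Ht. apply Bw_T, Ht.
  - apply h_continuous_dominated with (fun j => INR j ^ 4 * am j).
    + apply am_pow_in. simpl. ring.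
    + intros n t. unfold w. apply cont_mult.
      * apply (continuous_opp (V := R_NormedModule)), cont_scal, cont_plus;
          [apply continuous_const | apply trunc_x_continuous].
      * eapply is_derive_cont. apply Dx.
    + intros T. exists ((1 + Rabs m + R0) * exp (K * T)). split; [apply Hce|].
      intros t n Ht. apply Bw_T, Ht.
  - intros eta t Heta Ht.
    assert (Hf : forall y, 0 <= y <= PI -> mode_sum t y = sine_series (x t) y) by reflexivity.
    rewrite (sine_function_kirch (mode_sum t) (x t) (x_summable t) Hf).
    rewrite <- (is_series_unique _ _ (sine_function_weak (mode_sum t) (x t) (x_summable t) Hf
      eta (m + kirch (x t)) Heta)).
    rewrite (Series_ext (fun n => w t (S n) * coef eta (S n))
      (fun n => - (INR (S n) ^ 2 * (INR (S n) ^ 2 + (m + kirch (x t))) * x t (S n)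
         * coef eta (S n)))).
    + rewrite Series_opp. ring.
    + intros n. unfold w. rewrite Htr by exact Ht. ring.
Qed.

Lemma modeE_dominated t T n : Rabs t <= T ->
  modeE m x v t n <= 2 * exp (K * T) ^ 2 * (INR (S n) ^ 2 * am (S n) ^ 2).
Proof.
  intros Ht. unfold modeE.
  assert (Hl := lam_ge m n hm). assert (Hw := omega_pos m n hm).
  assert (H1 : x t (S n) ^ 2 <= exp (K * T) ^ 2 * am (S n) ^ 2).
  { rewrite <- pow2_abs, <- Rpow_mult_distr. apply pow_incr.
    split; [apply Rabs_pos | apply Bx_T, Ht]. }
  assert (H2 : v t (S n) ^ 2 / (INR (S n) ^ 2 + m) <= exp (K * T) ^ 2 * (INR (S n) ^ 2 * am (S n) ^ 2)).
  { apply Rmult_le_reg_r with (INR (S n) ^ 2 + m); [lra|].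
    unfold Rdiv. rewrite Rmult_assoc, Rinv_l, Rmult_1_r by lra.
    replace (exp (K * T) ^ 2 * (INR (S n) ^ 2 * am (S n) ^ 2) * (INR (S n) ^ 2 + m))
      with ((INR (S n) ^ 2 * (INR (S n) ^ 2 + m)) * am (S n) ^ 2 * exp (K * T) ^ 2) by ring.
    rewrite <- omega_sqr, <- !Rpow_mult_distr, <- pow2_abs by exact hm.
    apply pow_incr. split; [apply Rabs_pos|].
    eapply Rle_trans; [apply Bv|]. apply Rmult_le_compat_l; [|apply exp_le_T, Ht].
    apply Rmult_le_pos; [lra | apply am_nonneg]. }
  assert (H3 := Rmult_le_compat_l _ _ _ (pow2_ge_0 (INR (S n))) H1). lra.
Qed.
End Construction.

(** * Numerical constants and conclusion *)

Lemma mu_bounds m : - 1 / 2 <= m -> 0 < mu m <= 3 * (1 + m).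
Proof.
  intros hm. unfold mu. split.
  - assert (0 < sqrt (1 + m)) by (apply sqrt_lt_R0; lra).
    assert (0 < sqrt (4 + m)) by (apply sqrt_lt_R0; lra).
    apply Rmin_glb_lt; lra.
  - eapply Rle_trans; [apply Rmin_l|].
    assert (H : sqrt (1 + m) <= 3 / 2 * (1 + m)); [|lra].
    rewrite <- (sqrt_pow2 (3 / 2 * (1 + m))) by lra. apply sqrt_le_1_alt. nra.
Qed.

(** The crude bounds [e >= 2] and [pi <= 4] suffice: the estimate of the energy holds on a
    longer time interval than needed. *)
Lemma T0_bound m eps : - 1 / 2 <= m -> T0 m eps <= 1 / 60.
Proof.
  intros hm. assert (Hmu := mu_bounds m hm). unfold T0.
  assert (He := exp_ineq1 1 ltac:(lra)).
  assert (Hpi := PI_RGT_0). assert (Hpi4 := PI_4).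
  assert (Hd : 22 <= c_dag).
  { unfold c_dag. apply Rmult_le_reg_r with PI; [exact Hpi|].
    unfold Rdiv. rewrite Rmult_assoc, Rinv_l by lra. lra. }
  assert (Hs : 17 / 10 <= c_star).
  { unfold c_star. set (q := 1 / (80 * exp 1)).
    assert (Hq : 0 < q < 1 / 160).
    { unfold q. split; [apply Rdiv_lt_0_compat; lra|].
      unfold Rdiv. rewrite !Rmult_1_l. apply Rinv_lt_contravar; nra. }
    assert (Hq2 : 0 < (5 / 6 - q) ^ 2 <= (5 / 6) ^ 2)
      by (split; [apply pow_lt; lra | apply pow_incr; lra]).
    apply (proj1 (Rle_div_r (17 / 10) ((11 / 10) ^ 2) ((5 / 6 - q) ^ 2) (proj1 Hq2))).
    apply Rle_trans with (17 / 10 * (5 / 6) ^ 2); [apply Rmult_le_compat_l; lra | lra]. }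
  assert (Hs2 : 289 / 100 <= c_star ^ 2) by nra.
  assert (Hp : 60 <= c_dag * c_star ^ 2) by nra.
  assert (Hn : 0 <= c_dag * c_star * eps ^ 2 / mu m).
  { apply Rdiv_le_0_compat; [|lra]. apply Rmult_le_pos; [nra | apply pow2_ge_0]. }
  assert (H1 : (1 - c_dag * c_star * eps ^ 2 / mu m) / (c_dag * c_star ^ 2) <= 1 / 60).
  { apply Rmult_le_reg_r with (c_dag * c_star ^ 2); [lra|].
    unfold Rdiv at 1. rewrite Rmult_assoc, Rinv_l by lra. lra. }
  lra.
Qed.

Lemma Series_inv_sqr : ex_series (fun n => / INR (S n) ^ 2) /\ Series (fun n => / INR (S n) ^ 2) <= 2.
Proof.
  assert (He : ex_series (fun n => / INR (S n) ^ 2)).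
  { apply (ex_series_ext_R (fun n => Rpower (INR (S n)) (- INR 2)));
      [|apply ex_series_Rpower; simpl; lra].
    intros n. rewrite Rpower_Ropp, Rpower_S_pow. reflexivity. }
  split; [exact He|]. apply Series_le_of_sums; [exact He|]. intros N.
  assert (H : sum_n (fun n => / INR (S n) ^ 2) N <= 2 - / INR (S N)).
  { induction N as [|N IH].
    - rewrite sum_O. simpl. lra.
    - rewrite sum_n_S. assert (Hx := S_pos N). rewrite (S_INR (S N)).
      set (y := INR (S N)) in *.
      assert (X : / (y + 1) ^ 2 <= / y - / (y + 1)).
      { replace (/ y - / (y + 1)) with (/ (y * (y + 1))) by (field; lra).
        apply Rinv_le_contravar; nra. }
      lra. }
  assert (Hp := Rinv_0_lt_compat _ (S_pos N)). lra.
Qed.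

(** Young's inequality with the weight [e] gives [(5/4 + 1) e] for the sum of the [|c_n|], using
    [sum 1/n^2 <= 2]; the eigenfunctions are bounded by [sqrt (2 / pi) <= 8/9]. *)
Lemma sine_series_sup c e y : 0 <= e -> ex_series (fun n => INR (S n) ^ 2 * c (S n) ^ 2) ->
  Series (fun n => INR (S n) ^ 2 * c (S n) ^ 2) <= 5 / 2 * e ^ 2 ->
  Rabs (sine_series c y) <= 2 * e.
Proof.
  intros He Hex HS.
  assert (Hterm : forall n, 0 <= INR (S n) ^ 2 * c (S n) ^ 2)
    by (intros; apply Rmult_le_pos; apply pow2_ge_0).
  destruct Series_inv_sqr as [Hi1 Hi2].
  set (sp := sqrt (2 / PI)).
  assert (Hsp : 0 <= sp <= 8 / 9).
  { destruct sqrt_2_PI as [H1 H2]. fold sp in H1, H2. split; [lra|].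
    apply Rsqr_incr_0_var; [|lra]. rewrite !Rsqr_pow2, H2.
    assert (Hpi := PI_gt_3).
    apply Rmult_le_reg_r with PI; [lra|]. unfold Rdiv at 1. rewrite Rmult_assoc, Rinv_l; lra. }
  destruct (Rle_lt_or_eq_dec 0 e He) as [Hpos | Hz].
  - set (g n := sp * (/ (2 * e) * (INR (S n) ^ 2 * c (S n) ^ 2) + e / 2 * / INR (S n) ^ 2)).
    assert (Hg : ex_series g).
    { apply ex_series_scal_R, ex_series_plus_R; apply ex_series_scal_R; assumption. }
    eapply Rle_trans; [apply (Rabs_Series_le _ g); [|exact Hg]|].
    + intros n. unfold g, phi. fold sp. rewrite !Rabs_mult, (Rabs_pos_eq sp) by lra.
      assert (Hs : Rabs (sin (INR (S n) * y)) <= 1) by apply Rabs_le, SIN_bound.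
      assert (HJ := S_pos n). set (J := INR (S n)) in *.
      assert (A := amgm2 (J * c (S n)) (/ J) e Hpos).
      rewrite Rabs_mult, (Rabs_pos_eq J), (Rabs_pos_eq (/ J)) in A
        by (try (left; apply Rinv_0_lt_compat); lra).
      replace (J * Rabs (c (S n)) * / J) with (Rabs (c (S n))) in A by (field; lra).
      replace (/ (2 * e) * (J ^ 2 * c (S n) ^ 2) + e / 2 * / J ^ 2)
        with (1 / 2 * ((J * c (S n)) ^ 2 / e + e * (/ J) ^ 2)) by (field; lra).
      assert (X := Rabs_pos (c (S n))). assert (Y := Rabs_pos (sin (J * y))).
      apply Rle_trans with (sp * Rabs (c (S n))).
      * rewrite <- Rmult_assoc, (Rmult_comm (Rabs (c (S n)))).
        assert (0 <= sp * Rabs (c (S n))) by (apply Rmult_le_pos; lra). nra.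
      * apply Rmult_le_compat_l; lra.
    + unfold g. rewrite Series_scal_l, Series_plus, !Series_scal_l
        by (apply ex_series_scal_R; assumption).
      assert (B1 : / (2 * e) * Series (fun n => INR (S n) ^ 2 * c (S n) ^ 2) <= 5 / 4 * e).
      { apply Rmult_le_reg_l with (2 * e); [lra|].
        rewrite <- Rmult_assoc, Rinv_r, Rmult_1_l by lra. lra. }
      assert (B2 : e / 2 * Series (fun n => / INR (S n) ^ 2) <= e) by nra.
      apply Rle_trans with (8 / 9 * (9 / 4 * e)); [|lra].
      assert (B3 : 0 <= / (2 * e) * Series (fun n => INR (S n) ^ 2 * c (S n) ^ 2)
         + e / 2 * Series (fun n => / INR (S n) ^ 2)).
      { apply Rplus_le_le_0_compat; apply Rmult_le_pos.
        - left. apply Rinv_0_lt_compat. lra.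
        - apply Series_nonneg; assumption.
        - lra.
        - apply Series_nonneg; [|exact Hi1]. intros n. left.
          apply Rinv_0_lt_compat, pow_lt, S_pos. }
      apply Rmult_le_compat; lra.
  - subst e. unfold sine_series.
    rewrite (Series_ext _ (fun n => 0 * 0)).
    + rewrite Series_scal_l, Rmult_0_l, Rabs_R0. lra.
    + intros n. assert (X := term_le_Series _ n Hterm Hex). cbv beta in X.
      assert (Z : INR (S n) ^ 2 * c (S n) ^ 2 = 0) by (apply Rle_antisym; [lra | apply Hterm]).
      apply Rmult_integral in Z. destruct Z as [Z | Z].
      * exfalso. revert Z. apply pow_nonzero, Rgt_not_eq, S_pos.
      * assert (Zc : c (S n) = 0) by (apply Rsqr_0_uniq; rewrite Rsqr_pow2; exact Z).
        rewrite Zc. ring.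
Qed.

Lemma sqrt_le_sqr a e : sqrt a <= e -> 0 <= a -> a <= e ^ 2.
Proof.
  intros H Ha. rewrite <- (pow2_sqrt a Ha). apply pow_incr. split; [apply sqrt_pos | exact H].
Qed.

Lemma epsilon_initial m s u0 v0 : - 1 / 2 <= m -> 0 <= s ->
  in_h (s + 2) (coef u0) -> in_h s (coef v0) ->
  0 <= epsilon m u0 v0 /\
  ex_series (fun n => INR (S n) ^ 2 * coef u0 (S n) ^ 2) /\
  ex_series (fun n => coef v0 (S n) ^ 2 / (INR (S n) ^ 2 + m)) /\
  Series (fun n => INR (S n) ^ 2 * coef u0 (S n) ^ 2
     + coef v0 (S n) ^ 2 / (INR (S n) ^ 2 + m)) <= 2 * epsilon m u0 v0 ^ 2.
Proof.
  intros hm hs Hu Hv. set (e := epsilon m u0 v0).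
  assert (H1 : H_norm 1 u0 <= e) by apply Rmax_l.
  assert (H2 : Htilde_norm m v0 <= e) by apply Rmax_r.
  assert (E1 : forall n, coef u0 (S n) ^ 2 * Rpower (INR (S n)) (2 * 1)
     = INR (S n) ^ 2 * coef u0 (S n) ^ 2).
  { intros n. replace (2 * 1) with (INR 2) by (simpl; ring). rewrite Rpower_S_pow. ring. }
  assert (E2 : forall n, INR (S n) ^ 2 / omega m (S n) ^ 2 * coef v0 (S n) ^ 2
     = coef v0 (S n) ^ 2 / (INR (S n) ^ 2 + m)).
  { intros n. rewrite omega_sqr by exact hm. assert (Hl := lam_ge m n hm).
    field. split; [lra | apply Rgt_not_eq, S_pos]. }
  assert (X1 : ex_series (fun n => INR (S n) ^ 2 * coef u0 (S n) ^ 2)).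
  { apply (h_norm_bounds_series (s + 2) 2 _ Hu). simpl. lra. }
  assert (X0 : ex_series (fun n => INR (S n) ^ 0 * coef v0 (S n) ^ 2)).
  { apply (h_norm_bounds_series s 0 _ Hv). simpl. lra. }
  assert (P2 : forall n, 0 <= coef v0 (S n) ^ 2 / (INR (S n) ^ 2 + m)).
  { intros n. assert (Hl := lam_ge m n hm). apply Rdiv_le_0_compat; [apply pow2_ge_0 | lra]. }
  assert (X2 : ex_series (fun n => coef v0 (S n) ^ 2 / (INR (S n) ^ 2 + m))).
  { apply ex_series_dom with (fun n => 2 * (INR (S n) ^ 0 * coef v0 (S n) ^ 2)).
    - intros n. rewrite Rabs_pos_eq by apply P2. assert (Hl := lam_ge m n hm).
      apply Rmult_le_reg_r with (INR (S n) ^ 2 + m); [lra|]. unfold Rdiv.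
      rewrite Rmult_assoc, Rinv_l by lra. rewrite pow_O.
      assert (Q := pow2_ge_0 (coef v0 (S n))). nra.
    - apply ex_series_scal_R, X0. }
  split; [eapply Rle_trans; [apply sqrt_pos | exact H1]|].
  split; [exact X1|]. split; [exact X2|].
  rewrite Series_plus by assumption.
  unfold H_norm, h_norm in H1. rewrite (Series_ext _ _ E1) in H1.
  unfold Htilde_norm in H2. rewrite (Series_ext _ _ E2) in H2.
  apply sqrt_le_sqr in H1; [|apply Series_nonneg; [|exact X1]; intros; apply Rmult_le_pos; apply pow2_ge_0].
  apply sqrt_le_sqr in H2; [|apply Series_nonneg; [exact P2 | exact X2]].
  lra.
Qed.

(** [5/2 + 1 <= (19/10)^2]. *)
Lemma HN_norm_le r N f e : 0 <= e ->
  sum_n (fun n => INR (S n) ^ 2 * coef f (S n) ^ 2) N <= 5 / 2 * e ^ 2 ->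
  Series (fun n => Rpower (INR (S (S N) + n)) (2 * r) * coef f (S (S N) + n) ^ 2) <= e ^ 2 ->
  HN_norm r (S N) f <= 19 / 10 * e.
Proof.
  intros He H1 H2. unfold HN_norm.
  rewrite <- (sum_n_m_S (G := R_AbelianMonoid) (fun j => INR j ^ 2 * coef f j ^ 2) 0 N).
  fold (sum_n (fun n => INR (S n) ^ 2 * coef f (S n) ^ 2) N).
  rewrite <- (sqrt_pow2 (19 / 10 * e)) by lra. apply sqrt_le_1_alt.
  change (sum_n (fun n => INR (S n) ^ 2 * coef f (S n) ^ 2) N
    + Series (fun n => Rpower (INR (S (S N) + n)) (2 * r) * coef f (S (S N) + n) ^ 2)
    <= (19 / 10 * e) ^ 2).
  assert (X := pow2_ge_0 e). nra.
Qed.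

Lemma sup_abs_le f e : (forall y, 0 <= y <= PI -> Rabs (f y) <= e) -> Rbar_le (sup_abs f) e.
Proof.
  intros H. unfold sup_abs. apply (proj2 (Lub_Rbar_correct _)).
  intros z [y [Hy ->]]. apply H, Hy.
Qed.

Lemma modeE_reverse m x v t n :
  modeE m (fun t => x (- t)) (fun t j => - v (- t) j) t n = modeE m x v (- t) n.
Proof. unfold modeE. f_equal. f_equal. ring. Qed.

Lemma Series_zero (a : nat -> R) : (forall n, a n = 0) -> Series a = 0.
Proof.
  intros H. rewrite (Series_ext _ (fun n => 0 * 0)) by (intros; rewrite H; ring).
  rewrite Series_scal_l. ring.
Qed.

Section Lifespan.
Variables (m s : R) (u0 v0 : R -> R) (x v : R -> nat -> R).
Hypothesis hm : - 1 / 2 <= m.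
Hypothesis hs : 1 / 2 < s.
Hypothesis hu0 : in_H (s + 2) u0.
Hypothesis hv0 : in_H s v0.

Let eps : R := epsilon m u0 v0.
Let R0 : R := eps ^ 2 + 1.
Let am : nat -> R := amp m (coef u0) (coef v0).
Let K : R := 3 / 2 * R0.

Hypothesis heps : eps <= 8 / 100 * sqrt (mu m).
Hypothesis Dx : forall n t, is_derive (fun s => x s (S n)) t (v t (S n)).
Hypothesis Dv : forall n t, is_derive (fun s => v s (S n)) t
  (- (INR (S n) ^ 2 * (INR (S n) ^ 2 + m + trunc R0 (x t))) * x t (S n)).
Hypothesis Ix : forall n, x 0 (S n) = coef u0 (S n).
Hypothesis Iv : forall n, v 0 (S n) = coef v0 (S n).
Hypothesis Bx : forall n t, Rabs (x t (S n)) <= am (S n) * exp (K * Rabs t).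
Hypothesis Bv : forall n t, Rabs (v t (S n)) <= omega m (S n) * am (S n) * exp (K * Rabs t).

Let R0_pos : 0 < R0.
Proof. unfold R0. assert (X := pow2_ge_0 eps). lra. Qed.

Let eps_nonneg : 0 <= eps.
Proof. apply (epsilon_initial m s u0 v0 hm); [lra | apply hu0 | apply hv0]. Qed.

Let modeE_0 n : modeE m x v 0 n =
  INR (S n) ^ 2 * coef u0 (S n) ^ 2 + coef v0 (S n) ^ 2 / (INR (S n) ^ 2 + m).
Proof. unfold modeE. now rewrite Ix, Iv. Qed.

Let energy_0 : Series (modeE m x v 0) <= 2 * eps ^ 2.
Proof.
  rewrite (Series_ext _ _ modeE_0).
  apply (epsilon_initial m s u0 v0 hm); [lra | apply hu0 | apply hv0].
Qed.

Let dom (T : R) (n : nat) : R := 2 * exp (K * T) ^ 2 * (INR (S n) ^ 2 * am (S n) ^ 2).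

Let dom_summable T : ex_series (dom T).
Proof.
  apply ex_series_scal_R.
  apply (h_norm_bounds_series (s + 2) 2 am); [|simpl; lra].
  apply amp_in_h; [exact hm | apply hu0 | apply hv0].
Qed.

Let modeE_dom t T n : Rabs t <= T -> modeE m x v t n <= dom T n.
Proof. apply (modeE_dominated m R0 u0 v0 x v hm R0_pos Bx Bv). Qed.

Lemma energy_summable t : ex_series (modeE m x v t).
Proof.
  apply ex_series_dom with (dom (Rabs t)); [|apply dom_summable].
  intros n. rewrite Rabs_pos_eq by (apply modeE_nonneg, hm). apply modeE_dom, Rle_refl.
Qed.

(** The stiffness is at most one sixth of the energy. *)
Lemma trunc_inactive t : Series (modeE m x v t) <= 3 * eps ^ 2 -> trunc R0 (x t) = kirch (x t).
Proof.
  intros H. destruct (kirch_le_energy m x v t hm (energy_summable t)) as [_ [_ Hk]].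
  unfold trunc. apply Rmin_right. unfold R0. assert (X := pow2_ge_0 eps). lra.
Qed.

Let eps_sqr : eps ^ 2 <= (1 + m) / 50.
Proof.
  assert (Hmu := mu_bounds m hm).
  assert (X : eps ^ 2 <= (8 / 100 * sqrt (mu m)) ^ 2) by (apply pow_incr; lra).
  rewrite Rpow_mult_distr, pow2_sqrt in X by lra. lra.
Qed.

Let trivial_modes : eps = 0 -> forall t n, x t (S n) = 0 /\ v t (S n) = 0.
Proof.
  intros He. assert (Ham : forall n, am (S n) = 0).
  { intros n.
    assert (H := term_le_Series (modeE m x v 0) n
      (fun n => modeE_nonneg m x v hm 0 n) (energy_summable 0)).
    assert (H0 := energy_0). rewrite He in H0. rewrite modeE_0 in H.
    assert (P1 : 0 <= INR (S n) ^ 2 * coef u0 (S n) ^ 2) by (apply Rmult_le_pos; apply pow2_ge_0).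
    assert (Hl := lam_ge m n hm).
    assert (P2 : 0 <= coef v0 (S n) ^ 2 / (INR (S n) ^ 2 + m))
      by (apply Rdiv_le_0_compat; [apply pow2_ge_0 | lra]).
    assert (Z1 : INR (S n) ^ 2 * coef u0 (S n) ^ 2 = 0) by lra.
    assert (Z2 : coef v0 (S n) ^ 2 / (INR (S n) ^ 2 + m) = 0) by lra.
    assert (Hsq : forall z, z ^ 2 = 0 -> z = 0)
      by (intros z Hz; apply Rsqr_0_uniq; rewrite Rsqr_pow2; exact Hz).
    apply Rmult_integral in Z1. apply Rmult_integral in Z2.
    unfold am, amp.
    replace (coef u0 (S n)) with 0.
    2: { symmetry. apply Hsq. destruct Z1 as [Z | Z]; [|exact Z].
         exfalso. revert Z. apply pow_nonzero, Rgt_not_eq, S_pos. }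
    replace (coef v0 (S n)) with 0.
    2: { symmetry. apply Hsq. destruct Z2 as [Z | Z]; [exact Z|].
         exfalso. revert Z. apply Rinv_neq_0_compat. lra. }
    rewrite Rabs_R0. unfold Rdiv. ring. }
  intros t n. assert (A := Bx n t). assert (B := Bv n t). rewrite Ham in A, B.
  rewrite ?Rmult_0_r, ?Rmult_0_l in A, B.
  split; apply Rabs_eq_0, Rle_antisym; try apply Rabs_pos; lra.
Qed.

(** Since [T0 <= 1/60] and [mu <= 3 (1 + m)], this exceeds the time [T0 mu eps^-4]. *)
Let T1 : R := (1 + m) / (10 * eps ^ 4).

Let energy_bound t : 0 < eps -> Rabs t <= T1 -> Series (modeE m x v t) <= 5 / 2 * eps ^ 2.
Proof.
  intros He Ht. assert (He2 : 0 < eps ^ 2) by (apply pow_lt, He).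
  assert (HT : 0 <= T1).
  { eapply Rle_trans; [apply Rabs_pos | exact Ht]. }
  assert (Htime : T1 * (eps ^ 2) ^ 2 <= (1 + m) / 10).
  { unfold T1. right. field. lra. }
  destruct (Rle_dec 0 t) as [Hpos | Hneg].
  - rewrite Rabs_pos_eq in Ht by exact Hpos.
    apply (long_time_energy m x v (fun t => trunc R0 (x t)) (dom (T1 + 1)) T1 (eps ^ 2) hm Dx Dv HT);
      try assumption.
    + apply dom_summable.
    + intros z n Hz. apply modeE_dom. apply Rabs_le. lra.
    + intros z _. apply trunc_inactive.
    + lra.
  - rewrite Rabs_left in Ht by lra.
    assert (E : forall z, Series (modeE m (fun t => x (- t)) (fun t j => - v (- t) j) z)
       = Series (modeE m x v (- z))) by (intros z; apply Series_ext, modeE_reverse).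
    rewrite <- (Ropp_involutive t), <- E.
    assert (Hrev : forall n z, mode_equation m (trunc R0 (x (- z)))
      (fun t => x (- t)) (fun t j => - v (- t) j) n z).
    { intros n z. apply mode_equation_reverse. split; [apply Dx | apply Dv]. }
    apply (long_time_energy m (fun t => x (- t)) (fun t j => - v (- t) j)
      (fun t => trunc R0 (x (- t))) (dom (T1 + 1)) T1 (eps ^ 2) hm
      (fun n z => proj1 (Hrev n z)) (fun n z => proj2 (Hrev n z)) HT); try assumption.
    + apply dom_summable.
    + intros z n Hz. rewrite modeE_reverse. apply modeE_dom. rewrite Rabs_Ropp. apply Rabs_le. lra.
    + intros z _ Hz. rewrite E in Hz. apply trunc_inactive, Hz.
    + rewrite E, Ropp_0. exact energy_0.
    + lra.
Qed.

Let lifespan_lt t : 0 < eps -> within_lifespan m eps t -> Rabs t < T1.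
Proof.
  intros He [H | H]; [lra|].
  eapply Rle_lt_trans; [exact H|].
  assert (He4 : 0 < eps ^ 4) by (apply pow_lt, He).
  assert (Hmu := mu_bounds m hm). assert (HT := T0_bound m eps hm).
  unfold T1. replace ((1 + m) / (10 * eps ^ 4)) with ((1 + m) / 10 / eps ^ 4) by (field; lra).
  apply Rmult_lt_compat_r; [apply Rinv_0_lt_compat, He4|]. nra.
Qed.

(** On a bounded time interval the high modes of the solution are uniformly small, so that the
    weight [j^(2s+4)] costs nothing beyond a suitable [N]: only the energy has to be
    controlled for a long time. *)
Lemma lifespan_control : exists (N : nat) (a b : Rbar), in_interval a b 0 /\
  (forall t, within_lifespan m eps t -> in_interval a b t) /\
  (forall t, in_interval a b t -> Series (modeE m x v t) <= 5 / 2 * eps ^ 2 /\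
    Series (fun n => Rpower (INR (S (S N) + n)) (2 * (s + 2)) * x t (S (S N) + n)%nat ^ 2)
      <= eps ^ 2).
Proof.
  destruct (Rle_lt_or_eq_dec 0 eps eps_nonneg) as [He | He].
  - assert (He2 : 0 < eps ^ 2) by (apply pow_lt, He).
    assert (HT : 0 < T1).
    { unfold T1. apply Rdiv_lt_0_compat; [lra|]. assert (0 < eps ^ 4) by apply pow_lt, He. lra. }
    assert (Hin : in_h (s + 2) am) by (apply amp_in_h; [exact hm | apply hu0 | apply hv0]).
    set (A := exp (K * T1) ^ 2).
    assert (HA : 0 < A) by (apply pow_lt, exp_pos).
    destruct (Series_tail_small _ (eps ^ 2 / A) Hin) as [N HN]; [apply Rdiv_lt_0_compat; lra|].
    specialize (HN N (le_n N)).
    exists N, (Finite (- T1)), (Finite T1).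
    split; [split; simpl; lra|]. split.
    { intros t Ht. assert (X := lifespan_lt t He Ht). apply Rabs_def2 in X.
      split; simpl; lra. }
    intros t [Ha Hb]. simpl in Ha, Hb.
    assert (Ht : Rabs t <= T1) by (apply Rabs_le; lra).
    split; [apply energy_bound; assumption|].
    set (h k := am (S (S N + k)) ^ 2 * Rpower (INR (S (S N + k))) (2 * (s + 2))) in *.
    assert (Hh : ex_series h).
    { apply (ex_series_shift (fun n => am (S n) ^ 2 * Rpower (INR (S n)) (2 * (s + 2))) (S N)), Hin. }
    apply Rle_trans with (Series (fun k => A * h k)).
    + apply Series_le; [|apply ex_series_scal_R, Hh]. intros k.
      assert (Hp := Rpower_pos (INR (S (S N) + k)) (2 * (s + 2))).
      split; [apply Rmult_le_pos; [lra | apply pow2_ge_0]|].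
      unfold h. change (S (S N + k)) with (S (S N) + k)%nat.
      rewrite (Rmult_comm (am _ ^ 2)), <- Rmult_assoc, (Rmult_comm A), Rmult_assoc.
      apply Rmult_le_compat_l; [lra|].
      unfold A. rewrite <- Rpow_mult_distr, <- pow2_abs. apply pow_incr.
      split; [apply Rabs_pos|].
      eapply Rle_trans; [apply (Bx (S N + k) t)|]. rewrite Rmult_comm.
      apply Rmult_le_compat_r; [apply amp_nonneg, hm|].
      apply exp_le, Rmult_le_compat_l; [unfold K; lra | exact Ht].
    + rewrite Series_scal_l. assert (X := Rle_abs (Series h)).
      replace (eps ^ 2) with (A * (eps ^ 2 / A)) by (field; lra).
      apply Rmult_le_compat_l; lra.
  - exists 0%nat, m_infty, p_infty. split; [split; exact I|].
    split; [intros; split; exact I|]. intros t _.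
    assert (Z := trivial_modes (eq_sym He) t).
    rewrite (Series_zero (modeE m x v t)).
    2: { intros n. unfold modeE. destruct (Z n) as [-> ->]. unfold Rdiv. ring. }
    rewrite Series_zero.
    2: { intros n. destruct (Z (1 + n)%nat) as [E _]. simpl in E |- *. rewrite E. ring. }
    assert (X := pow2_ge_0 eps). lra.
Qed.
End Lifespan.

Theorem theorem3 (m s : R) (u0 v0 : R -> R)
  (hm : m >= - 1 / 2) (hs : s > 1 / 2)
  (hu0 : in_H (s + 2) u0) (hv0 : in_H s v0)
  (heps : epsilon m u0 v0 <= 8 / 100 * sqrt (mu m)) :
  exists N : nat, (1 <= N)%nat /\
  exists (a b : Rbar) (u : R -> R -> R),
    weak_solution m s u0 v0 a b u /\
    (forall (a' b' : Rbar) (u' : R -> R -> R),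
       weak_solution m s u0 v0 a' b' u' ->
       forall t x, in_interval a b t -> in_interval a' b' t -> 0 <= x <= PI ->
         u' t x = u t x) /\
    forall t, within_lifespan m (epsilon m u0 v0) t ->
      in_interval a b t /\
      in_H (s + 2) (u t) /\
      HN_norm (s + 2) N (u t) <= 19 / 10 * epsilon m u0 v0 /\
      Rbar_le (sup_abs (u t)) (2 * epsilon m u0 v0).
Proof.
  assert (hm' : - 1 / 2 <= m) by lra. assert (hs' : 1 / 2 < s) by lra.
  set (e := epsilon m u0 v0) in *.
  assert (He : 0 <= e).
  { apply (epsilon_initial m s u0 v0 hm'); [lra | apply hu0 | apply hv0]. }
  assert (HR : 0 < e ^ 2 + 1) by (assert (X := pow2_ge_0 e); lra).
  assert (Ham : in_h (s + 2) (amp m (coef u0) (coef v0)))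
    by (apply amp_in_h; [exact hm' | apply hu0 | apply hv0]).
  destruct (truncated_solution m (e ^ 2 + 1) (coef u0) (coef v0) hm' HR)
    as [x [v [Dx [Dv [Ix [Iv [Bx Bv]]]]]]].
  { apply (h_norm_bounds_series (s + 2) 2 _ Ham). simpl. lra. }
  destruct (lifespan_control m s u0 v0 x v hm' hs' hu0 hv0 heps Dx Dv Ix Iv Bx Bv)
    as [N [a [b [H0 [Hlife Hctl]]]]].
  fold e in Hlife, Hctl.
  assert (W : weak_solution m s u0 v0 a b (mode_sum x)).
  { apply (mode_sum_weak_solution m s (e ^ 2 + 1) u0 v0 x v); try assumption.
    intros t Ht. destruct (Hctl t Ht) as [HE _].
    apply (trunc_inactive m s u0 v0 x v hm' hs' hu0 hv0 Bx Bv).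
    fold e. assert (X := pow2_ge_0 e). lra. }
  exists (S N). split; [lia|]. exists a, b, (mode_sum x).
  split; [exact W|]. split.
  { intros a' b' u' W' t y Ht Ht' Hy.
    apply (weak_solution_unique m s u0 v0 a b a' b' (mode_sum x) u' t y); assumption. }
  intros t Ht. assert (Hin := Hlife t Ht). destruct (Hctl t Hin) as [HE Htail].
  assert (Hcoef := mode_sum_coef m s (e ^ 2 + 1) u0 v0 x hm' hs' HR hu0 hv0 Bx t).
  destruct (kirch_le_energy m x v t hm'
    (energy_summable m s u0 v0 x v hm' hs' hu0 hv0 Bx Bv t)) as [K1 [K2 _]].
  assert (Hen := energy_summable m s u0 v0 x v hm' hs' hu0 hv0 Bx Bv t).
  split; [exact Hin|]. split.
  { apply (mode_sum_in_H m s (e ^ 2 + 1) u0 v0 x); assumption. }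
  assert (HS : Series (fun n => INR (S n) ^ 2 * x t (S n) ^ 2) <= 5 / 2 * e ^ 2).
  { eapply Rle_trans; [apply (Series_le _ _ K1 Hen) | exact HE]. }
  split.
  - apply HN_norm_le; [exact He | |].
    + rewrite (sum_n_ext (G := R_AbelianMonoid) _ (fun n => INR (S n) ^ 2 * x t (S n) ^ 2))
        by (intros n; now rewrite Hcoef).
      eapply Rle_trans; [apply sum_n_le_Series; [intros n; apply K1 | exact K2] | exact HS].
    + rewrite (Series_ext _ (fun n => Rpower (INR (S (S N) + n)) (2 * (s + 2))
        * x t (S (S N) + n)%nat ^ 2)); [exact Htail|].
      intros n. now rewrite (Hcoef (S N + n)%nat : coef (mode_sum x t) (S (S N) + n) = _).
  - apply sup_abs_le. intros y _. apply sine_series_sup; assumption.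
Qed.
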